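(* Let $X$ be a compact metric space, $f:X\to X$ a homeomorphism and $\mu$ an $f$-invariant Borel probability measure on $X$. Let $J\subset C(X,\mathbb{R})$ be a segment such that $\{(E,v)\in\mathbb{R}\times J: L(E-v)>0\}$ is dense in $\mathbb{R}\times J$. Then for almost every $v\in J$, the set $\{E\in\mathbb{R}: L(E-v)>0\}$ is dense in $\mathbb{R}$.
   Context: A segment is a set $J=\{(1-s)v_0+s v_1: s\in[0,1]\}$ with $v_0\neq v_1$ in $C(X,\mathbb{R})$; ''almost every $v\in J$'' means for Lebesgue almost every parameter $s\in[0,1]$. $C(X,\mathbb{R})$ carries the uniform topology. For $A\in C(X,\mathrm{SL}(2,\mathbb{R}))$ and $n\ge 1$ put $A_n(x)=A(f^{n-1}(x))\cdots A(x)$ and $L(A)=\lim_{n\to\infty}\frac1n\int_X\ln\|A_n(x)\|\,d\mu(x)$ (the Lyapunov exponent). For $v\in C(X,\mathbb{R})$ let $A^{(v)}(x)=\begin{pmatrix} v(x)&-1\\1&0\end{pmatrix}$ and $L(v)=L(A^{(v)})$. *)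

(* Defs.v *)
(* MathComp-Analysis. *)
From HB Require Import structures.
From mathcomp Require Import all_boot all_order all_algebra.
From mathcomp Require Import all_classical all_reals all_analysis.

Set Implicit Arguments.
Unset Strict Implicit.
Unset Printing Implicit Defensive.

Import Order.TTheory GRing.Theory Num.Theory.
Import numFieldNormedType.Exports.

Local Open Scope classical_set_scope.
Local Open Scope ring_scope.

(* The library's measurable types are pointed.  The base point costs no
   generality here: a space carrying a probability measure is nonempty. *)
#[short(type="pmetricType")]
HB.structure Definition PointedMetric (R : numDomainType) :=
  {M of Metric R M & Pointed M}.

Definition borelType (R : realType) (X : pmetricType R) :=
  g_sigma_algebraType (@open X).

Definition homeomorphism (X Y : topologicalType) (f : X -> Y) : Prop :=
  continuous f /\
  exists g : Y -> X, [/\ continuous g, cancel f g & cancel g f].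

Definition invariant_measure (R : realType) (X : pmetricType R) (f : X -> X)
    (mu : set (borelType X) -> \bar R) : Prop :=
  forall B : set (borelType X), measurable B -> mu (f @^-1` B) = mu B.

(* [S] is a dense subset of [D] for the topology induced on [D]. *)
Definition dense_subset (T : topologicalType) (S D : set T) : Prop :=
  S `<=` D /\ D `<=` closure S.

Section Lyapunov.
Variable R : realType.

Definition norm2 n (u : 'cV[R]_n) : R := Num.sqrt (\sum_i u i 0 ^+ 2).

(* Operator norm for the Euclidean norm; the library's norm on matrices is the
   largest absolute value of an entry. *)
Definition opnorm n (A : 'M[R]_n) : R :=
  sup [set norm2 (A *m u) | u in [set u : 'cV[R]_n | norm2 u = 1]].

Variables (X : pmetricType R) (f : X -> X) (mu : probability (borelType X) R).

Fixpoint cocycle (A : X -> 'M[R]_2) (n : nat) (x : X) : 'M[R]_2 :=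
  if n is m.+1 then A (iter m f x) *m cocycle A m x else 1%:M.

(* For continuous [A] with values in SL(2,R) the sequence converges by
   subadditivity, so that [limn] is its genuine limit. *)
Definition lyapunov (A : X -> 'M[R]_2) : R :=
  limn (fun n : nat =>
    n%:R^-1 * \int[mu]_x ln (opnorm (cocycle A n x))).

Definition schrodinger (v : X -> R) (x : X) : 'M[R]_2 :=
  \matrix_(i < 2, j < 2)
    if i == 0 then (if j == 0 then v x else -1) else (if j == 0 then 1 else 0).

Definition lyapunov_schrodinger (v : X -> R) : R := lyapunov (schrodinger v).

Definition segment_pt (v0 v1 : X -> R) (s : R) : X -> R :=
  fun x => (1 - s) * v0 x + s * v1 x.

(* C(X,R) is the subspace of continuous functions of [{uniform X -> R}]; for
   continuous [v0] and [v1] the segment lies in it. *)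
Definition segment (v0 v1 : X -> R) : set {uniform X -> R} :=
  [set segment_pt v0 v1 s | s in `[0, 1]].

End Lyapunov.

Lemma det_schrodinger (R : realType) (X : pmetricType R) (v : X -> R) (x : X) :
  \det (schrodinger v x) = 1.
Proof.
rewrite (expand_det_row _ ord0) !big_ord_recl big_ord0 /cofactor !det_mx11.
by rewrite !mxE /= !expr1 !mulr0 !mulr1 mulN1r opprK addr0 add0r.
Qed.

(* Main.v *)
(* Write L(E, s) for the Lyapunov exponent of E - (v0 + s (v1 - v0)).  For an
   interval I, let Z be the set of the s such that L(E, s) = 0 for all E in I.
   Suppose that Z accumulates at one of its points s0, and let E0 be the midpoint
   of I.  The finite scale potentials F = 1/n ln |D_n(E + i eta, s)|, where D_n is
   the Dirichlet determinant, are harmonic along the parabola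
   t |-> (E0 + r t + i eta, s0 + kappa (1 - t^2)), whose image is in the half plane
   of hyperbolicity for Im t > 0.  By Cauchy's theorem on the rectangle
   [-1, 1] x [0, 1], the integral of F against (1 - t^2)^m over [-1, 1] is an
   integral over the other three sides, where F is expanded in powers of
   s - s0.  The Taylor coefficients are determined by the integrals over
   horizontal segments s = const near s0, hence by the points of Z, where F tends
   to 0; so the average of F along the parabola is small.  As F is a logarithmic
   average of the distances to the zeros of a polynomial in t, its value at t = 0
   is controlled by its average.  Thus L(E0, s0 + kappa) = 0 for small kappa, so
   L vanishes on an open box, against the density assumption.  Hence Z is discrete
   and countable; the bad parameters are covered by the sets Z of the intervals
   with rational endpoints.

   To avoid contour integration, Cauchy's theorem is used for Riemann sums on a
   grid of mesh 1/N; uniformity in the base point x then allows all estimates to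
   be integrated against mu before n tends to infinity. *)

Require Import Defs.
From mathcomp Require Import all_boot all_order all_algebra.
From mathcomp Require Import all_classical all_reals all_analysis.
From mathcomp Require Import complex ring lra zify.

Set Implicit Arguments.
Unset Strict Implicit.
Unset Printing Implicit Defensive.

Import Order.TTheory GRing.Theory Num.Theory.
Import numFieldNormedType.Exports.
Import ComplexField.Normc.

Local Open Scope classical_set_scope.
Local Open Scope complex_scope.
Local Open Scope ring_scope.

(** At height eta > 0 the determinant is bounded below independently of n, so F >= - ln (2 / eta) /
    n; the vanishing of L is used only as an upper bound, by semicontinuity. At Im t = y the k-th
    Taylor coefficient in s may be as large as (2 C / (r y))^k. On the three upper sides |1 - t^2|
    <= 3 Im t, so the power (1 - t^2)^m absorbs this growth down to the corners. The parabola is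
    chosen because its increment kappa (1 - t^2) is a multiple of that weight: its expansion
    involves the same coefficients, with weight m + k at order k. Truncation at order m costs (18 C
    kappa / r)^m and undoing the weight near t = 0 costs (4/3)^m; for 36 C kappa <= r the product is
    at most (2/3)^m. No mean value property on a disc around t = 0 is available, since F is harmonic
    on one side only. Instead each logarithm is compared with its average over a short interval,
    with a loss of order one only for the few roots close to 0. Uniformity in n and in the base
    point holds because the determinant has at most 2n roots in t and its logarithm is divided by n:
    difference quotients are bounded by the distance to the roots alone. *)

Notation Re := complex.Re.
Notation Im := complex.Im.

(** * Complex modulus and continuants *)

Section ComplexModulus.
Variable R : realType.
Implicit Types (x y z : R[i]) (a b : R).

Lemma normcD x y : normc (x + y) <= normc x + normc y.
Proof. exact: le_normcD. Qed.

Lemma normcNN z : normc (- z) = normc z.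
Proof. exact: normcN. Qed.

Lemma normc_sqr z : normc z ^+ 2 = Re z ^+ 2 + Im z ^+ 2.
Proof. by case: z => a b /=; rewrite sqr_sqrtr // addr_ge0 ?sqr_ge0. Qed.

Lemma normc_ge0 z : 0 <= normc z.
Proof. by case: z => a b /=; exact: sqrtr_ge0. Qed.

Lemma normc_eq0 z : (normc z == 0) = (z == 0).
Proof.
apply/eqP/eqP => [/eq0_normc//|->]; exact: normc0.
Qed.

Lemma normc_gt0 z : (0 < normc z) = (z != 0).
Proof. by rewrite lt_neqAle normc_ge0 andbT eq_sym normc_eq0. Qed.

Lemma normc_real a : normc a%:C = `|a|.
Proof. by rewrite /= expr0n addr0 sqrtr_sqr. Qed.

Lemma normci : normc ('i : R[i]) = 1.
Proof. by rewrite /= expr0n add0r expr1n sqrtr1. Qed.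

Lemma normcX z n : normc (z ^+ n) = normc z ^+ n.
Proof.
elim: n => [|n IH]; first by rewrite !expr0 normc1.
by rewrite !exprS normcM IH.
Qed.

Lemma normc_Re z : `|Re z| <= normc z.
Proof.
rewrite -(@ler_pXn2r _ 2) ?nnegrE ?normc_ge0 //.
by rewrite normc_sqr real_normK ?num_real // lerDl sqr_ge0.
Qed.

Lemma normc_Im z : `|Im z| <= normc z.
Proof.
rewrite -(@ler_pXn2r _ 2) ?nnegrE ?normc_ge0 //.
by rewrite normc_sqr real_normK ?num_real // lerDr sqr_ge0.
Qed.

Lemma normc_le_Re_Im z : normc z <= `|Re z| + `|Im z|.
Proof.
rewrite -(@ler_pXn2r _ 2) ?nnegrE ?normc_ge0 ?addr_ge0 //.
rewrite normc_sqr sqrrD !real_normK ?num_real //.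
by have := mulr_ge0 (normr_ge0 (Re z)) (normr_ge0 (Im z)); lra.
Qed.

Lemma normc_sum I (r : seq I) (P : pred I) (F : I -> R[i]) :
  normc (\sum_(i <- r | P i) F i) <= \sum_(i <- r | P i) normc (F i).
Proof.
elim/big_ind2: _ => //; first by rewrite normc0.
by move=> x1 x2 y1 y2 h1 h2; apply: le_trans (normcD _ _) _; exact: lerD.
Qed.

Lemma normcB x y : normc (x - y) = normc (y - x).
Proof. by rewrite -opprB normcNN. Qed.

Lemma le_normcB x y : normc (x - y) <= normc x + normc y.
Proof. by have := normcD x (- y); rewrite normcNN. Qed.

Lemma normcB_ge x y : normc x - normc y <= normc (x - y).
Proof. by rewrite lerBlDr; have := normcD (x - y) y; rewrite subrK. Qed.

Lemma normc_conj z : normc (conjc z) = normc z.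
Proof. by case: z => a b /=; rewrite sqrrN. Qed.

Lemma cReD x y : Re (x + y) = Re x + Re y. Proof. by case: x y => ? ? []. Qed.
Lemma cImD x y : Im (x + y) = Im x + Im y. Proof. by case: x y => ? ? []. Qed.
Lemma cReN x : Re (- x) = - Re x. Proof. by case: x. Qed.
Lemma cImN x : Im (- x) = - Im x. Proof. by case: x. Qed.
Lemma cReM x y : Re (x * y) = Re x * Re y - Im x * Im y.
Proof. by case: x y => ? ? []. Qed.
Lemma cImM x y : Im (x * y) = Re x * Im y + Im x * Re y.
Proof. by case: x y => ? ? []. Qed.
Lemma cReJ x : Re (conjc x) = Re x. Proof. by case: x. Qed.
Lemma cImJ x : Im (conjc x) = - Im x. Proof. by case: x. Qed.

Definition reim := (cReD, cImD, cReN, cImN, cReM, cImM, cReJ, cImJ).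

Lemma cRe_sum I (r : seq I) (P : pred I) (F : I -> R[i]) :
  Re (\sum_(i <- r | P i) F i) = \sum_(i <- r | P i) Re (F i).
Proof. by elim/big_rec2: _ => // i u v _ <-; rewrite cReD. Qed.

Lemma complexP x y : Re x = Re y -> Im x = Im y -> x = y.
Proof. by case: x y => ? ? [] ? ? /= -> ->. Qed.

Lemma prod_XsubC_neq0 (c : R[i]) (rs : seq R[i]) z :
  (c *: \prod_(r <- rs) ('X - r%:P)).[z] = c * \prod_(r <- rs) (z - r).
Proof.
rewrite hornerZ horner_prod; congr (_ * _).
by apply: eq_bigr => r _; rewrite hornerXsubC.
Qed.

Lemma logder_prod (c : R[i]) (rs : seq R[i]) z :
  let p := c *: \prod_(r <- rs) ('X - r%:P) in
  p.[z] != 0 -> p^`().[z] / p.[z] = \sum_(r <- rs) (z - r)^-1.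
Proof.
elim: rs => [|r rs IH] /=.
  by rewrite !big_nil alg_polyC derivC horner0 mul0r.
rewrite !big_cons; set p := c *: \prod_(j <- rs) _ in IH *.
rewrite scalerAr -/p => nz.
have := nz; rewrite hornerM mulf_eq0 negb_or => /andP[zr pz].
rewrite hornerXsubC in zr.
rewrite derivM derivXsubC mul1r hornerD !hornerM !hornerXsubC -IH //.
by field; rewrite zr pz.
Qed.

Lemma closed_roots (p : {poly R[i]}) :
  {rs : seq R[i] | p = lead_coef p *: \prod_(r <- rs) ('X - r%:P)}.
Proof. exact: closed_field_poly_normal. Qed.

End ComplexModulus.

(** * Derivatives of complex valued paths *)

Section PathDerivative.
Variable R : realType.
Implicit Types (g h : R -> R[i]) (t u : R) (d e : R[i]).

(** Holomorphic functions are only ever differentiated along real segments, so a componentwise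
    derivative in one real variable suffices. *)
Definition cder g t d :=
  is_derive t 1 (fun u => Re (g u)) (Re d) /\
  is_derive t 1 (fun u => Im (g u)) (Im d).

Lemma cder_eq g t d e : cder g t d -> d = e -> cder g t e.
Proof. by move=> + <-. Qed.

Lemma cder_ext g h t d : g =1 h -> cder g t d -> cder h t d.
Proof. by move=> /funext ->. Qed.

Lemma cder_cst (c : R[i]) t : cder (fun=> c) t 0.
Proof. by split; exact: is_derive_cst. Qed.

Lemma cder_real t : cder (fun u => u%:C) t 1.
Proof. by split; [exact: is_derive_id|exact: is_derive_cst]. Qed.

Lemma cderD g h t d e : cder g t d -> cder h t e ->
  cder (fun u => g u + h u) t (d + e).
Proof.
move=> [g1 g2] [h1 h2]; split.
- rewrite (_ : (fun _ => _) = (fun u => Re (g u)) \+ (fun u => Re (h u))).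
    by rewrite cReD; exact: is_deriveD.
  by apply/funext => u; rewrite /= cReD.
- rewrite (_ : (fun _ => _) = (fun u => Im (g u)) \+ (fun u => Im (h u))).
    by rewrite cImD; exact: is_deriveD.
  by apply/funext => u; rewrite /= cImD.
Qed.

Lemma is_deriveMf (f g : R -> R) t a b : is_derive t 1 f a ->
  is_derive t 1 g b -> is_derive t 1 (fun u => f u * g u) (f t * b + a * g t).
Proof.
move=> hf hg; apply: (is_derive_eq (is_deriveM hf hg)).
by rewrite /GRing.scale /= [g t * a]mulrC.
Qed.

Lemma cderM g h t d e : cder g t d -> cder h t e ->
  cder (fun u => g u * h u) t (g t * e + d * h t).
Proof.
move=> [g1 g2] [h1 h2]; split.
- rewrite (_ : (fun _ => _) = (fun u => Re (g u) * Re (h u)) -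
    (fun u => Im (g u) * Im (h u))); last first.
    by apply/funext => u; rewrite /= cReM.
  by apply: (is_derive_eq (is_deriveB (is_deriveMf g1 h1) (is_deriveMf g2 h2)));
    rewrite !reim; ring.
- rewrite (_ : (fun _ => _) = (fun u => Re (g u) * Im (h u)) \+
    (fun u => Im (g u) * Re (h u))); last first.
    by apply/funext => u; rewrite /= cImM.
  by apply: (is_derive_eq (is_deriveD (is_deriveMf g1 h2) (is_deriveMf g2 h1)));
    rewrite !reim; ring.
Qed.

Lemma cder_horner (p : {poly R[i]}) g t d : cder g t d ->
  cder (fun u => p.[g u]) t (p^`().[g t] * d).
Proof.
move=> hg; elim/poly_ind: p => [|p c IH].
  apply: (@cder_ext (fun=> 0)); first by move=> u; rewrite horner0.
  by apply: cder_eq (cder_cst 0 t) _; rewrite derivC horner0 mul0r.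
apply: (@cder_ext (fun u => p.[g u] * g u + c)).
  by move=> u; rewrite hornerMXaddC.
apply: cder_eq; first by apply: cderD; [apply: cderM; [exact: IH|exact: hg]|exact: cder_cst].
by rewrite derivMXaddC hornerD hornerMX addr0; ring.
Qed.

Lemma cder_conj g t d : cder g t d -> cder (fun u => conjc (g u)) t (conjc d).
Proof.
move=> [g1 g2]; split.
  rewrite (_ : (fun _ => _) = (fun u => Re (g u))).
    by rewrite cReJ.
  by apply/funext => u; rewrite cReJ.
rewrite (_ : (fun _ => _) = - (fun u => Im (g u))).
  by rewrite cImJ; exact: is_deriveN.
by apply/funext => u; rewrite /= cImJ.
Qed.

Lemma ln_normc (z : R[i]) : z != 0 ->
  ln (normc z) = 2^-1 * ln (Re z ^+ 2 + Im z ^+ 2).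
Proof.
move=> z0; have nz : 0 < normc z by rewrite normc_gt0.
by rewrite -normc_sqr lnXn // mulr2n; field.
Qed.

Lemma is_derive_ln_normc g t d : cder g t d -> g t != 0 ->
  is_derive t 1 (fun u => ln (normc (g u))) (Re (d / g t)).
Proof.
move=> [g1 g2] g0.
pose N u := Re (g u) ^+ 2 + Im (g u) ^+ 2.
have N0 : 0 < N t by rewrite /N -normc_sqr exprn_gt0 // normc_gt0.
have dN : is_derive t 1 N (2 * (Re (g t) * Re d + Im (g t) * Im d)).
  rewrite (_ : N = (fun u => Re (g u) * Re (g u)) \+ (fun u => Im (g u) * Im (g u))).
    by apply: (is_derive_eq (is_deriveD (is_deriveMf g1 g1) (is_deriveMf g2 g2))); ring.
  by apply/funext => u; rewrite /N /= !expr2.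
have dl : is_derive t 1 (fun u => 2^-1 * ln (N u)) (Re (d / g t)).
  have h := is_derive1_comp (is_derive1_ln N0) dN.
  apply: (is_derive_eq (is_deriveZ 2^-1 h)); rewrite /GRing.scale /=.
  rewrite /N in N0 *; case: (g t) N0 => a b /= N0; case: d {g1 g2 dN h} => c e /=.
  by field; rewrite gt_eqF.
have gn0 : \forall u \near t, g u != 0.
  have cN : {for t, continuous N}.
    by apply: differentiable_continuous; apply/derivable1_diffP; case: dN.
  near=> u.
  have : 0 < N u by near: u; exact: (cvgr_gt _ cN _ N0).
  by rewrite /N -normc_sqr; apply: contraTneq => ->; rewrite normc0 expr0n ltxx.
apply: near_eq_is_derive dl.
by near=> u; rewrite ln_normc //; near: u.
Unshelve. all: by end_near. Qed.

(** In the upper half plane [atan (Re z / Im z)] is [pi / 2] minus the argument of z; hence the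
    minus sign in front of the imaginary part of the logarithmic derivative. *)
Lemma is_derive_atan_ratio g t d : cder g t d -> Im (g t) != 0 ->
  is_derive t 1 (fun u => atan (Re (g u) / Im (g u))) (- Im (d / g t)).
Proof.
move=> [g1 g2] g0.
have dV : is_derive t 1 (fun u => (Im (g u))^-1) (- (Im (g t)) ^- 2 * Im d).
  exact: (is_derive_eq (is_deriveV g0 g2) _).
have dr := is_deriveMf g1 dV.
apply: (is_derive_eq (is_derive1_comp (is_derive1_atan _) dr)).
case: (g t) g0 => a b /= b0; case: d {g1 g2 dV dr} => c e /=.
have b2 : 0 < b ^+ 2 by rewrite exprn_even_gt0.
have h : a ^+ 2 + b ^+ 2 != 0 by rewrite gt_eqF // ltr_wpDl ?sqr_ge0.
by field; rewrite h b0.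
Qed.

(** The mean value theorem is applied to the real and the imaginary part separately, at different
    intermediate points; this costs the factor 2. *)
Lemma cder_mean_value g (g' : R -> R[i]) (K : R) :
  (forall t, 0 <= t <= 1 -> cder g t (g' t)) ->
  (forall t, 0 <= t <= 1 -> normc (g' t) <= K) ->
  normc (g 1 - g 0) <= 2 * K.
Proof.
move=> gd gK.
have main (pr : R[i] -> R) :
    (forall t, 0 <= t <= 1 -> is_derive t 1 (fun u => pr (g u)) (pr (g' t))) ->
    (forall z, `|pr z| <= normc z) -> `|pr (g 1) - pr (g 0)| <= K.
  move=> dp lep.
  have [|||c] := @MVT R (fun u => pr (g u)) (fun u => pr (g' u)) 0 1.
  - exact: ltr01.
  - by move=> t; rewrite in_itv /= => /andP[t0 t1]; apply: dp; rewrite !ltW.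
  - apply: derivable_within_continuous => t; rewrite in_itv /= => t01.
    by case: (dp t t01).
  rewrite in_itv /= => /andP[c0 c1] ->; rewrite subr0 mulr1.
  by apply: le_trans (lep _) (gK _ _); rewrite !ltW.
apply: le_trans (normc_le_Re_Im _) _; rewrite !reim mulr_natl mulr2n.
apply: lerD; apply: main => //.
- by move=> t /gd[].
- exact: normc_Re.
- by move=> t /gd[].
- exact: normc_Im.
Qed.

End PathDerivative.

(** * Continuants, that is, Dirichlet determinants *)

Section Continuant.
Variable K : nzRingType.

(** The pair holds two consecutive values, which makes the second order recursion structural.
    [dp a n] is the determinant of the n by n tridiagonal matrix with diagonal a and off-diagonal
    entries 1. *)
Fixpoint dpair (a : nat -> K) n : K * K :=
  if n is m.+1 then (a m * (dpair a m).1 - (dpair a m).2, (dpair a m).1)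
  else (1, 0).

Definition dp a n := (dpair a n).1.

Lemma dp0 a : dp a 0 = 1. Proof. by []. Qed.

Lemma dp1 a : dp a 1 = a 0. Proof. by rewrite /dp /= mulr1 subr0. Qed.

Lemma dpSS a n : dp a n.+2 = a n.+1 * dp a n.+1 - dp a n. Proof. by []. Qed.

Lemma dp_ind (P : nat -> Prop) :
  P 0%N -> P 1%N -> (forall n, P n -> P n.+1 -> P n.+2) -> forall n, P n.
Proof.
move=> P0 P1 PS n; suff [] : P n /\ P n.+1 by [].
by elim: n => // n [h1 h2]; split => //; exact: PS.
Qed.

End Continuant.

Section ContinuantComm.
Variable K : comNzRingType.

(** Expansion along the first row, whereas the definition expands along the last one. *)
Lemma dp_shift (a : nat -> K) n :
  dp a n.+2 = a 0 * dp (a \o succn) n.+1 - dp (a \o succn \o succn) n.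
Proof.
elim/dp_ind: n => [||n IH1 IH2].
- by rewrite dpSS !dp1 !dp0 /=; ring.
- by rewrite !dpSS !dp1 !dp0 /=; ring.
- by rewrite dpSS IH2 IH1 !dpSS /=; ring.
Qed.

(** The four continuants are, up to sign, the entries of the transfer matrix, which has determinant
    1. *)
Lemma dp_wronskian (a : nat -> K) n :
  dp a n.+1 * dp (a \o succn) n.+1 - dp a n.+2 * dp (a \o succn) n = 1.
Proof.
elim: n => [|n IH]; first by rewrite !dpSS !dp1 !dp0 /=; ring.
by rewrite -[RHS]IH [dp a n.+3]dpSS [dp (a \o succn) n.+2]dpSS /=; ring.
Qed.

Lemma dp_horner (b : nat -> {poly K}) n z :
  (dp b n).[z] = dp (fun k => (b k).[z]) n.
Proof.
elim/dp_ind: n => [||n h1 h2]; first by rewrite !dp0 hornerC.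
  by rewrite !dp1.
by rewrite !dpSS hornerD hornerN hornerM h1 h2.
Qed.

Lemma size_dp (b : nat -> {poly K}) d n :
  (forall k, (size (b k) <= d.+1)%N) -> (size (dp b n) <= (d * n).+1)%N.
Proof.
move=> sb; elim/dp_ind: n => [||n h1 h2].
- by rewrite dp0 size_poly1.
- by rewrite dp1 muln1.
- rewrite dpSS (leq_trans (size_polyD _ _)) // size_polyN geq_max.
  have := sb n.+1; have := size_polyMleq (b n.+1) (dp b n.+1).
  move: h1 h2; rewrite !mulnS; move: (size _) (size _) (size _) (size _) => A B C D.
  by move: (d * n)%N => E hD hC hB hA; apply/andP; split; lia.
Qed.

Lemma map_dp (K' : comNzRingType) (f : {rmorphism K -> K'}) a n :
  f (dp a n) = dp (f \o a) n.
Proof.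
elim/dp_ind: n => [||n h1 h2]; rewrite ?dp0 ?dp1 ?rmorph1 //.
by rewrite !dpSS rmorphB rmorphM h1 h2.
Qed.

End ContinuantComm.

Section UpperHalfPlane.
Variable R : realType.
Implicit Types (a : nat -> R[i]) (e Q : R).

(** The ratio of consecutive values obeys q -> a - 1/q, which preserves the upper half plane. The
    ratio is written as a product with a conjugate, so that no division by a possibly vanishing term
    occurs. *)
Lemma dp_upper a n : (forall k, 0 < Im (a k)) ->
  dp a n != 0 /\ 0 < Im (dp a n.+1 * conjc (dp a n)).
Proof.
move=> ap; elim: n => [|n [h1 h2]].
  by rewrite dp0 dp1 oner_neq0 conjc1 mulr1.
have nz : dp a n.+1 != 0 by apply: contraTneq h2 => ->; rewrite mul0r ltxx.
split=> //; rewrite dpSS.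
have {}nz : 0 < normc (dp a n.+1) ^+ 2 by rewrite exprn_gt0 // normc_gt0.
move: (ap n.+1) h2 nz; rewrite normc_sqr !reim => p q r.
have := mulr_gt0 p r; nra.
Qed.

Lemma dp_upper_le a e n : 0 < e -> (forall k, e <= Im (a k)) ->
  e * normc (dp a n) ^+ 2 <= Im (dp a n.+1 * conjc (dp a n)).
Proof.
move=> e0 ap; have ap0 k : 0 < Im (a k) by exact: lt_le_trans (ap k).
case: n => [|n]; first by rewrite dp0 dp1 conjc1 mulr1 normc1 expr1n mulr1.
have [_] := dp_upper n ap0; rewrite dpSS.
have nz : 0 <= normc (dp a n.+1) ^+ 2 by rewrite exprn_ge0 // normc_ge0.
have := ap n.+1; move: nz; rewrite normc_sqr !reim => r p q.
have := ler_wpM2r r p; nra.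
Qed.

Lemma mulr_conj_le (x y : R[i]) e : y != 0 ->
  e * normc y ^+ 2 <= Im (x * conjc y) -> e * normc y <= normc x.
Proof.
move=> y0 h; have ny : 0 < normc y by rewrite normc_gt0.
rewrite -(ler_pM2r ny) -mulrA -expr2 (le_trans h) //.
by rewrite (le_trans (ler_norm _)) // (le_trans (normc_Im _)) // normcM normc_conj.
Qed.

Lemma dp_growth a e n : 0 < e -> (forall k, e <= Im (a k)) ->
  e * normc (dp a n) <= normc (dp a n.+1).
Proof.
move=> e0 ap; have ap0 k : 0 < Im (a k) by exact: lt_le_trans (ap k).
by apply: mulr_conj_le; [case: (dp_upper n ap0)|exact: dp_upper_le].
Qed.

(** Mirror image of [dp_growth]: the first entry is removed instead of the last, by the same half
    plane argument applied to [dp_shift]. *)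
Lemma dp_growth_shift a e n : 0 < e -> (forall k, e <= Im (a k)) ->
  e * normc (dp (a \o succn) n) <= normc (dp a n.+1).
Proof.
move=> e0; elim: n a => [|n IH] a ap.
  rewrite dp0 dp1 normc1 mulr1.
  exact: le_trans (ap 0%N) (le_trans (ler_norm _) (normc_Im _)).
have ap0 k : 0 < Im (a k) by exact: lt_le_trans (ap k).
have ap1 k : 0 < Im ((a \o succn) k) by exact: ap0.
apply: mulr_conj_le; first by case: (dp_upper n.+1 ap1).
suff {IH} main m : forall a', (forall k, e <= Im (a' k)) ->
    e * normc (dp (a' \o succn) m) ^+ 2 <=
      Im (dp a' m.+1 * conjc (dp (a' \o succn) m)) by exact: main.
elim: m => [|m IH] a' ap'.
  by rewrite dp0 dp1 conjc1 mulr1 normc1 expr1n mulr1.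
have := IH (a' \o succn) (fun k => ap' k.+1); rewrite dp_shift.
have : 0 <= normc (dp (a' \o succn) m.+1) ^+ 2 by rewrite exprn_ge0 // normc_ge0.
have : 0 <= e * normc (dp ((a' \o succn) \o succn) m) ^+ 2.
  by rewrite mulr_ge0 ?exprn_ge0 ?normc_ge0 // ltW.
move: (ap' 0%N); rewrite !normc_sqr !reim => r p q.
have := ler_wpM2r q r; nra.
Qed.

(** The growth lemmas bound the other three entries of the transfer matrix by multiples of D = |dp a
    n|; inserted into the Wronskian identity they give e^2 <= 2 D^2. The bound does not depend on n,
    so after division by n the logarithm is almost nonnegative. *)
Lemma dp_ge a e n : 0 < e <= 1 -> (forall k, e <= Im (a k)) ->
  e / 2 <= normc (dp a n).
Proof.
move=> /andP[e0 e1] ap; case: n => [|[|n]].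
- by rewrite dp0 normc1; lra.
- have := le_trans (ap 0%N) (le_trans (ler_norm _) (normc_Im _)).
  by rewrite dp1; lra.
pose D : R := normc (dp a n.+2); rewrite -/D.
have h1 : e * normc (dp a n.+1) <= D by exact: dp_growth.
have h2 : e * normc (dp (a \o succn) n.+1) <= D by exact: dp_growth_shift.
have h3 : e * normc (dp (a \o succn) n) <= normc (dp (a \o succn) n.+1).
  by apply: dp_growth => // k; exact: ap.
have := congr1 (@normc R) (dp_wronskian a n); rewrite normc1 => /esym h4.
have h5 : 1 <= normc (dp a n.+1) * normc (dp (a \o succn) n.+1)
    + D * normc (dp (a \o succn) n).
  by rewrite {1}h4 (le_trans (le_normcB _ _)) // !normcM.
have D0 : 0 <= D by exact: normc_ge0.
have [n1 n2 n3] : [/\ 0 <= normc (dp a n.+1), 0 <= normc (dp (a \o succn) n.+1)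
  & 0 <= normc (dp (a \o succn) n)] by rewrite !normc_ge0.
move: n1 n2 n3 h1 h2 h3 h5 {h4}; move: (normc _) (normc _) (normc _) => w v u.
move=> u0 v0 w0 h1 h2 h3 h5.
have e2 : e * v * (e * u) <= D * D by rewrite ler_pM // ?mulr_ge0 // ltW.
have e3 : D * (e * (e * w)) <= D * D.
  by rewrite ler_wpM2l // (le_trans _ h2) // ler_wpM2l // ltW.
have e4 : e ^+ 2 <= 2 * D ^+ 2.
  have := ler_wpM2l (sqr_ge0 e) h5; rewrite mulr1.
  have -> : e ^+ 2 * (u * v + D * w) = e * v * (e * u) + D * (e * (e * w)) by ring.
  by move=> h6; rewrite expr2; lra.
have eh : 0 <= e / 2 by rewrite divr_ge0 // ltW.
rewrite -(@ler_pXn2r _ 2) ?nnegrE // expr_div_n ler_pdivrMr ?exprn_gt0 //.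
apply: le_trans e4 _; rewrite mulrC ler_wpM2l ?sqr_ge0 //; lra.
Qed.

Lemma dp_le a Q n : 0 <= Q -> (forall k, normc (a k) <= Q) ->
  normc (dp a n) <= (Q + 1) ^+ n.
Proof.
move=> Q0 aQ; have Q1 : 0 <= Q + 1 by rewrite addr_ge0.
elim/dp_ind: n => [||n h1 h2].
- by rewrite dp0 normc1 expr0.
- by rewrite dp1 expr1 (le_trans (aQ _)) // lerDl.
- rewrite dpSS (le_trans (le_normcB _ _)) // normcM exprS mulrDl mul1r lerD //.
    by rewrite ler_pM ?normc_ge0.
  by rewrite (le_trans h1) // exprS ler_peMl ?exprn_ge0 // lerDr.
Qed.

(** Each summand, with its sign, is the argument of a ratio of consecutive continuants minus
    [pi / 2]; the constant shift is harmless. *)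
Definition argdp a n : R :=
  - \sum_(k < n) atan (Re (dp a k.+1 * conjc (dp a k)) /
                       Im (dp a k.+1 * conjc (dp a k))).

(* A holomorphic branch of log (dp a n) as long as all the a k have positive
   imaginary part: then so have the successive ratios dp a k.+1 / dp a k. *)
Definition logdp a n : R[i] := ln (normc (dp a n)) +i* argdp a n.

Lemma cder_logdp (b : nat -> {poly R[i]}) (g : R -> R[i]) t d n rs :
  cder g t d -> (forall k, 0 < Im (b k).[g t]) ->
  dp b n = lead_coef (dp b n) *: \prod_(r <- rs) ('X - r%:P) ->
  cder (fun u => logdp (fun k => (b k).[g u]) n) t
    (d * \sum_(r <- rs) (g t - r)^-1).
Proof.
move=> gd bp brs; set a := fun k => (b k).[g t].
have E k u : dp (fun k => (b k).[g u]) k = (dp b k).[g u] by rewrite dp_horner.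
pose e k := (dp b k)^`().[g t] * d.
have de k : cder (fun u => dp (fun k => (b k).[g u]) k) t (e k).
  by apply: cder_ext (cder_horner (dp b k) gd) => u; rewrite E.
have nz k : dp a k != 0 by case: (dp_upper k bp).
have -> : d * \sum_(r <- rs) (g t - r)^-1 = e n / dp a n.
  rewrite /e /a E; have := nz n; rewrite /a E; rewrite brs => nzn.
  by rewrite -(logder_prod nzn) mulrCA mulrA.
split; first by have := is_derive_ln_normc (de n) (nz n).
rewrite [X in is_derive _ _ X](_ : _ = - \sum_(k < n) (fun u =>
    atan (Re (dp (fun k => (b k).[g u]) k.+1 * conjc (dp (fun k => (b k).[g u]) k)) /
          Im (dp (fun k => (b k).[g u]) k.+1 * conjc (dp (fun k => (b k).[g u]) k)))));
    last first.
  by apply/funext => u /=; rewrite /argdp fct_sumE.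
(* The logarithmic derivative of a product of x with the conjugate of y is the sum of those of both
   factors, and conjugation flips the sign of the imaginary part; hence a difference. *)
pose s (k : 'I_n) : R := - (Im (e k.+1 / dp a k.+1) - Im (e k / dp a k)).
have hs (k : 'I_n) : is_derive t 1 (fun u =>
    atan (Re (dp (fun k => (b k).[g u]) k.+1 * conjc (dp (fun k => (b k).[g u]) k)) /
          Im (dp (fun k => (b k).[g u]) k.+1 * conjc (dp (fun k => (b k).[g u]) k))))
    (s k).
  have qd := cderM (de k.+1) (cder_conj (de k)).
  have [_ q0] := dp_upper k bp.
  have := is_derive_atan_ratio qd _; rewrite -/a (gt_eqF q0) => /(_ isT).
  move=> h; apply: (is_derive_eq h); rewrite /s; congr (- _).
  have cz : conjc (dp a k) != 0 by rewrite conjc_eq0.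
  rewrite -/(dp a k) (_ : _ / _ = e k.+1 / dp a k.+1 + conjc (e k / dp a k)).
    by rewrite cImD cImJ.
  have -> : conjc (e k / dp a k) = conjc (e k) / conjc (dp a k).
    by rewrite -conjc_inv -rmorphM.
  move: (nz k.+1) cz; move: (dp a k.+1) (conjc (dp a k)) (conjc (e k)) => x y z x0 y0.
  by field; rewrite x0 y0.
apply: (is_derive_eq (is_deriveN (is_derive_sum hs))); rewrite /s -(big_mkord xpredT (fun k =>
  - (Im (e k.+1 / dp a k.+1) - Im (e k / dp a k)))) sumrN opprK.
rewrite telescope_sumr // [e 0%N](_ : _ = 0) ?mul0r ?subr0 //.
by rewrite /e dp0 derivC horner0 mul0r.
Qed.

(** The modulus is controlled by [dp_le] and [dp_ge], and each of the n arguments by the range of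
    [atan]; the result is linear in n, with constants depending only on e and Q. *)
Lemma normc_logdp a e Q n : 0 < e <= 1 -> 0 <= Q ->
  (forall k, e <= Im (a k)) -> (forall k, normc (a k) <= Q) ->
  normc (logdp a n) <= n%:R * (ln (Q + 1) + pi) + ln (2 / e).
Proof.
move=> /andP[e0 e1] Q0 ap aQ.
have h1 : e / 2 <= normc (dp a n) by apply: dp_ge => //; rewrite e0.
have h0 : 0 < normc (dp a n) by apply: lt_le_trans h1; rewrite divr_gt0.
have h2 := dp_le n Q0 aQ.
have Q1 : 0 < Q + 1 by rewrite ltr_wpDl.
have l1 : ln (normc (dp a n)) <= n%:R * ln (Q + 1).
  by rewrite mulr_natl -lnXn // ler_ln ?posrE // exprn_gt0.
have l2 : - ln (2 / e) <= ln (normc (dp a n)).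
  rewrite -lnV ?posrE ?divr_gt0 // invf_div ler_ln ?posrE // divr_gt0 //.
have l3 : 0 <= ln (2 / e).
  by apply: ln_ge0; rewrite ler_pdivlMr // mul1r; lra.
have l4 : 0 <= n%:R * ln (Q + 1) by rewrite mulr_ge0 // ln_ge0 // lerDr.
have l5 : `|argdp a n| <= n%:R * pi.
  rewrite normrN (le_trans (ler_norm_sum _ _ _)) //.
  rewrite (@le_trans _ _ (\sum_(k < n) pi)) //; last first.
    by rewrite sumr_const card_ord mulr_natl.
  apply: ler_sum => k _; rewrite ler_norml.
  have p0 := pi_gt0 R.
  have := atan_gtNpi2 (Re (dp a k.+1 * conjc (dp a k)) / Im (dp a k.+1 * conjc (dp a k))).
  have := atan_ltpi2 (Re (dp a k.+1 * conjc (dp a k)) / Im (dp a k.+1 * conjc (dp a k))).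
  lra.
apply: le_trans (normc_le_Re_Im _) _ => /=.
have : `|ln (normc (dp a n))| <= n%:R * ln (Q + 1) + ln (2 / e).
  by rewrite ler_norml; lra.
by rewrite mulrDr; lra.
Qed.

End UpperHalfPlane.

(** * Cauchy's theorem on a grid and Taylor expansions *)

Section DiscreteCauchy.
Variables (R : realType) (N : nat).
Hypothesis N0 : (0 < N)%N.
Implicit Types (G H : nat -> nat -> R[i]) (B : R).

Let h : R := N%:R^-1.

Let h0 : 0 <= h. Proof. by rewrite invr_ge0 ler0n. Qed.
Let h1 : h <= 1.
Proof. by rewrite invf_le1 ?ltr0n // ler1n. Qed.

Lemma mulrNn : h * N%:R = 1.
Proof. by rewrite mulVf // pnatr_eq0 -lt0n. Qed.

Let sum_double (c : R) : \sum_(i < N.*2) c = 2 * c * N%:R.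
Proof.
by rewrite sumr_const card_ord -mul2n mulrnA -[_ *+ N]mulr_natr -[c *+ 2]mulr_natl.
Qed.

(* G i j stands for the value of a holomorphic function at the grid point
   (-1 + i / N) + 'i (j / N): the last clause is a discrete Cauchy-Riemann
   equation. *)
Definition discrete_hol B G := forall i j, (i < N.*2)%N -> (j < N)%N ->
  [/\ normc (G i j) <= B,
      normc (G i.+1 j - G i j) <= B * h,
      normc (G i j.+1 - G i j) <= B * h &
      normc (G i j.+1 - G i j - 'i%C * (G i.+1 j - G i j)) <= B * h ^+ 2].

(** Leibniz rule for increments: the Cauchy-Riemann defect of a product consists of the two defects
    times the other factor and two products of increments, each at most B1 B2 h^2; hence the
    constant 4. *)
Lemma discrete_holM B1 B2 G H : discrete_hol B1 G -> discrete_hol B2 H ->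
  discrete_hol (4 * (B1 * B2)) (fun i j => G i j * H i j).
Proof.
move=> hG hH i j iN jN.
have [g1 g2 g3 g4] := hG i j iN jN; have [k1 k2 k3 k4] := hH i j iN jN.
move: (G i j) (G i.+1 j) (G i j.+1) (H i j) (H i.+1 j) (H i j.+1) g1 g2 g3 g4 k1 k2 k3 k4.
move=> g gx gy k kx ky g1 g2 g3 g4 k1 k2 k3 k4.
have B10 : 0 <= B1 by exact: le_trans (normc_ge0 _) g1.
have B20 : 0 <= B2 by exact: le_trans (normc_ge0 _) k1.
have B0 : 0 <= B1 * B2 by rewrite mulr_ge0.
have M (x y : R[i]) a b : normc x <= a -> normc y <= b -> normc (x * y) <= a * b.
  by move=> xa yb; rewrite normcM ler_pM ?normc_ge0.
have hh : h ^+ 2 <= h by rewrite expr2 ler_piMl.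
split.
- by apply: le_trans (M _ _ _ _ g1 k1) _; lra.
- have -> : gx * kx - g * k = (gx - g) * k + g * (kx - k) + (gx - g) * (kx - k) by ring.
  apply: le_trans (normcD _ _) _.
  have := M _ _ _ _ g2 k1; have := M _ _ _ _ g1 k2; have := M _ _ _ _ g2 k2.
  have := normcD ((gx - g) * k) (g * (kx - k)).
  have := ler_wpM2l B0 hh; have := mulr_ge0 B0 h0.
  rewrite (_ : B1 * h * (B2 * h) = B1 * B2 * h ^+ 2); last by ring.
  rewrite (_ : B1 * (B2 * h) = B1 * B2 * h); last by ring.
  rewrite (_ : B1 * h * B2 = B1 * B2 * h); last by ring.
  lra.
- have -> : gy * ky - g * k = (gy - g) * k + g * (ky - k) + (gy - g) * (ky - k) by ring.
  apply: le_trans (normcD _ _) _.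
  have := M _ _ _ _ g3 k1; have := M _ _ _ _ g1 k3; have := M _ _ _ _ g3 k3.
  have := normcD ((gy - g) * k) (g * (ky - k)).
  have := ler_wpM2l B0 hh; have := mulr_ge0 B0 h0.
  rewrite (_ : B1 * h * (B2 * h) = B1 * B2 * h ^+ 2); last by ring.
  rewrite (_ : B1 * (B2 * h) = B1 * B2 * h); last by ring.
  rewrite (_ : B1 * h * B2 = B1 * B2 * h); last by ring.
  lra.
- have -> : gy * ky - g * k - 'i%C * (gx * kx - g * k) =
     ((gy - g - 'i%C * (gx - g)) * k + g * (ky - k - 'i%C * (kx - k))) +
     ((gy - g) * (ky - k) - 'i%C * ((gx - g) * (kx - k))) by ring.
  apply: le_trans (normcD _ _) _.
  apply: le_trans (lerD (normcD _ _) (le_normcB _ _)) _.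
  rewrite [normc ('i%C * _)]normcM normci mul1r.
  have := M _ _ _ _ g4 k1; have := M _ _ _ _ g1 k4; have := M _ _ _ _ g2 k2.
  have := M _ _ _ _ g3 k3.
  rewrite (_ : B1 * h * (B2 * h) = B1 * B2 * h ^+ 2); last by ring.
  rewrite (_ : B1 * (B2 * h ^+ 2) = B1 * B2 * h ^+ 2); last by ring.
  rewrite (_ : B1 * h ^+ 2 * B2 = B1 * B2 * h ^+ 2); last by ring.
  lra.
Qed.

(** Riemann sum of the contour integral over left, top and right side of [-1, 1] x [0, 1], oriented
    so as to replace the integral over the bottom from -1 to 1. *)
Definition upper_sum G : R[i] :=
  h%:C * \sum_(i < N.*2) G i N -
  'i%C * (h%:C * \sum_(j < N) (G N.*2 j - G 0%N j)).

(** Summing the discrete Cauchy-Riemann equation over a row telescopes to the two lateral values,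
    with an error 2N B h^2 = 2 B h. The N rows are then added and multiplied by the mesh. *)
Lemma discrete_cauchy B G : discrete_hol B G ->
  normc (h%:C * \sum_(i < N.*2) G i 0%N - upper_sum G) <= 2 * B * h.
Proof.
move=> hG; pose S j := \sum_(i < N.*2) G i j.
have step j : (j < N)%N ->
    normc (S j.+1 - S j - 'i%C * (G N.*2 j - G 0%N j)) <= 2 * B * h.
  move=> jN.
  have -> : S j.+1 - S j - 'i%C * (G N.*2 j - G 0%N j) =
      \sum_(i < N.*2) (G i j.+1 - G i j - 'i%C * (G i.+1 j - G i j)).
    rewrite sumrB sumrB -mulr_sumr; congr (_ - 'i%C * _).
    by rewrite -(big_mkord xpredT (fun i => G i.+1 j - G i j)) telescope_sumr.
  apply: le_trans (normc_sum _ _ _) _.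
  apply: (@le_trans _ _ (\sum_(i < N.*2) B * h ^+ 2)).
    by apply: ler_sum => i _; have [] := hG i j (ltn_ord i) jN.
  rewrite sum_double.
  rewrite (_ : _ * _ = 2 * B * h * (h * N%:R)); last by ring.
  by rewrite mulrNn mulr1.
have tele : S N - S 0%N - 'i%C * \sum_(j < N) (G N.*2 j - G 0%N j) =
    \sum_(j < N) (S j.+1 - S j - 'i%C * (G N.*2 j - G 0%N j)).
  rewrite [RHS]sumrB -mulr_sumr; congr (_ - _).
  by rewrite -(big_mkord xpredT (fun j => S j.+1 - S j)) telescope_sumr.
rewrite normcB /upper_sum -/(S N) -/(S 0%N).
have -> : h%:C * S N - 'i%C * (h%:C * \sum_(j < N) (G N.*2 j - G 0%N j)) - h%:C * S 0%N
  = h%:C * (S N - S 0%N - 'i%C * \sum_(j < N) (G N.*2 j - G 0%N j)) by ring.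
rewrite tele normcM normc_real ger0_norm //.
rewrite mulrC ler_wpM2r // ; apply: le_trans (normc_sum _ _ _) _.
apply: (@le_trans _ _ (\sum_(j < N) 2 * B * h)).
  by apply: ler_sum => j _; exact: step.
by rewrite sumr_const card_ord -[_ *+ N]mulr_natr -mulrA mulrNn mulr1.
Qed.

Lemma upper_sumD G H :
  upper_sum (fun i j => G i j + H i j) = upper_sum G + upper_sum H.
Proof.
rewrite /upper_sum big_split /=.
have -> : \sum_(j < N) (G N.*2 j + H N.*2 j - (G 0%N j + H 0%N j)) =
    \sum_(j < N) (G N.*2 j - G 0%N j) + \sum_(j < N) (H N.*2 j - H 0%N j).
  by rewrite -big_split /=; apply: eq_bigr => j _; ring.
by ring.
Qed.

Lemma upper_sumZ c G : upper_sum (fun i j => c * G i j) = c * upper_sum G.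
Proof.
rewrite /upper_sum -mulr_sumr.
have -> : \sum_(j < N) (c * G N.*2 j - c * G 0%N j) =
    c * \sum_(j < N) (G N.*2 j - G 0%N j).
  by rewrite mulr_sumr; apply: eq_bigr => j _; ring.
by ring.
Qed.

Lemma upper_sum_sum (I : Type) (r : seq I) (c : I -> R[i]) (F : I -> nat -> nat -> R[i]) :
  upper_sum (fun i j => \sum_(k <- r) c k * F k i j) =
  \sum_(k <- r) c k * upper_sum (F k).
Proof.
elim: r => [|k r IH].
  rewrite big_nil; rewrite (_ : (fun _ _ => _) = (fun i j => 0 * (0 : R[i]))).
    by rewrite upper_sumZ mul0r.
  by apply/funext => i; apply/funext => j; rewrite big_nil mul0r.
rewrite big_cons -IH -upper_sumZ -upper_sumD; congr upper_sum.
by apply/funext => i; apply/funext => j; rewrite big_cons.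
Qed.

(** The three sides have total length 4. *)
Lemma upper_sum_le (M : R) G :
  (forall i, (i < N.*2)%N -> normc (G i N) <= M) ->
  (forall j, (j < N)%N -> normc (G 0%N j) <= M /\ normc (G N.*2 j) <= M) ->
  normc (upper_sum G) <= 4 * M.
Proof.
move=> top sides; apply: le_trans (le_normcB _ _) _.
rewrite !normcM normci mul1r normc_real ger0_norm //.
have t : normc (\sum_(i < N.*2) G i N) <= 2 * M * N%:R.
  apply: le_trans (normc_sum _ _ _) _.
  apply: (@le_trans _ _ (\sum_(i < N.*2) M)); first by apply: ler_sum => i _; exact: top.
  by rewrite sum_double.
have s : normc (\sum_(j < N) (G N.*2 j - G 0%N j)) <= 2 * M * N%:R.
  apply: le_trans (normc_sum _ _ _) _.
  apply: (@le_trans _ _ (\sum_(j < N) (2 * M))).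
    apply: ler_sum => j _; have [s1 s2] := sides j (ltn_ord j).
    by apply: le_trans (le_normcB _ _) _; lra.
  by rewrite sumr_const card_ord -[_ *+ N]mulr_natr.
have := ler_wpM2l h0 t; have := ler_wpM2l h0 s.
rewrite (_ : h * (2 * M * N%:R) = 2 * M * (h * N%:R)); last by ring.
rewrite mulrNn; lra.
Qed.

End DiscreteCauchy.

(** * Uniform determination of Taylor coefficients by nearby values *)

Section Elimination.
Variables (R : realType) (T J : Type) (V : T -> Prop) (M : T -> J -> R) (e : T -> R).
Implicit Types g : T -> R.

(** The list and the constant are chosen before p: the linear combination is the same for all p in
    V. The values [M p j] are the known data and [e p] is an error made small only later, so an
    arbitrary multiple of it is allowed. *)
Definition approximable g := forall eps : R, 0 < eps ->
  exists2 l : seq (R * J), True & exists2 c, 0 <= c &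
    forall p, V p -> `|g p - \sum_(x <- l) x.1 * M p x.2| <= eps + c * e p.

Lemma approx_closed g : (forall eps : R, 0 < eps ->
    exists2 g', approximable g' & exists2 c, 0 <= c &
      forall p, V p -> `|g p - g' p| <= eps + c * e p) ->
  approximable g.
Proof.
move=> H eps eps0; have eps2 : 0 < eps / 2 by rewrite divr_gt0.
have [g' ag' [c c0 hc]] := H _ eps2; have [l _ [c' c'0 hl]] := ag' _ eps2.
exists l => //; exists (c + c'); first by rewrite addr_ge0.
move=> p Vp; apply: le_trans (ler_distD (g' p) _ _) _.
by have := hc p Vp; have := hl p Vp; lra.
Qed.

Lemma approx_eq g g' : (forall p, V p -> g p = g' p) -> approximable g -> approximable g'.
Proof.
move=> E ag eps eps0; have [l _ [c c0 hl]] := ag _ eps0.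
by exists l => //; exists c => // p Vp; rewrite -E //; exact: hl.
Qed.

Lemma approx_M j : approximable (M^~ j).
Proof.
move=> eps eps0; exists [:: (1, j)] => //; exists 0 => // p Vp.
by rewrite big_seq1 mul1r subrr normr0 mul0r addr0 ltW.
Qed.

Lemma approxD g g' : approximable g -> approximable g' -> approximable (fun p => g p + g' p).
Proof.
move=> ag ag' eps eps0; have eps2 : 0 < eps / 2 by rewrite divr_gt0.
have [l _ [c c0 hl]] := ag _ eps2; have [l' _ [c' c'0 hl']] := ag' _ eps2.
exists (l ++ l') => //; exists (c + c'); first by rewrite addr_ge0.
move=> p Vp; rewrite big_cat /= opprD addrACA.
by apply: le_trans (ler_normD _ _) _; have := hl p Vp; have := hl' p Vp; lra.
Qed.

Lemma approxZ a g : approximable g -> approximable (fun p => a * g p).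
Proof.
move=> ag eps eps0; have a0 : 0 < `|a| + 1 by rewrite ltr_wpDl.
have [l _ [c c0 hl]] := ag _ (divr_gt0 eps0 a0).
exists [seq (a * x.1, x.2) | x <- l] => //; exists (`|a| * c).
  by rewrite mulr_ge0.
move=> p Vp; rewrite big_map /=.
have -> : \sum_(x <- l) a * x.1 * M p x.2 = a * \sum_(x <- l) x.1 * M p x.2.
  by rewrite mulr_sumr; apply: eq_bigr => x _; rewrite mulrA.
rewrite -mulrBr normrM (le_trans (ler_wpM2l (normr_ge0 a) (hl p Vp))) //.
rewrite mulrDr; apply: lerD; last by rewrite mulrA.
rewrite mulrCA ler_piMr ?ltW //.
by rewrite ltr_pdivrMr // mul1r ltrDl.
Qed.

Lemma approx0 : approximable (fun=> 0).
Proof.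
move=> eps eps0; exists [::] => //; exists 0 => // p Vp.
by rewrite big_nil subrr normr0 mul0r addr0 ltW.
Qed.

Lemma approx_sum n (F : nat -> T -> R) : (forall k, (k < n)%N -> approximable (F k)) ->
  approximable (fun p => \sum_(k < n) F k p).
Proof.
elim: n => [|n IH] aF.
  by apply: approx_eq approx0 => p _; rewrite big_ord0.
apply: approx_eq (approxD (IH _) (aF n _)) => //.
  by move=> p _; rewrite big_ord_recr.
by move=> k kn; apply: aF; rewrite ltnS ltnW.
Qed.

(* The coefficients of an asymptotic expansion at 0 are determined one after
   the other by the values at points accumulating at 0. *)
Lemma approx_coef (A : nat -> T -> R) m C : 0 <= C ->
  (forall k p, V p -> (0 < k < m)%N -> `|A k p| <= C) ->
  (forall eps : R, 0 < eps -> exists2 d : R, 0 < `|d| < eps & exists j,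
     forall p, V p ->
       `|M p j - \sum_(k < m) d ^+ k * A k p| <= C * `|d| ^+ m + C * e p) ->
  forall k, (k < m)%N -> approximable (A k).
Proof.
move=> C0 Ab exp; elim/ltn_ind => k IH km; apply: approx_closed => eps eps0.
have K0 : 0 < (m%:R + 1) * C + 1.
  by rewrite ltr_wpDl // mulr_ge0 // addr_ge0.
(* Division by d^k leaves a truncation error of at most (m + 1) C |d|, which this choice keeps below
   eps. *)
have [|d /andP[d0 ds] [j hj]] := exp (Num.min 1 (eps / ((m%:R + 1) * C + 1))).
  by rewrite lt_min ltr01 divr_gt0.
move: ds; rewrite lt_min => /andP[d1 ds].
have dn0 : d != 0 by rewrite -normr_gt0.
exists (fun p => d ^- k * (M p j + (- 1) * \sum_(i < k) d ^+ i * A i p)).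
  apply: approxZ; apply: approxD; first exact: approx_M.
  apply: approxZ; apply: (@approx_sum k (fun i p => d ^+ i * A i p)) => i ik.
  by apply: approxZ; apply: IH => //; exact: ltn_trans ik km.
exists (`|d| ^- k * C).
  by rewrite mulr_ge0 // invr_ge0 exprn_ge0.
move=> p Vp.
have -> : A k p - d ^- k * (M p j + -1 * \sum_(i < k) d ^+ i * A i p) =
  d ^- k * (\sum_(i < k.+1) d ^+ i * A i p - M p j).
  by rewrite big_ord_recr /= mulN1r; field; rewrite expf_neq0.
rewrite normrM normfV normrX.
have split_sum : \sum_(i < m) d ^+ i * A i p = \sum_(i < k.+1) d ^+ i * A i p +
    \sum_(k.+1 <= i < m) d ^+ i * A i p.
  by rewrite -!(big_mkord xpredT (fun i => d ^+ i * A i p)) -big_cat_nat.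
(* Only positive indices occur here; the coefficient of index 0 is the value of the function itself
   and is never estimated. *)
have tail : `|\sum_(k.+1 <= i < m) d ^+ i * A i p| <= m%:R * C * `|d| ^+ k.+1.
  apply: le_trans (ler_norm_sum _ _ _) _.
  apply: (@le_trans _ _ (\sum_(k.+1 <= i < m) C * `|d| ^+ k.+1)).
    rewrite !big_nat; apply: ler_sum => i /andP[ki im].
    rewrite normrM normrX mulrC ler_pM //.
      by apply: Ab => //; rewrite im andbT (leq_trans _ ki).
    by rewrite ler_wiXn2l // ltW.
  rewrite sumr_const_nat -[_ *+ (m - _)]mulr_natl mulrA ler_wpM2r ?exprn_ge0 //.
  by rewrite ler_wpM2r // ler_nat leq_subr.
have main : `|\sum_(i < k.+1) d ^+ i * A i p - M p j| <=
    (m%:R + 1) * C * `|d| ^+ k.+1 + C * e p.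
  have -> : \sum_(i < k.+1) d ^+ i * A i p - M p j =
    - (M p j - \sum_(i < m) d ^+ i * A i p) - \sum_(k.+1 <= i < m) d ^+ i * A i p.
    by rewrite split_sum; ring.
  apply: le_trans (ler_normB _ _) _; rewrite normrN.
  have : C * `|d| ^+ m <= C * `|d| ^+ k.+1.
    by rewrite ler_wpM2l // ler_wiXn2l // ltW.
  have := hj p Vp; move: tail.
  by rewrite [(_ + 1) * C]mulrDl mul1r [(_ + C) * _]mulrDl; lra.
apply: le_trans (ler_wpM2l _ main) _; first by rewrite invr_ge0 exprn_ge0.
rewrite mulrDr; apply: lerD; last by rewrite mulrA.
have -> : `|d| ^- k * ((m%:R + 1) * C * `|d| ^+ k.+1) = (m%:R + 1) * C * `|d|.
  by rewrite exprS; field; rewrite expf_neq0 // normr_eq0.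
have h : 0 <= (m%:R + 1) * C by rewrite mulr_ge0 // addr_ge0.
apply: le_trans (ler_wpM2l h (ltW ds)) _.
by rewrite mulrCA ler_piMr ?ltW // ltr_pdivrMr // mul1r ltrDl.
Qed.

End Elimination.

(** * Finite scale potentials: difference quotients and Taylor expansion *)

Section Potential.
Variable R : realType.
Implicit Types (v w : nat -> R) (z s t xi : R[i]) (n : nat).

Definition energy v w z s (k : nat) : R[i] := z - (v k)%:C - s * (w k)%:C.

Definition cpot v w n z s : R[i] := (n%:R^-1)%:C * logdp (energy v w z s) n.

Definition pot v w n z s : R := n%:R^-1 * ln (normc (dp (energy v w z s) n)).

Lemma Re_cpot v w n z s : Re (cpot v w n z s) = pot v w n z s.
Proof. by rewrite /cpot /pot cReM /= mul0r subr0. Qed.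

Lemma Im_energy v w z s k : Im (energy v w z s k) = Im z - Im s * w k.
Proof. by rewrite /energy !reim /=; ring. Qed.

Lemma Im_energy_ge v w z s k C : `|w k| <= C ->
  Im z - C * `|Im s| <= Im (energy v w z s k).
Proof.
move=> wC; rewrite Im_energy lerD2l lerN2 (le_trans (ler_norm _)) //.
by rewrite normrM mulrC ler_wpM2r.
Qed.

(* Both lemmas below integrate the logarithmic derivative of a polynomial along
   a segment, using its roots. *)
Lemma normc_inv_sum_le (rs : seq R[i]) t c : 0 < c ->
  (forall x, x \in rs -> c <= normc (t - x)) ->
  normc (\sum_(x <- rs) (t - x)^-1) <= (size rs)%:R / c.
Proof.
move=> c0 h; apply: le_trans (normc_sum _ _ _) _.
rewrite big_seq (@le_trans _ _ (\sum_(x <- rs | x \in rs) c^-1)) //.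
  apply: ler_sum => x /h hx; rewrite normcV lef_pV2 ?posrE //.
  exact: lt_le_trans hx.
by rewrite -big_seq big_const_seq count_predT iter_addr_0 -[_ *+ _]mulr_natl.
Qed.

Lemma normc_inv_sumB_le (rs : seq R[i]) t t' c : 0 < c ->
  (forall x, x \in rs -> c <= normc (t - x)) ->
  (forall x, x \in rs -> c <= normc (t' - x)) ->
  normc (\sum_(x <- rs) (t - x)^-1 - \sum_(x <- rs) (t' - x)^-1) <=
    (size rs)%:R * normc (t - t') / c ^+ 2.
Proof.
move=> c0 h h'; rewrite -sumrB; apply: le_trans (normc_sum _ _ _) _.
rewrite big_seq (@le_trans _ _ (\sum_(x <- rs | x \in rs) (normc (t - t') / c ^+ 2))) //.
  apply: ler_sum => x xr; have hx := h x xr; have hx' := h' x xr.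
  have x0 : 0 < normc (t - x) by exact: lt_le_trans hx.
  have x'0 : 0 < normc (t' - x) by exact: lt_le_trans hx'.
  have -> : (t - x)^-1 - (t' - x)^-1 = (t' - t) / ((t - x) * (t' - x)).
    by field; rewrite -!normc_eq0 !gt_eqF.
  rewrite normcM normcV normcB ler_wpM2l ?normc_ge0 // lef_pV2 ?posrE ?exprn_gt0 //.
    by rewrite normcM expr2 ler_pM // ltW.
  by rewrite normcM mulr_gt0.
by rewrite -big_seq big_const_seq count_predT iter_addr_0 -[_ *+ _]mulr_natl mulrA.
Qed.

Variables (b : nat -> {poly R[i]}) (n : nat) (rs : seq R[i]).
Hypothesis n0 : (0 < n)%N.
Hypothesis brs : dp b n = lead_coef (dp b n) *: \prod_(r <- rs) ('X - r%:P).

Let f t := (n%:R^-1)%:C * logdp (fun k => (b k).[t]) n.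

Let cder_f t xi (u : R) : (forall k, 0 < Im (b k).[t + xi * u%:C]) ->
  cder (fun u => f (t + xi * u%:C)) u
    ((n%:R^-1)%:C * (xi * \sum_(r <- rs) (t + xi * u%:C - r)^-1)).
Proof.
move=> bp; have gd : cder (fun u => t + xi * u%:C) u xi.
  apply: cder_eq; first by apply: cderD; [exact: cder_cst|apply: cderM; [exact: cder_cst|exact: cder_real]].
  by rewrite add0r mulr1 mul0r addr0.
apply: cder_eq; first by apply: cderM; [exact: cder_cst|exact: cder_logdp gd bp brs].
by rewrite mul0r addr0.
Qed.

Let normc_inv_n z : normc ((n%:R^-1)%:C * z) = n%:R^-1 * normc z.
Proof. by rewrite normcM normc_real ger0_norm // invr_ge0 ler0n. Qed.

Let inv_n_size (d : nat) (x : R) : 0 <= x -> (size rs <= d * n)%N ->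
  n%:R^-1 * ((size rs)%:R * x) <= d%:R * x.
Proof.
move=> x0 sz; rewrite mulrA ler_wpM2r // ler_pdivrMl ?ltr0n //.
by rewrite mulrC -natrM ler_nat.
Qed.

(** There are at most d n roots and the logarithm is divided by n, so the bound depends on d and on
    the distance c to the roots only. *)
Lemma path_diff_le d c t xi : 0 < c -> (size rs <= d * n)%N ->
  (forall u : R, 0 <= u <= 1 -> (forall k, 0 < Im (b k).[t + xi * u%:C]) /\
     (forall x, x \in rs -> c <= normc (t + xi * u%:C - x))) ->
  normc (f (t + xi) - f t) <= 2 * (d%:R * (normc xi / c)).
Proof.
move=> c0 sz H.
have := @cder_mean_value R (fun u => f (t + xi * u%:C)) _ (d%:R * (normc xi / c))
  (fun u u01 => cder_f (H u u01).1).
rewrite mulr1 mulr0 addr0; apply=> u u01.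
rewrite normc_inv_n normcM.
apply: le_trans (inv_n_size _ sz); last by rewrite divr_ge0 ?normc_ge0 // ltW.
rewrite ler_wpM2l ?invr_ge0 ?ler0n // [leRHS]mulrCA ler_wpM2l ?normc_ge0 //.
exact: normc_inv_sum_le (H u u01).2.
Qed.

Lemma path_diff2_le d c t (h : R) : 0 < c -> 0 <= h -> (size rs <= d * n)%N ->
  (forall u : R, 0 <= u <= 1 -> (forall k, 0 < Im (b k).[t + h%:C * u%:C]) /\
     (forall x, x \in rs -> c <= normc (t + h%:C * u%:C - x))) ->
  (forall u : R, 0 <= u <= 1 -> (forall k, 0 < Im (b k).[t + ('i%C * h%:C) * u%:C]) /\
     (forall x, x \in rs -> c <= normc (t + ('i%C * h%:C) * u%:C - x))) ->
  normc (f (t + 'i%C * h%:C) - f t - 'i%C * (f (t + h%:C) - f t)) <=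
    2 * (d%:R * (2 * h ^+ 2 / c ^+ 2)).
Proof.
move=> c0 h0 sz H1 H2.
(* Vertical and horizontal increments run simultaneously: the derivative of [g] contains the
   difference of the logarithmic derivatives at two points at distance at most 2h, which yields the
   second factor h. *)
pose g u := f (t + ('i%C * h%:C) * u%:C) + (- 'i%C) * f (t + h%:C * u%:C).
pose S x : R[i] := \sum_(r <- rs) (x - r)^-1.
pose g' (u : R) := (n%:R^-1)%:C *
  ('i%C * h%:C * (S (t + ('i%C * h%:C) * u%:C) - S (t + h%:C * u%:C))).
have gd u : 0 <= u <= 1 -> cder g u (g' u).
  move=> u01; apply: cder_eq.
    apply: cderD; first exact: cder_f (H2 u u01).1.
    by apply: cderM; [exact: cder_cst|exact: cder_f (H1 u u01).1].
  by rewrite /g' /S; ring.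
have := cder_mean_value gd.
move=> /(_ (d%:R * (2 * h ^+ 2 / c ^+ 2))).
rewrite /g !mulr1 !mulr0 !addr0.
have -> : f (t + 'i%C * h%:C) + - 'i%C * f (t + h%:C) - (f t + - 'i%C * f t) =
  f (t + 'i%C * h%:C) - f t - 'i%C * (f (t + h%:C) - f t) by ring.
apply=> u u01; rewrite /g' normc_inv_n 2!normcM normci mul1r normc_real ger0_norm //.
have X0 : 0 <= 2 * h ^+ 2 / c ^+ 2 by rewrite divr_ge0 ?mulr_ge0 ?exprn_ge0 // ltW.
apply: le_trans (inv_n_size X0 sz); rewrite ler_wpM2l ?invr_ge0 ?ler0n //.
have := normc_inv_sumB_le c0 (H2 u u01).2 (H1 u u01).2.
set a := normc (_ - _) => ha; set a' := normc (_ - _) in ha.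
have a'h : a' <= 2 * h.
  rewrite /a'; have -> : t + 'i%C * h%:C * u%:C - (t + h%:C * u%:C) =
    (h * u)%:C * ('i%C - 1) by rewrite rmorphM /=; ring.
  rewrite normcM normc_real mulrC.
  move: u01 => /andP[u0 u1]; rewrite ger0_norm ?mulr_ge0 //.
  apply: ler_pM; rewrite ?normc_ge0 ?mulr_ge0 //; last by rewrite ler_piMr.
  by apply: le_trans (le_normcB _ _) _; rewrite normci normc1.
apply: le_trans (ler_wpM2l h0 ha) _.
have -> : (size rs)%:R * (2 * h ^+ 2 / c ^+ 2) = h * ((size rs)%:R * (2 * h) / c ^+ 2) by ring.
rewrite ler_wpM2l // ler_wpM2r ?invr_ge0 ?exprn_ge0 ?(ltW c0) //.
by rewrite ler_wpM2l ?ler0n.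
Qed.

(* The coefficients of the power series of log (dp b n) at x0, read off the
   roots. *)
Definition log_coef (x0 : R[i]) k : R[i] :=
  if k is 0%N then f x0 else
    - ((n%:R^-1)%:C * (k%:R^-1 * \sum_(r <- rs) (r - x0) ^- k)).

(** Remainder of the geometric series of ratio xi q / x; it is the contribution of one root at
    offset x to the derivative of the Taylor remainder. *)
Let geometric (xi x : R[i]) (q : R[i]) m : x != 0 -> x - xi * q != 0 ->
  xi / (xi * q - x) + \sum_(k < m) xi ^+ k.+1 * q ^+ k * x ^- k.+1 =
  - (xi / (x - xi * q)) * (xi * q / x) ^+ m.
Proof.
move=> x0 y0; elim: m => [|m IH].
  rewrite big_ord0 addr0 expr0 mulr1; field.
  by rewrite y0 -oppr_eq0 opprB.
rewrite big_ord_recr /= addrA IH exprSr.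
rewrite !exprMn !exprSr !exprVn; field.
by rewrite x0 y0 expf_neq0.
Qed.

(** The derivative of the remainder along the segment is, root by root, a geometric tail of size at
    most (|xi| / c)^m. Keeping the whole segment away from the roots takes the place of a disc of
    convergence. *)
Lemma log_taylor m c x0 xi : (0 < m)%N -> 0 < c -> (size rs <= n)%N ->
  (forall u : R, 0 <= u <= 1 -> (forall k, 0 < Im (b k).[x0 + xi * u%:C]) /\
     (forall x, x \in rs -> c <= normc (x0 + xi * u%:C - x))) ->
  normc (f (x0 + xi) - \sum_(k < m) log_coef x0 k * xi ^+ k) <=
    2 * (normc xi / c) ^+ m.
Proof.
case: m => // m _ c0 sz H.
have c1 x : x \in rs -> c <= normc (x - x0).
  move=> xr; have [_ /(_ x xr)] := H 0 (introT andP (conj (lexx 0) ler01)).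
  by rewrite mulr0 addr0 normcB.
pose g u := f (x0 + xi * u%:C) +
   - \sum_(k < m) log_coef x0 k.+1 * xi ^+ k.+1 * u%:C ^+ k.+1.
pose g' (u : R) := (n%:R^-1)%:C * \sum_(x <- rs)
   - (xi / (x - x0 - xi * u%:C)) * (xi * u%:C / (x - x0)) ^+ m.
have cder_sum I (l : seq I) (F : I -> R -> R[i]) (F' : I -> R[i]) u :
    (forall i, cder (F i) u (F' i)) ->
    cder (fun u => \sum_(i <- l) F i u) u (\sum_(i <- l) F' i).
  move=> FF; elim: l => [|i l IH].
    rewrite big_nil; apply: cder_ext (cder_cst 0 u) => y; by rewrite big_nil.
  rewrite big_cons; apply: cder_ext (cderD (FF i) IH) => y; by rewrite big_cons.
have cder_pow (k : nat) (u : R) : cder (fun u => u%:C ^+ k.+1) u (k.+1%:R * u%:C ^+ k).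
  have h := cder_horner ('X^(k.+1) : {poly R[i]}) (cder_real u).
  apply: cder_eq (cder_ext _ h) _; first by move=> y; rewrite hornerXn.
  by rewrite derivXn hornerMn hornerXn /= mulr1 mulr_natl.
have gd u : 0 <= u <= 1 -> cder g u (g' u).
  move=> u01; have [Hu1 Hu2] := H u u01.
  apply: cder_eq.
    apply: cderD; first exact: cder_f Hu1.
    apply: (@cder_ext R (fun u => - 1 * \sum_(k < m) log_coef x0 k.+1 * xi ^+ k.+1 * u%:C ^+ k.+1)).
      by move=> y; rewrite mulN1r.
    apply: cderM; first exact: cder_cst.
    apply: (cder_sum _ _ _ (fun k : 'I_m => log_coef x0 k.+1 * xi ^+ k.+1 * (k.+1%:R * u%:C ^+ k))) => k.
    apply: cder_eq.
      apply: cderM; first exact: cder_cst.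
      exact: cder_pow.
    by rewrite mul0r addr0.
  rewrite mul0r addr0 mulN1r -sumrN /g' /=.
  transitivity ((n%:R^-1)%:C * (\sum_(x <- rs) (xi / (xi * u%:C - (x - x0)) +
      \sum_(k < m) xi ^+ k.+1 * u%:C ^+ k * (x - x0) ^- k.+1))).
    rewrite big_split /= mulrDr; congr (_ + _).
      congr (_ * _); rewrite mulr_sumr; apply: eq_bigr => x _.
      by congr (_ * _^-1); ring.
    rewrite exchange_big /= mulr_sumr; apply: eq_bigr => k _.
    rewrite -mulr_sumr /log_coef; move: (\sum_(r <- rs) _) => y.
    by field; rewrite addrC natr1 !pnatr_eq0 -lt0n n0.
  congr (_ * _); rewrite big_seq [RHS]big_seq; apply: eq_bigr => x xr.
  rewrite geometric //.
    by rewrite -normc_eq0 gt_eqF // (lt_le_trans c0) // c1.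
  rewrite -normc_eq0 gt_eqF // (lt_le_trans c0) //.
  by have := Hu2 x xr; rewrite normcB (_ : x - _ = x - x0 - xi * u%:C) //; ring.
have := cder_mean_value gd; move=> /(_ ((normc xi / c) ^+ m.+1)).
rewrite /g mulr1 mulr0 addr0.
have -> : \sum_(k < m) log_coef x0 k.+1 * xi ^+ k.+1 * 0%:C ^+ k.+1 = 0.
  by apply: big1 => k _; rewrite expr0n /= mulr0.
rewrite subr0 big_ord_recl expr0 mulr1 /=.
have -> : \sum_(k < m) log_coef x0 k.+1 * xi ^+ k.+1 * 1%:C ^+ k.+1 =
    \sum_(i < m) log_coef x0 i.+1 * xi ^+ i.+1.
  by apply: eq_bigr => k _; rewrite expr1n mulr1.
rewrite opprD addrA [_ - f x0 - _]addrAC; apply=> u u01.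
have [Hu1 Hu2] := H u u01; move: (u01) => /andP[u0 u1].
rewrite /g' normc_inv_n.
have X0 : 0 <= (normc xi / c) ^+ m.+1 by rewrite exprn_ge0 // divr_ge0 ?normc_ge0 // ltW.
rewrite -[leRHS]mul1r.
apply: le_trans (@inv_n_size 1 _ X0 _); last by rewrite mul1n.
rewrite ler_wpM2l ?invr_ge0 ?ler0n //.
apply: le_trans (normc_sum _ _ _) _.
rewrite big_seq (@le_trans _ _ (\sum_(x <- rs | x \in rs) (normc xi / c) ^+ m.+1)) //.
  apply: ler_sum => x xr; rewrite normcM normcNN normcX exprS.
  apply: ler_pM; rewrite ?normc_ge0 ?exprn_ge0 ?normc_ge0 //.
    rewrite normcM normcV ler_wpM2l ?normc_ge0 // lef_pV2 ?posrE //.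
      by have := Hu2 x xr; rewrite normcB (_ : x - _ = x - x0 - xi * u%:C) //; ring.
    by have := Hu2 x xr; rewrite normcB (_ : x - _ = x - x0 - xi * u%:C);
      [exact: lt_le_trans|ring].
  rewrite lerXn2r // ?nnegrE ?normc_ge0 //; first by rewrite divr_ge0 ?normc_ge0 // ltW.
  rewrite !normcM normcV normc_real ger0_norm //.
  apply: ler_pM; rewrite ?mulr_ge0 ?invr_ge0 ?normc_ge0 //.
    by rewrite ler_piMr ?normc_ge0.
  by rewrite lef_pV2 ?posrE ?c1 // (lt_le_trans c0) ?c1.
by rewrite -big_seq big_const_seq count_predT iter_addr_0 -[_ *+ _]mulr_natl.
Qed.

Lemma log_coef_le c x0 k : (0 < k)%N -> 0 < c -> (size rs <= n)%N ->
  (forall x, x \in rs -> c <= normc (x0 - x)) ->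
  normc (log_coef x0 k) <= c^-1 ^+ k.
Proof.
case: k => // k _ c0 sz H; rewrite /log_coef normcNN normc_inv_n.
have X0 : 0 <= c^-1 ^+ k.+1 by rewrite exprn_ge0 // invr_ge0 ltW.
rewrite -[leRHS]mul1r.
apply: le_trans (@inv_n_size 1 _ X0 _); last by rewrite mul1n.
rewrite ler_wpM2l ?invr_ge0 ?ler0n // normcM normcV.
have -> : normc (k.+1%:R : R[i]) = k.+1%:R.
  by rewrite -(rmorph_nat (real_complex R)) normc_real ger0_norm.
apply: (@le_trans _ _ (normc (\sum_(r <- rs) (r - x0) ^- k.+1))).
  by rewrite ler_piMl ?normc_ge0 // invf_le1 ?ltr0n // ler1n.
apply: le_trans (normc_sum _ _ _) _.
rewrite big_seq (@le_trans _ _ (\sum_(x <- rs | x \in rs) c^-1 ^+ k.+1)) //.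
  apply: ler_sum => x xr; rewrite normcV normcX -exprVn.
  have hx := H x xr; have x0' := lt_le_trans c0 hx.
  rewrite lerXn2r ?nnegrE ?invr_ge0 ?normc_ge0 ?(ltW c0) //.
  by rewrite normcB lef_pV2 ?posrE.
by rewrite -big_seq big_const_seq count_predT iter_addr_0 -[_ *+ _]mulr_natl.
Qed.

End Potential.

(** * Potentials along horizontal segments and parabolas *)

Section Curves.
Variables (R : realType) (E0 r C V s0 : R).
Hypotheses (r0 : 0 < r) (r1 : r <= 1) (C0 : 0 < C) (V0 : 0 <= V).
Implicit Types (v w : nat -> R) (n N m : nat) (t z : R[i]) (eta kap sig : R).

(** One family covers both curves: [kap] = 0 with [sig] = s0 + delta is a horizontal segment, [sig]
    = s0 is the parabola. The first component is common to both. *)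
Definition zcurve eta t : R[i] := (E0 +i* eta) + r%:C * t.
Definition scurve sig kap t : R[i] := sig%:C + kap%:C * (1 - t ^+ 2).

Definition curve_poly v w eta sig kap k : {poly R[i]} :=
  ((E0 +i* eta) - (v k)%:C)%:P + r%:C *: 'X -
  (w k)%:C *: ((sig%:C + kap%:C)%:P - kap%:C *: 'X^2).

Lemma curve_polyE v w eta sig kap k t :
  (curve_poly v w eta sig kap k).[t] =
  energy v w (zcurve eta t) (scurve sig kap t) k.
Proof.
rewrite /curve_poly /energy /zcurve /scurve.
by rewrite !(hornerD, hornerN, hornerZ, hornerC, hornerX, hornerXn); ring.
Qed.

Lemma size_curve_poly v w eta sig kap k :
  (size (curve_poly v w eta sig kap k) <= 3)%N.
Proof.
have sZ (c : R[i]) (p : {poly R[i]}) : (size p <= 3)%N -> (size (c *: p) <= 3)%N.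
  by move=> h; exact: leq_trans (size_scale_leq _ _) h.
have sC (c : R[i]) : (size (c%:P) <= 3)%N by exact: leq_trans (size_polyC_leq1 _) _.
have sD (p q : {poly R[i]}) : (size p <= 3)%N -> (size q <= 3)%N -> (size (p + q)%R <= 3)%N.
  by move=> h1 h2; rewrite (leq_trans (size_polyD _ _)) // geq_max h1.
have sN (p : {poly R[i]}) : (size p <= 3)%N -> (size (- p)%R <= 3)%N.
  by rewrite size_polyN.
apply: (sD); last apply: (sN).
  by apply: (sD); [exact: sC|apply: sZ; rewrite size_polyX].
by apply: (sZ); apply: (sD); [exact: sC|apply: sN; apply: sZ; rewrite size_polyXn].
Qed.

Lemma dp_root (b : nat -> {poly R[i]}) n (rs : seq R[i]) x :
  dp b n = lead_coef (dp b n) *: \prod_(y <- rs) ('X - y%:P) ->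
  x \in rs -> dp (fun k => (b k).[x]) n = 0.
Proof.
move=> brs xr; rewrite -dp_horner brs hornerZ.
have /eqP -> : root (\prod_(y <- rs) ('X - y%:P)) x by rewrite root_prod_XsubC.
by rewrite mulr0.
Qed.

Lemma size_roots (b : nat -> {poly R[i]}) d n (rs : seq R[i]) :
  (forall k, (size (b k) <= d.+1)%N) -> dp b n != 0 ->
  dp b n = lead_coef (dp b n) *: \prod_(y <- rs) ('X - y%:P) ->
  (size rs <= d * n)%N.
Proof.
move=> sb nz brs; have := size_dp n sb.
rewrite brs size_scale ?lead_coef_eq0 //.
by rewrite size_prod_XsubC ltnS.
Qed.

Lemma dp_poly_neq0 (b : nat -> {poly R[i]}) n t :
  (forall k, 0 < Im (b k).[t]) -> dp b n != 0.
Proof.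
move=> h; have [h1 _] := dp_upper n h; apply: contraNneq h1 => e.
by rewrite -dp_horner e horner0.
Qed.

Section OneCurve.
Variables (v w : nat -> R) (n N : nat) (eta sig kap : R).
Hypotheses (n0 : (0 < n)%N) (N0 : (0 < N)%N) (eta0 : 0 < eta) (eta1 : eta <= 1).
Hypotheses (vV : forall k, `|v k| <= V) (wC : forall k, `|w k| <= C).
Hypotheses (kapr : 4 * (C * `|kap|) <= r) (kap1 : `|kap| <= 1) (sig1 : `|sig| <= `|s0| + 1).

Let b := curve_poly v w eta sig kap.

(** The imaginary part of [scurve] is - 2 kap Re t Im t, and 4 C |kap| <= r turns its effect into at
    most half of r |Re t| |Im t|. It holds for all complex t, hence also at roots outside the
    rectangle. *)
Lemma Im_curve t k : eta + r * Im t - r / 2 * (`|Re t| * `|Im t|) <= Im (b k).[t].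
Proof.
rewrite curve_polyE Im_energy.
have -> : Im (zcurve eta t) = eta + r * Im t.
  by rewrite /zcurve !reim /=; ring.
have -> : Im (scurve sig kap t) = - 2 * (kap * (Re t * Im t)).
  by rewrite /scurve expr2 !reim /=; ring.
rewrite lerD2l lerN2 (le_trans (ler_norm _)) // !normrM normrN normr_nat.
set x := `|Re t| * `|Im t|; have x0 : 0 <= x by rewrite mulr_ge0.
have h := ler_wpM2r x0 kapr.
have h2 : `|kap| * x * `|w k| <= `|kap| * x * C by rewrite ler_wpM2l ?mulr_ge0.
lra.
Qed.

Lemma Im_curve_ge t k : `|Re t| <= 1 -> 0 <= Im t -> eta + r * Im t / 2 <= Im (b k).[t].
Proof.
move=> x1 y0; apply: le_trans (Im_curve t k); rewrite [`|Im t|]ger0_norm //.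
have : `|Re t| * Im t <= Im t by rewrite ler_piMl.
by move=> /(ler_wpM2l (ltW r0)); lra.
Qed.

Lemma Im_curve_gt0 t k : `|Re t| <= 1 -> 0 <= Im t -> eta <= Im (b k).[t].
Proof.
move=> x1 y0; apply: le_trans (Im_curve_ge k x1 y0).
by rewrite lerDl divr_ge0 // mulr_ge0 // ltW.
Qed.

(** Within eta / 3 of a point of the rectangle one has |Re x| <= 2, so [Im_curve] still leaves more
    than eta - 2 r eta / 3 > 0; there the determinant cannot vanish. *)
Lemma curve_root_dist rs t x :
  dp b n = lead_coef (dp b n) *: \prod_(y <- rs) ('X - y%:P) -> x \in rs ->
  `|Re t| <= 1 -> 0 <= Im t -> eta / 3 <= normc (t - x).
Proof.
move=> brs xr t1 t0; rewrite leNgt; apply/negP => lt3.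
have h := dp_root brs xr.
suff up k : 0 < Im (b k).[x] by have [] := dp_upper n up; rewrite h eqxx.
apply: lt_le_trans (Im_curve x k).
have := le_lt_trans (normc_Re _) lt3; have := le_lt_trans (normc_Im _) lt3.
rewrite !reim ltr_norml => /andP[i1 i2]; rewrite ltr_norml => /andP[i3 i4].
have X2 : `|Re x| <= 2.
  by move: t1 eta1; rewrite !ler_norml => /andP[u1 u2] e1; lra.
have Y2 : `|Im x| <= Im t + eta / 3 by rewrite ler_norml; lra.
have XY : `|Re x| * `|Im x| <= 2 * (Im t + eta / 3) by rewrite ler_pM.
have := ler_wpM2l (ltW r0) XY.
have re : r * eta <= eta by rewrite ler_piMl // ltW.
have := ltr_pM2l r0 (Im t - eta / 3) (Im x).
rewrite (_ : Im t - eta / 3 < Im x); last lra.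
move=> /idP; lra.
Qed.

(** On the rectangle |t| <= 2, hence |z| <= |E0| + 3 and |s| <= |s0| + 1 + 5. *)
Definition curve_Q : R := `|E0| + 3 + V + C * (`|s0| + 6).

Lemma curve_Q_ge0 : 0 <= curve_Q.
Proof. by rewrite /curve_Q !addr_ge0 // mulr_ge0 ?addr_ge0 // ltW. Qed.

Lemma normc_energy_le t k : `|Re t| <= 1 -> 0 <= Im t <= 1 ->
  normc (b k).[t] <= curve_Q.
Proof.
move=> x1 /andP[y0 y1]; rewrite curve_polyE /energy.
have t2 : normc t <= 2.
  by apply: le_trans (normc_le_Re_Im _) _; rewrite [`|Im t|]ger0_norm //; lra.
apply: le_trans (le_normcB _ _) _; apply: le_trans (lerD (le_normcB _ _) (lexx _)) _.
rewrite normcM !normc_real.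
have zb : normc (zcurve eta t) <= `|E0| + 3.
  apply: le_trans (normcD _ _) _; rewrite normcM normc_real.
  have := normc_le_Re_Im (E0 +i* eta) => /=; rewrite [`|eta|]gtr0_norm // [`|r|]gtr0_norm //.
  have : r * normc t <= 1 * 2 by rewrite ler_pM ?normc_ge0 // ltW.
  move: (Num.sqrt _) (r * normc t) => A B; move: r1 eta1; lra.
have sb : normc (scurve sig kap t) <= `|s0| + 6.
  apply: le_trans (normcD _ _) _; rewrite normcM !normc_real.
  have : normc (1 - t ^+ 2) <= 5.
    apply: le_trans (le_normcB _ _) _; rewrite normc1 normcX.
    have : normc t ^+ 2 <= 2 ^+ 2 by rewrite lerXn2r ?nnegrE ?normc_ge0.
    by rewrite !expr2; lra.
  move=> h; have : `|kap| * normc (1 - t ^+ 2) <= 1 * 5 by rewrite ler_pM ?normc_ge0.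
  by move: (`|kap| * _) sig1 => A; lra.
rewrite /curve_Q; apply: lerD; first by apply: lerD.
by rewrite mulrC ler_pM ?normc_ge0.
Qed.

(** The first three terms bound the potential itself; [12 / eta] and [72 / eta ^+ 2] come from
    [path_diff_le] and [path_diff2_le] for degree 2 and root distance eta / 3. Neither n nor the
    sequences v, w enter. *)
Definition curve_const eta : R :=
  ln (curve_Q + 1) + pi + ln (2 / eta) + 12 / eta + 72 / eta ^+ 2.

Definition gridpt N i j : R[i] := (-1 + i%:R / N%:R) +i* (j%:R / N%:R).

Lemma gridpt_Re i j : (i <= N.*2)%N -> `|Re (gridpt N i j)| <= 1.
Proof.
move=> iN /=; have Np : (0 : R) < N%:R by rewrite ltr0n.
have : i%:R / N%:R <= 2 :> R.
  by rewrite ler_pdivrMr // -natrM ler_nat mul2n.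
have : 0 <= i%:R / N%:R :> R by rewrite divr_ge0 ?ler0n.
by rewrite ler_norml; lra.
Qed.

Lemma gridpt_Im i j : (j <= N)%N -> 0 <= Im (gridpt N i j) <= 1.
Proof.
move=> jN /=; have Np : (0 : R) < N%:R by rewrite ltr0n.
by rewrite divr_ge0 ?ler0n // ler_pdivrMr // mul1r ler_nat.
Qed.

Definition curve_cpot t := cpot v w n (zcurve eta t) (scurve sig kap t).

Lemma curve_cpotE t : curve_cpot t = (n%:R^-1)%:C * logdp (fun k => (b k).[t]) n.
Proof.
rewrite /curve_cpot /cpot; congr (_ * logdp _ _); apply/funext => k.
by rewrite curve_polyE.
Qed.

Lemma curve_discrete_hol :
  discrete_hol N (curve_const eta) (fun i j => curve_cpot (gridpt N i j)).
Proof.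
move=> i j iN jN; have [t Et] : exists t, t = gridpt N i j by exists (gridpt N i j).
have [rs brs] := closed_roots (dp b n).
have Np : (0 : R) < N%:R by rewrite ltr0n.
pose h : R := N%:R^-1; have h0 : 0 < h by rewrite invr_gt0.
have tx1 : gridpt N i.+1 j = t + h%:C.
  by rewrite Et /gridpt; apply: complexP; rewrite /= -?natr1 /h /=; ring.
have ty1 : gridpt N i j.+1 = t + 'i%C * h%:C.
  by rewrite Et /gridpt; apply: complexP; rewrite !reim /= -?natr1 /h /=; ring.
have tRe : `|Re t| <= 1 by rewrite Et; apply: gridpt_Re; exact: ltnW.
have tIm : 0 <= Im t <= 1 by rewrite Et; apply: gridpt_Im; exact: ltnW.
have tRe' : `|Re t + h| <= 1.
  by have := gridpt_Re j iN; rewrite tx1 !reim /=.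
have sz : (size rs <= 2 * n)%N.
  apply: (@size_roots b) brs; first exact: size_curve_poly.
  apply: (@dp_poly_neq0 _ _ t) => k; apply: lt_le_trans (Im_curve_gt0 k tRe _) => //.
  by case/andP: tIm.
have c0 : 0 < eta / 3 by rewrite divr_gt0.
have P t' : `|Re t'| <= 1 -> 0 <= Im t' -> (forall k, 0 < Im (b k).[t']) /\
     (forall x, x \in rs -> eta / 3 <= normc (t' - x)).
  move=> h1 h2; split => [k|x xr].
    exact: lt_le_trans (Im_curve_gt0 k h1 h2).
  exact: curve_root_dist brs xr h1 h2.
have Px u : 0 <= u <= 1 -> (forall k, 0 < Im (b k).[t + h%:C * u%:C]) /\
     (forall x, x \in rs -> eta / 3 <= normc (t + h%:C * u%:C - x)).
  move=> /andP[u0 u1]; apply: P; rewrite !reim /=.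
    move: tRe tRe'; rewrite !ler_norml !mul0r subr0 => /andP[p1 p2] /andP[p3 p4].
    have : 0 <= h * u by rewrite mulr_ge0 // ltW.
    have : h * u <= h by rewrite ler_piMr // ltW.
    lra.
  by case/andP: tIm => p _; rewrite mul0r mulr0 !addr0.
have Py u : 0 <= u <= 1 -> (forall k, 0 < Im (b k).[t + ('i%C * h%:C) * u%:C]) /\
     (forall x, x \in rs -> eta / 3 <= normc (t + ('i%C * h%:C) * u%:C - x)).
  move=> /andP[u0 u1]; apply: P; rewrite !reim /=.
    by rewrite (_ : _ + _ = Re t) //; ring.
  have : 0 <= h * u by rewrite mulr_ge0 // ltW.
  case/andP: tIm => p _ q; rewrite (_ : _ + _ = Im t + h * u); last by ring.
  exact: addr_ge0.
rewrite !curve_cpotE tx1 ty1 -Et.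
have e0 : 0 < eta ^+ 2 by rewrite exprn_gt0.
have L0 : 0 <= ln (curve_Q + 1).
  by rewrite ln_ge0 // lerDr curve_Q_ge0.
have L1 : 0 <= ln (2 / eta) by rewrite ln_ge0 // ler_pdivlMr // mul1r; move: eta1; lra.
have L2 := pi_ge0 R.
have L3 : 0 <= 12 / eta by rewrite divr_ge0 // ltW.
have L4 : 0 <= 72 / eta ^+ 2 by rewrite divr_ge0 // ltW.
have nxi : normc ('i%C * h%:C : R[i]) = h by rewrite normcM normci mul1r normc_real gtr0_norm.
have nh : normc (h%:C : R[i]) = h by rewrite normc_real gtr0_norm.
have eqh : 2 * (2%:R * (h / (eta / 3))) = 12 / eta * h.
  by field; rewrite gt_eqF.
have leh : 12 / eta * h <= curve_const eta * h.
  by rewrite ler_wpM2r ?(ltW h0) // /curve_const; lra.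
split.
- rewrite normcM normc_real gtr0_norm ?invr_gt0 ?ltr0n // ler_pdivrMl ?ltr0n //.
  apply: le_trans (@normc_logdp R _ eta curve_Q n _ curve_Q_ge0 _ _) _.
  + by rewrite eta0.
  + by move=> k; apply: Im_curve_gt0 => //; case/andP: tIm.
  + by move=> k; exact: normc_energy_le.
  have n1 : 1 <= n%:R :> R by rewrite ler1n.
  have : ln (2 / eta) <= n%:R * ln (2 / eta) by rewrite ler_peMl.
  have : 0 <= n%:R * (12 / eta) by rewrite mulr_ge0 // ler0n.
  have : 0 <= n%:R * (72 / eta ^+ 2) by rewrite mulr_ge0 // ler0n.
  rewrite /curve_const !mulrDr; lra.
- apply: le_trans (path_diff_le n0 brs c0 sz Px) _.
  by rewrite nh eqh.
- apply: le_trans (path_diff_le n0 brs c0 sz Py) _.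
  by rewrite nxi eqh.
- apply: le_trans (path_diff2_le n0 brs c0 (ltW h0) sz Px Py) _.
  have -> : 2 * (2%:R * (2 * h ^+ 2 / (eta / 3) ^+ 2)) = 72 / eta ^+ 2 * h ^+ 2.
    by field; rewrite gt_eqF.
  by rewrite ler_wpM2r ?exprn_ge0 ?(ltW h0) // /curve_const; lra.
Qed.

End OneCurve.
End Curves.

Section CauchyTransfer.
Variables (R : realType) (E0 r C V s0 : R).
Hypotheses (r0 : 0 < r) (r1 : r <= 1) (C0 : 0 < C) (V0 : 0 <= V).
Implicit Types (v w : nat -> R) (n N m : nat) (t z s : R[i]) (eta kap sig : R).

Definition line_poly v w z k : {poly R[i]} := (z - (v k)%:C)%:P - (w k)%:C *: 'X.

Lemma line_polyE v w z k s : (line_poly v w z k).[s] = energy v w z s k.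
Proof.
rewrite /line_poly /energy !(hornerD, hornerN, hornerZ, hornerC, hornerX); ring.
Qed.

Lemma size_line_poly v w z k : (size (line_poly v w z k) <= 2)%N.
Proof.
rewrite (leq_trans (size_polyD _ _)) // geq_max size_polyN.
rewrite (leq_trans (size_polyC_leq1 _)) //=.
by rewrite (leq_trans (size_scale_leq _ _)) // size_polyX.
Qed.

Definition line_roots v w n z : seq R[i] := sval (closed_roots (dp (line_poly v w z) n)).

Lemma line_rootsP v w n z : dp (line_poly v w z) n =
  lead_coef (dp (line_poly v w z) n) *: \prod_(y <- line_roots v w n z) ('X - y%:P).
Proof. exact: svalP (closed_roots _). Qed.

(** The expansion is in s alone, at fixed z: along the upper sides of the rectangle z is a mere
    parameter. *)
Definition taylor_coef v w n z : nat -> R[i] :=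
  log_coef (line_poly v w z) n (line_roots v w n z) s0%:C.

Section Bounds.
Variables (v w : nat -> R) (n : nat) (z : R[i]) (d : R).
Hypotheses (n0 : (0 < n)%N) (wC : forall k, `|w k| <= C) (d0 : 0 < d).
Hypothesis zd : d <= Im z.

Let line_upper s : C * `|Im s| <= d / 2 -> forall k, 0 < Im (line_poly v w z k).[s].
Proof.
move=> sd k; rewrite line_polyE.
apply: lt_le_trans (Im_energy_ge v z s (wC k)).
by move: d0 zd; lra.
Qed.

Let line_dist s x : C * `|Im s| <= d / 2 -> x \in line_roots v w n z ->
  d / (2 * C) <= normc (s - x).
Proof.
move=> sd xr; have h := dp_root (line_rootsP v w n z) xr.
rewrite leNgt; apply/negP; rewrite ltr_pdivlMr ?mulr_gt0 // => lt.
suff up k : 0 < Im (line_poly v w z k).[x] by have [] := dp_upper n up; rewrite h eqxx.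
rewrite line_polyE; apply: lt_le_trans (Im_energy_ge v z x (wC k)).
have h1 : C * `|Im (s - x)| <= C * normc (s - x) by rewrite ler_wpM2l ?normc_Im // ltW.
have h2 : C * `|Im x| <= C * `|Im s| + C * `|Im (s - x)|.
  rewrite -mulrDr ler_wpM2l ?(ltW C0) //.
  have -> : Im x = Im s - Im (s - x) by rewrite !reim; ring.
  exact: ler_normB.
by move: zd; lra.
Qed.

Let line_size : (size (line_roots v w n z) <= n)%N.
Proof.
rewrite -[leqRHS]mul1n; apply: (@size_roots _ (line_poly v w z)); last exact: line_rootsP.
  exact: size_line_poly.
apply: (@dp_poly_neq0 _ _ _ 0); apply: line_upper.
by rewrite normr0 mulr0 divr_ge0 // ltW.
Qed.

Let cpotE s : cpot v w n z s = (n%:R^-1)%:C * logdp (fun k => (line_poly v w z k).[s]) n.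
Proof.
rewrite /cpot; congr (_ * logdp _ _); apply/funext => k; by rewrite line_polyE.
Qed.

(** For Im z >= d the determinant does not vanish in the strip C |Im s| < d, so the half strip C |Im
    s| <= d / 2 keeps the distance d / (2 C) to all roots in s. This distance shrinks with the
    height, which the weight below has to compensate. *)
Lemma taylor_le m xi : (0 < m)%N ->
  (forall u : R, 0 <= u <= 1 -> C * `|Im (xi * u%:C)| <= d / 2) ->
  normc (cpot v w n z (s0%:C + xi) - \sum_(k < m) taylor_coef v w n z k * xi ^+ k) <=
    2 * (normc xi * (2 * C / d)) ^+ m.
Proof.
move=> m0 H; rewrite cpotE.
have c0 : 0 < d / (2 * C) by rewrite divr_gt0 // mulr_gt0.
have -> : 2 * C / d = (d / (2 * C))^-1 by rewrite invf_div.
apply: (log_taylor n0 (line_rootsP v w n z)) => // u u01.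
have h : C * `|Im (s0%:C + xi * u%:C)| <= d / 2.
  by rewrite cImD /= add0r; exact: H.
by split => [|x xr]; [exact: line_upper|exact: line_dist].
Qed.

Lemma taylor_coef_le k : (0 < k)%N -> normc (taylor_coef v w n z k) <= (2 * C / d) ^+ k.
Proof.
move=> k0; have c0 : 0 < d / (2 * C) by rewrite divr_gt0 // mulr_gt0.
have -> : 2 * C / d = (d / (2 * C))^-1 by rewrite invf_div.
rewrite /taylor_coef; apply: (log_coef_le _ n0) => // x xr; apply: line_dist xr.
by rewrite normr0 mulr0 divr_ge0 // ltW.
Qed.

End Bounds.

(* The weight [weight ^+ m] vanishes to order m at the corners -1 and 1. *)
Definition weight t : R[i] := 1 - t ^+ 2.

(** On the lateral sides |1 - t^2|^2 = y^4 + 4 y^2 and on the top it is x^4 + 4; both are at most 9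
    y^2. The linear decay in the height cancels one factor 1 / Im t. *)
Lemma normc_weight t : `|Re t| <= 1 -> 0 <= Im t <= 1 -> `|Re t| = 1 \/ Im t = 1 ->
  normc (weight t) <= 3 * Im t.
Proof.
move=> x1 /andP[y0 y1] xy.
rewrite -(@ler_pXn2r _ 2) ?nnegrE ?normc_ge0 ?mulr_ge0 //.
rewrite normc_sqr /weight expr2 !reim /= exprMn.
have X2 : Re t ^+ 2 <= 1 by rewrite -real_normK ?num_real // expr_le1.
have Y2 : Im t ^+ 2 <= 1 by rewrite expr_le1.
have X0 := sqr_ge0 (Re t); have Y0 := sqr_ge0 (Im t).
move: xy X2 Y2 X0 Y0; rewrite !expr2; move: (Re t) (Im t) y0 y1 {x1} => x y y0 y1.
case=> [x1|->].
  have -> : x * x = 1 by rewrite -expr2 -real_normK ?num_real // x1 expr1n.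
  have e : x * x = 1 by rewrite -expr2 -real_normK ?num_real // x1 expr1n.
  move=> *.
  have -> : (0 - (x * y + y * x)) * (0 - (x * y + y * x)) = 4 * (x * x) * (y * y) by ring.
  by rewrite e; nra.
move=> *; nra.
Qed.

Lemma discrete_hol_weight m : exists2 B : R, 0 <= B & forall N, (0 < N)%N ->
  discrete_hol N B (fun i j => weight (gridpt R N i j) ^+ m).
Proof.
elim: m => [|m [B B0 IH]].
  exists 1 => // N N0 i j _ _; rewrite !expr0 normc1 !subrr mulr0 subrr normc0 !mul1r.
  by split=> //; rewrite ?exprn_ge0 ?invr_ge0 ?ler0n.
exists (4 * (7 * B)); first by rewrite !mulr_ge0.
move=> N N0; have Np : (0 : R) < N%:R by rewrite ltr0n.
pose h : R := N%:R^-1; have h0 : 0 < h by rewrite invr_gt0.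
have h1 : h <= 1 by rewrite invf_le1 // ler1n.
have W : discrete_hol N 7 (fun i j => weight (gridpt R N i j)).
  move=> i j iN jN.
  have [t Et] : exists t, t = gridpt R N i j by exists (gridpt R N i j).
  have tx1 : gridpt R N i.+1 j = t + h%:C.
    by rewrite Et /gridpt; apply: complexP; rewrite /= -?natr1 /h /=; ring.
  have ty1 : gridpt R N i j.+1 = t + 'i%C * h%:C.
    by rewrite Et /gridpt; apply: complexP; rewrite !reim /= -?natr1 /h /=; ring.
  have tRe : `|Re t| <= 1 by rewrite Et; apply: gridpt_Re => //; exact: ltnW.
  have tIm : 0 <= Im t <= 1 by rewrite Et; apply: gridpt_Im => //; exact: ltnW.
  rewrite tx1 ty1 -Et -/h /weight.
  have t2 : normc t <= 2.
    apply: le_trans (normc_le_Re_Im _) _; case/andP: tIm => y0 y1.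
    by rewrite [`|Im t|]ger0_norm //; lra.
  have nh : normc (h%:C : R[i]) = h by rewrite normc_real gtr0_norm.
  have n2 : normc (h%:C ^+ 2 : R[i]) = h ^+ 2 by rewrite normcX nh.
  have hh : h ^+ 2 <= h by rewrite expr2 ler_piMl // ltW.
  have th : normc t * h <= 2 * h by rewrite ler_wpM2r // ltW.
  have i2 : ('i%C : R[i]) * 'i%C = -1 by rewrite -expr2 sqr_i.
  have ni2 : normc ('i%C * 'i%C * h%:C ^+ 2 : R[i]) = h ^+ 2.
    by rewrite i2 mulN1r normcNN n2.
  split.
  - apply: le_trans (le_normcB _ _) _; rewrite normc1 normcX.
    have : normc t ^+ 2 <= 2 ^+ 2 by rewrite lerXn2r ?nnegrE ?normc_ge0.
    by rewrite expr2 expr2; lra.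
  - have -> : 1 - (t + h%:C) ^+ 2 - (1 - t ^+ 2) = - (2%:R%:C * (t * h%:C) + h%:C ^+ 2).
      by rewrite rmorph_nat; ring.
    rewrite normcNN; apply: le_trans (normcD _ _) _.
    rewrite n2 !normcM nh normc_real normr_nat; move: (normc t) th => a th; lra.
  - have -> : 1 - (t + 'i%C * h%:C) ^+ 2 - (1 - t ^+ 2) =
        - (2%:R%:C * (t * h%:C) * 'i%C + 'i%C * 'i%C * h%:C ^+ 2).
      by rewrite rmorph_nat; ring.
    rewrite normcNN; apply: le_trans (normcD _ _) _.
    rewrite ni2 !normcM nh normc_real normr_nat normci !mulr1.
    move: (normc t) th => a th; lra.
  - have -> : 1 - (t + 'i%C * h%:C) ^+ 2 - (1 - t ^+ 2) -
        'i%C * (1 - (t + h%:C) ^+ 2 - (1 - t ^+ 2)) =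
        - ('i%C * 'i%C * h%:C ^+ 2) + 'i%C * h%:C ^+ 2 by ring.
    apply: le_trans (normcD _ _) _; rewrite normcNN ni2 normcM n2 normci mul1r.
    by have := exprn_ge0 2 (ltW h0); lra.
have := discrete_holM N0 W (IH N N0).
by rewrite (_ : (fun _ _ => _ * _) = (fun i j => weight (gridpt R N i j) ^+ m.+1)) //;
  apply/funext => i; apply/funext => j; rewrite exprS.
Qed.

End CauchyTransfer.

(** * Averages along a parabola *)

Section Transfer.
Variables (R : realType) (E0 r C V s0 : R).
Hypotheses (r0 : 0 < r) (r1 : r <= 1) (C0 : 0 < C) (V0 : 0 <= V).
Implicit Types (n N m k : nat) (t z s : R[i]) (eta kap sig delta : R).

(** Everything over which the elimination has to be uniform is bundled: the potential along an
    orbit, the scale n, the mesh 1 / N and the height eta. The sequences are arbitrary bounded ones;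
    orbits are inserted later. *)
Record sample := Sample { pv : nat -> R; pw : nat -> R; pn : nat; pN : nat; peta : R }.
Implicit Types p : sample.

Definition good p := [/\ (0 < pn p)%N, (0 < pN p)%N, 0 < peta p <= 1,
  forall k, `|pv p k| <= V & forall k, `|pw p k| <= C].

Definition gridx N i : R := -1 + i%:R / N%:R.

Definition curve_pot p sig kap (x : R) : R :=
  pot (pv p) (pw p) (pn p) (zcurve E0 r (peta p) x%:C) (scurve sig kap x%:C).

Definition mean_pot p m sig kap : R :=
  (pN p)%:R^-1 * \sum_(i < (pN p).*2)
     curve_pot p sig kap (gridx (pN p) i) * (1 - gridx (pN p) i ^+ 2) ^+ m.

Definition err p : R := curve_const E0 C V s0 (peta p) / (pN p)%:R.

Lemma curve_const_ge0 eta : 0 < eta <= 1 -> 0 <= curve_const E0 C V s0 eta.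
Proof.
move=> /andP[e0 e1]; rewrite /curve_const.
have L0 : 0 <= ln (curve_Q E0 C V s0 + 1).
  by rewrite ln_ge0 // lerDr curve_Q_ge0.
have L1 : 0 <= ln (2 / eta) by rewrite ln_ge0 // ler_pdivlMr // mul1r; lra.
have L2 := pi_ge0 R.
have L3 : 0 <= 12 / eta by rewrite divr_ge0 // ltW.
have L4 : 0 <= 72 / eta ^+ 2 by rewrite divr_ge0 ?exprn_ge0 // ltW.
lra.
Qed.

Lemma err_ge0 p : good p -> 0 <= err p.
Proof. by case=> _ _ h _ _; rewrite divr_ge0 ?ler0n // curve_const_ge0. Qed.

Let G p sig kap i j := cpot (pv p) (pw p) (pn p)
  (zcurve E0 r (peta p) (gridpt R (pN p) i j)) (scurve sig kap (gridpt R (pN p) i j)).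

Lemma gridpt0 N i : gridpt R N i 0 = (gridx N i)%:C.
Proof. by rewrite /gridpt mul0r. Qed.

Lemma mean_potE p m sig kap : mean_pot p m sig kap =
  Re (((pN p)%:R^-1)%:C * \sum_(i < (pN p).*2)
        G p sig kap i 0%N * weight (gridpt R (pN p) i 0) ^+ m).
Proof.
rewrite cReM /= mul0r subr0 cRe_sum; congr (_ * _); apply: eq_bigr => i _.
rewrite /G gridpt0 /weight.
have -> : (1 - (gridx (pN p) i)%:C ^+ 2) ^+ m = ((1 - gridx (pN p) i ^+ 2) ^+ m)%:C.
  by rewrite !(rmorphXn, rmorphB, rmorph1).
by rewrite cReM Re_cpot /= mulr0 subr0.
Qed.

Lemma mean_pot_cauchy m : exists2 B : R, 0 <= B & forall p sig kap, good p ->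
  4 * (C * `|kap|) <= r -> `|kap| <= 1 -> `|sig| <= `|s0| + 1 ->
  `|mean_pot p m sig kap - Re (upper_sum (pN p) (fun i j =>
      G p sig kap i j * weight (gridpt R (pN p) i j) ^+ m))| <= B * err p.
Proof.
have [B B0 WB] := discrete_hol_weight R m.
exists (8 * B); first by rewrite mulr_ge0.
move=> p sig kap [n0 N0 /andP[e0 e1] vV wC] kr k1 s1.
have GB : discrete_hol (pN p) (curve_const E0 C V s0 (peta p)) (G p sig kap).
  by move=> i j iN jN; exact: (@curve_discrete_hol R E0 r C V s0 r0 r1 C0 V0 _ _ _ _ _ sig kap n0 N0 e0 e1
    vV wC kr k1 s1 i j iN jN).
have := discrete_cauchy N0 (discrete_holM N0 GB (WB _ N0)).
rewrite mean_potE -cReN -cReD => h; apply: le_trans (normc_Re _) (le_trans h _).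
by rewrite /err; lra.
Qed.

(** These numbers depend on neither delta nor kap, which makes them the link between horizontal
    segments and parabolas. *)
Definition coef m k p : R := Re (upper_sum (pN p) (fun i j =>
  taylor_coef s0 (pv p) (pw p) (pn p) (zcurve E0 r (peta p) (gridpt R (pN p) i j)) k *
  weight (gridpt R (pN p) i j) ^+ m)).

Let Im_zcurve p t : Im (zcurve E0 r (peta p) t) = peta p + r * Im t.
Proof. by rewrite /zcurve !reim /=; ring. Qed.

Let weight_pow0 t m : (0 < m)%N -> normc (weight t) <= 3 * 0 -> weight t ^+ m = 0.
Proof.
move=> m0; rewrite mulr0 => h; apply/eqP; rewrite expf_eq0 m0 /= -normc_eq0.
by rewrite eq_le h normc_ge0.
Qed.

(** The remainder (2 C |xi| / (r Im t))^m times (3 Im t)^m loses its dependence on the height. At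
    the corners Im t = 0, where the Taylor bound is void, the weight vanishes. *)
Lemma upper_taylor p m t xi : good p -> (0 < m)%N ->
  `|Re t| <= 1 -> 0 <= Im t <= 1 -> `|Re t| = 1 \/ Im t = 1 ->
  (forall u : R, 0 <= u <= 1 -> C * `|Im (xi * u%:C)| <= r * Im t / 2) ->
  normc ((cpot (pv p) (pw p) (pn p) (zcurve E0 r (peta p) t) (s0%:C + xi) -
    \sum_(k < m) taylor_coef s0 (pv p) (pw p) (pn p) (zcurve E0 r (peta p) t) k * xi ^+ k)
    * weight t ^+ m) <= 2 * (normc xi * (6 * C / r)) ^+ m.
Proof.
move=> [n0 N0 /andP[e0 e1] vV wC] m0 x1 y01 xy H; have /andP[y0 y1] := y01.
have W := normc_weight x1 y01 xy.
have X0 : 0 <= normc xi * (6 * C / r).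
  by rewrite mulr_ge0 ?normc_ge0 // divr_ge0 ?mulr_ge0 // ltW.
have [y00|yn0] := eqVneq (Im t) 0.
  rewrite y00 in W.
  by rewrite (weight_pow0 m0 W) mulr0 normc0 mulr_ge0 // exprn_ge0.
have yp : 0 < Im t by rewrite lt_neqAle eq_sym yn0.
have d0 : 0 < r * Im t by rewrite mulr_gt0.
rewrite normcM normcX.
have zd : r * Im t <= Im (zcurve E0 r (peta p) t) by rewrite Im_zcurve; lra.
have h1 := taylor_le s0 C0 (pv p) n0 wC d0 zd m0 H.
have h2 : normc (weight t) ^+ m <= (3 * Im t) ^+ m.
  by rewrite lerXn2r ?nnegrE ?normc_ge0 // mulr_ge0.
apply: le_trans (ler_pM _ _ h1 h2) _; rewrite ?normc_ge0 ?exprn_ge0 ?normc_ge0 //.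
rewrite -[leLHS]mulrA -exprMn.
have -> : normc xi * (2 * C / (r * Im t)) * (3 * Im t) = normc xi * (6 * C / r).
  by field; rewrite yn0 gt_eqF.
exact: lexx.
Qed.

(** Of the m factors of the weight, k cancel the growth (2 C / (r Im t))^k of the coefficient and
    the others are at most 3; this is why k must not exceed m. *)
Lemma upper_coef p m k t : good p -> (0 < k <= m)%N ->
  `|Re t| <= 1 -> 0 <= Im t <= 1 -> `|Re t| = 1 \/ Im t = 1 ->
  normc (taylor_coef s0 (pv p) (pw p) (pn p) (zcurve E0 r (peta p) t) k * weight t ^+ m) <=
    (6 * C / r + 3) ^+ m.
Proof.
move=> [n0 N0 /andP[e0 e1] vV wC] /andP[k0 km] x1 y01 xy; have /andP[y0 y1] := y01.
have W := normc_weight x1 y01 xy.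
have K0 : 0 < C / r by rewrite divr_gt0.
have [y00|yn0] := eqVneq (Im t) 0.
  rewrite y00 in W; rewrite (weight_pow0 (leq_trans k0 km) W) mulr0 normc0 exprn_ge0 //.
  by rewrite -mulrA; lra.
have yp : 0 < Im t by rewrite lt_neqAle eq_sym yn0.
have d0 : 0 < r * Im t by rewrite mulr_gt0.
rewrite normcM normcX.
have zd : r * Im t <= Im (zcurve E0 r (peta p) t) by rewrite Im_zcurve; lra.
have h1 := taylor_coef_le s0 C0 (pv p) n0 wC d0 zd k0.
have h2 : normc (weight t) ^+ m <= (3 * Im t) ^+ k * 3 ^+ (m - k).
  rewrite -{1}(subnKC km) exprD; apply: ler_pM; rewrite ?exprn_ge0 ?normc_ge0 //.
    by rewrite lerXn2r ?nnegrE ?normc_ge0 // mulr_ge0.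
  by rewrite lerXn2r ?nnegrE ?normc_ge0 // (le_trans W) // ler_piMr.
apply: le_trans (ler_pM _ _ h1 h2) _; rewrite ?normc_ge0 ?exprn_ge0 ?normc_ge0 //.
have -> : (6 * C / r + 3) ^+ m = (6 * C / r + 3) ^+ k * (6 * C / r + 3) ^+ (m - k).
  by rewrite -exprD subnKC.
rewrite mulrA -exprMn.
have -> : 2 * C / (r * Im t) * (3 * Im t) = 6 * (C / r).
  by field; rewrite yn0 gt_eqF.
rewrite -[6 * C / r]mulrA.
have K1 : 0 <= 6 * (C / r) by rewrite mulr_ge0 // ltW.
apply: ler_pM; rewrite ?exprn_ge0 //.
  by rewrite lerXn2r ?nnegrE ?addr_ge0 // lerDl.
by rewrite lerXn2r ?nnegrE ?addr_ge0 // lerDr.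
Qed.

Lemma coef_le p m k : good p -> (0 < k <= m)%N ->
  `|coef m k p| <= 4 * (6 * C / r + 3) ^+ m.
Proof.
move=> gp km; have [n0 N0 _ vV wC] := gp.
apply: le_trans (normc_Re _) _; apply: upper_sum_le => // [i iN|j jN].
  apply: upper_coef => //.
  - by apply: gridpt_Re => //; exact: ltnW.
  - exact: gridpt_Im.
  - by right; rewrite /= divff // pnatr_eq0 -lt0n.
have Np : (0 : R) < (pN p)%:R by rewrite ltr0n.
split; apply: upper_coef => //.
- exact: gridpt_Re.
- by apply: gridpt_Im => //; exact: ltnW.
- by left; rewrite /= mul0r addr0 normrN1.
- exact: gridpt_Re.
- by apply: gridpt_Im => //; exact: ltnW.
- left; rewrite /= -muln2 natrM mulrAC divff ?gt_eqF // mul1r.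
  by rewrite (_ : -1 + 2 = 1) ?normr1 //; ring.
Qed.

Let upper_points p (F : R[i] -> R[i]) (M : R) : good p ->
  (forall t, `|Re t| <= 1 -> 0 <= Im t <= 1 -> `|Re t| = 1 \/ Im t = 1 ->
     normc (F t) <= M) ->
  normc (upper_sum (pN p) (fun i j => F (gridpt R (pN p) i j))) <= 4 * M.
Proof.
move=> [n0 N0 _ vV wC] H.
have Np : (0 : R) < (pN p)%:R by rewrite ltr0n.
apply: upper_sum_le => // [i iN|j jN].
  apply: H.
  - by apply: gridpt_Re => //; exact: ltnW.
  - exact: gridpt_Im.
  - by right; rewrite /= divff // gt_eqF.
split; apply: H.
- exact: gridpt_Re.
- by apply: gridpt_Im => //; exact: ltnW.
- by left; rewrite /= mul0r addr0 normrN1.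
- exact: gridpt_Re.
- by apply: gridpt_Im => //; exact: ltnW.
- left; rewrite /= -muln2 natrM mulrAC divff ?gt_eqF // mul1r.
  by rewrite (_ : -1 + 2 = 1) ?normr1 //; ring.
Qed.

(* [xi] is a constant for horizontal segments and a multiple of [weight] for
   parabolas. *)
Lemma upper_expansion p m (xi : R[i] -> R[i]) (M : R) : good p -> (0 < m)%N ->
  (forall t, `|Re t| <= 1 -> 0 <= Im t <= 1 -> `|Re t| = 1 \/ Im t = 1 ->
    normc (xi t) <= M /\
    forall u : R, 0 <= u <= 1 -> C * `|Im (xi t * u%:C)| <= r * Im t / 2) ->
  normc (upper_sum (pN p) (fun i j =>
    cpot (pv p) (pw p) (pn p) (zcurve E0 r (peta p) (gridpt R (pN p) i j))
      (s0%:C + xi (gridpt R (pN p) i j)) * weight (gridpt R (pN p) i j) ^+ m) -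
   \sum_(k < m) upper_sum (pN p) (fun i j => taylor_coef s0 (pv p) (pw p) (pn p)
       (zcurve E0 r (peta p) (gridpt R (pN p) i j)) k *
     xi (gridpt R (pN p) i j) ^+ k * weight (gridpt R (pN p) i j) ^+ m)) <=
  8 * (M * (6 * C / r)) ^+ m.
Proof.
move=> gp m0 H.
have -> : \sum_(k < m) upper_sum (pN p) (fun i j => taylor_coef s0 (pv p) (pw p) (pn p)
       (zcurve E0 r (peta p) (gridpt R (pN p) i j)) k *
     xi (gridpt R (pN p) i j) ^+ k * weight (gridpt R (pN p) i j) ^+ m) =
  upper_sum (pN p) (fun i j => \sum_(k < m) 1 * (taylor_coef s0 (pv p) (pw p) (pn p)
       (zcurve E0 r (peta p) (gridpt R (pN p) i j)) k *
     xi (gridpt R (pN p) i j) ^+ k * weight (gridpt R (pN p) i j) ^+ m)).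
  by rewrite upper_sum_sum; apply: eq_bigr => k _; rewrite mul1r.
rewrite -mulN1r -upper_sumZ -upper_sumD.
rewrite (_ : 8 * _ = 4 * (2 * (M * (6 * C / r)) ^+ m)); last by ring.
pose F t := (cpot (pv p) (pw p) (pn p) (zcurve E0 r (peta p) t) (s0%:C + xi t) -
    \sum_(k < m) taylor_coef s0 (pv p) (pw p) (pn p) (zcurve E0 r (peta p) t) k * xi t ^+ k)
    * weight t ^+ m.
rewrite (_ : (fun i j => _ + _) = (fun i j => F (gridpt R (pN p) i j))); last first.
  apply/funext => i; apply/funext => j; rewrite /F mulrBl mulN1r mulr_suml.
  by congr (_ - _); apply: eq_bigr => k _; rewrite mul1r.
apply: upper_points => // t x1 y1 xy; have [h1 h2] := H t x1 y1 xy.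
apply: le_trans (upper_taylor gp m0 x1 y1 xy h2) _.
have q0 : 0 <= 6 * C / r by rewrite divr_ge0 ?mulr_ge0 // ltW.
have M0 : 0 <= M by exact: le_trans (normc_ge0 _) h1.
apply: ler_wpM2l => //; apply: lerXn2r; rewrite ?nnegrE; last exact: ler_wpM2r.
- by rewrite mulr_ge0 ?normc_ge0.
- exact: mulr_ge0.
Qed.

Lemma horizontal_expansion m : (0 < m)%N -> exists2 B : R, 0 <= B &
  forall p delta, good p -> `|delta| <= 1 ->
  `|mean_pot p m (s0 + delta) 0 - \sum_(k < m) delta ^+ k * coef m k p| <=
    8 * (`|delta| * (6 * C / r)) ^+ m + B * err p.
Proof.
move=> m0; have [B B0 HB] := mean_pot_cauchy m; exists B => // p delta gp d1.
have c1 : 4 * (C * `|0 : R|) <= r by rewrite normr0 !mulr0 ltW.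
have c2 : `|0 : R| <= 1 by rewrite normr0.
have c3 : `|s0 + delta| <= `|s0| + 1.
  by apply: le_trans (ler_normD _ _) _; rewrite lerD2l.
have h1 := HB p (s0 + delta) 0 gp c1 c2 c3.
pose xi (t : R[i]) : R[i] := delta%:C.
have hyp t : `|Re t| <= 1 -> 0 <= Im t <= 1 -> `|Re t| = 1 \/ Im t = 1 ->
    normc (xi t) <= `|delta| /\
    forall u : R, 0 <= u <= 1 -> C * `|Im (xi t * u%:C)| <= r * Im t / 2.
  move=> x1 y1 xy; rewrite normc_real; split=> // u _; rewrite cImM /= mulr0 mul0r addr0 normr0 mulr0.
  by rewrite divr_ge0 ?mulr_ge0 ?(ltW r0) //; case/andP: y1.
have h2 := @upper_expansion p m xi `|delta| gp m0 hyp; rewrite /xi in h2.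
set U := upper_sum _ _ in h1; set U' := upper_sum _ _ in h2.
have UU : U = U'.
  rewrite /U /U'; congr upper_sum; apply/funext => i; apply/funext => j.
  by rewrite /G /scurve mul0r addr0 rmorphD.
have cE : \sum_(k < m) delta ^+ k * coef m k p = Re (\sum_(k < m)
   upper_sum (pN p) (fun i j => taylor_coef s0 (pv p) (pw p) (pn p)
       (zcurve E0 r (peta p) (gridpt R (pN p) i j)) k *
     delta%:C ^+ k * weight (gridpt R (pN p) i j) ^+ m)).
  rewrite cRe_sum; apply: eq_bigr => k _; rewrite /coef.
  rewrite (_ : (fun i j => _ * _ * _) = (fun i j => delta%:C ^+ k *
     (taylor_coef s0 (pv p) (pw p) (pn p)
       (zcurve E0 r (peta p) (gridpt R (pN p) i j)) k * weight (gridpt R (pN p) i j) ^+ m))).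
    by rewrite upper_sumZ -rmorphXn cReM /= mul0r subr0.
  by apply/funext => i; apply/funext => j; ring.
rewrite cE; apply: le_trans (ler_distD (Re U) _ _) _; rewrite addrC; apply: lerD => //.
by rewrite UU -cReN -cReD; apply: le_trans (normc_Re _) h2.
Qed.

(** The k-th power of the increment contributes k further factors of the weight, so order k carries
    the weight m + k. The constant 18 is 3 times 6, as the increment is at most 3 |kap|; the factor
    12 keeps its imaginary part within the strip of [taylor_le]. *)
Lemma parabola_expansion m kap : (0 < m)%N -> 12 * (C * `|kap|) <= r -> `|kap| <= 1 ->
  exists2 B : R, 0 <= B & forall p, good p ->
  `|mean_pot p m s0 kap - \sum_(k < m) kap ^+ k * coef (m + k) k p| <=
    8 * (`|kap| * (18 * C / r)) ^+ m + B * err p.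
Proof.
move=> m0 kr k1; have [B B0 HB] := mean_pot_cauchy m; exists B => // p gp.
have kC : 0 <= C * `|kap| by rewrite mulr_ge0 // ltW.
have c1 : 4 * (C * `|kap|) <= r by lra.
have c3 : `|s0| <= `|s0| + 1 by lra.
have h1 := HB p s0 kap gp c1 k1 c3.
pose xi (t : R[i]) : R[i] := kap%:C * weight t.
have hyp t : `|Re t| <= 1 -> 0 <= Im t <= 1 -> `|Re t| = 1 \/ Im t = 1 ->
    normc (xi t) <= 3 * `|kap| /\
    forall u : R, 0 <= u <= 1 -> C * `|Im (xi t * u%:C)| <= r * Im t / 2.
  move=> x1 y1 xy; have W := normc_weight x1 y1 xy; have /andP[y0 yy1] := y1.
  rewrite /xi normcM normc_real; split.
    by rewrite mulrC ler_wpM2r // (le_trans W) // ler_piMr.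
  move=> u /andP[u0 u1].
  have : `|Im (kap%:C * weight t * u%:C)| <= `|kap| * (3 * Im t).
    apply: le_trans (normc_Im _) _; rewrite !normcM !normc_real -mulrA.
    by rewrite ler_wpM2l // [`|u|]ger0_norm // (le_trans _ W) // ler_piMr ?normc_ge0.
  move=> /(ler_wpM2l (ltW C0)) h; apply: (le_trans h).
  have := ler_wpM2r y0 kr; have := mulr_ge0 (ltW r0) y0; lra.
have h2 := @upper_expansion p m xi (3 * `|kap|) gp m0 hyp; rewrite /xi in h2.
set U := upper_sum _ _ in h1; set U' := upper_sum _ _ in h2.
have UU : U = U'.
  by rewrite /U /U'; congr upper_sum; apply/funext => i; apply/funext => j.
have cE : \sum_(k < m) kap ^+ k * coef (m + k) k p = Re (\sum_(k < m)
   upper_sum (pN p) (fun i j => taylor_coef s0 (pv p) (pw p) (pn p)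
       (zcurve E0 r (peta p) (gridpt R (pN p) i j)) k *
     (kap%:C * weight (gridpt R (pN p) i j)) ^+ k * weight (gridpt R (pN p) i j) ^+ m)).
  rewrite cRe_sum; apply: eq_bigr => k _; rewrite /coef.
  rewrite (_ : (fun i j => _ * _ * _) = (fun i j => kap%:C ^+ k *
     (taylor_coef s0 (pv p) (pw p) (pn p)
       (zcurve E0 r (peta p) (gridpt R (pN p) i j)) k * weight (gridpt R (pN p) i j) ^+ (m + k)))).
    by rewrite upper_sumZ -rmorphXn cReM /= mul0r subr0.
  by apply/funext => i; apply/funext => j; rewrite exprMn exprD; ring.
rewrite cE; apply: le_trans (ler_distD (Re U) _ _) _; rewrite addrC; apply: lerD => //.
rewrite UU -cReN -cReD; apply: le_trans (normc_Re _) (le_trans h2 _).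
by rewrite (_ : 3 * `|kap| * (6 * C / r) = `|kap| * (18 * C / r)) //; ring.
Qed.

(** For each k < m the horizontal expansion with weight m + k determines the coefficient needed in
    the parabola expansion. The list and c are chosen before the sample, so neither n, N, eta nor
    the orbit influences them. *)
Theorem transfer (P : R -> Prop) m kap :
  (forall eps, 0 < eps -> exists2 delta, P delta & 0 < `|delta| < eps) ->
  (0 < m)%N -> 12 * (C * `|kap|) <= r -> `|kap| <= 1 ->
  forall eps, 0 < eps -> exists2 l : seq (R * (nat * {delta | P delta})), True &
  exists2 c : R, 0 <= c & forall p, good p ->
   mean_pot p m s0 kap <= \sum_(x <- l) x.1 * mean_pot p x.2.1 (s0 + sval x.2.2) 0 +
      (eps + 8 * (`|kap| * (18 * C / r)) ^+ m + c * err p).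
Proof.
move=> accP m0 kr k1 eps eps0.
pose J := (nat * {delta | P delta})%type.
pose M p (j : J) := mean_pot p j.1 (s0 + sval j.2) 0.
have ac m' k : (0 < m')%N -> (k < m')%N -> approximable good M err (coef m' k).
  move=> m'0; have [B B0 HB] := horizontal_expansion m'0.
  pose K := 8 * (6 * C / r + 3) ^+ m' + B.
  have Cr : 0 <= 6 * C / r by rewrite divr_ge0 ?mulr_ge0 // ltW.
  have p0 : 0 <= (6 * C / r + 3) ^+ m' by rewrite exprn_ge0 // addr_ge0.
  have K0 : 0 <= K by rewrite addr_ge0 ?mulr_ge0.
  apply: (@approx_coef R sample J good M err (coef m') m' K) => //.
    move=> i p gp /andP[i0 im]; apply: le_trans (coef_le gp _) _.
      by rewrite i0 ltnW.
    by rewrite /K; lra.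
  move=> e e0; have [|delta Pd /andP[d0 d1]] := accP (Num.min 1 e).
    by rewrite lt_min ltr01.
  move: d1; rewrite lt_min => /andP[d1 de].
  exists delta; first by rewrite d0.
  exists (m', exist _ delta Pd) => p gp.
  apply: le_trans (HB p delta gp (ltW d1)) _.
  rewrite exprMn; apply: lerD; last first.
    by rewrite ler_wpM2r ?err_ge0 // /K lerDr mulr_ge0.
  rewrite mulrCA mulrC ler_wpM2r ?exprn_ge0 // /K.
  have : (6 * C / r) ^+ m' <= (6 * C / r + 3) ^+ m'.
    by rewrite lerXn2r ?nnegrE ?addr_ge0 // lerDl.
  by lra.
have : approximable good M err (fun p => \sum_(k < m) kap ^+ k * coef (m + k) k p).
  apply: (@approx_sum R sample J good M err m (fun k p => kap ^+ k * coef (m + k) k p)) => k km.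
  apply: approxZ.
  by apply: ac; [rewrite addn_gt0 m0|rewrite -{1}[k]add0n ltn_add2r].
move=> /(_ eps eps0)[l _ [c c0 hl]].
have [B B0 HB] := parabola_expansion m0 kr k1.
exists l => //; exists (c + B); first exact: addr_ge0.
move=> p gp; have := hl p gp; have := HB p gp.
rewrite !ler_norml => /andP[_ h1] /andP[_ h2]; rewrite /M in h2; lra.
Qed.

End Transfer.

(** * Recovering the value at the centre *)

Section LogAverage.
Variable R : realType.
Implicit Types (N k : nat) (y eta x : R) (rho : R[i]).

Lemma ln_1B_ge x : 0 <= x <= 1 / 2 -> - (2 * x) <= ln (1 - x).
Proof.
move=> /andP[x0 x1]; have p : 0 < 1 - x by lra.
rewrite lerNl -lnV ?posrE //.
have -> : (1 - x)^-1 = 1 + x / (1 - x) by field; rewrite gt_eqF.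
apply: le_trans (le_ln1Dx _) _.
  by rewrite (lt_le_trans (ltrN10 _)) // divr_ge0 // ltW.
by rewrite ler_pdivrMr //; nra.
Qed.

(** This is N! >= (N / e)^N, by induction from (1 + 1/N)^N <= e. *)
Lemma sum_ln_ge N : (0 < N)%N -> - N%:R <= \sum_(d < N) ln (d.+1%:R / N%:R) :> R.
Proof.
move=> N0.
have E : forall M, (0 < M)%N -> \sum_(d < M) ln (d.+1%:R / M%:R) =
    \sum_(d < M) ln (d.+1%:R) - M%:R * ln M%:R :> R.
  move=> M M0; have -> : M%:R * ln M%:R = \sum_(d < M) ln (M%:R) :> R.
    by rewrite sumr_const card_ord mulr_natl.
  by rewrite -sumrB; apply: eq_bigr => d _; rewrite ln_div ?posrE ?ltr0n.
rewrite E //; case: N N0 => // N _; elim: N => [|N IH].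
  by rewrite big_ord1 ln1 mulr0 subr0 oppr_le0.
rewrite big_ord_recr /=.
have : N.+1%:R * (ln N.+2%:R - ln N.+1%:R) <= 1 :> R.
  rewrite -ln_div ?posrE ?ltr0n //.
  have -> : N.+2%:R / N.+1%:R = 1 + N.+1%:R^-1 :> R.
    by rewrite -natr1 mulrDl divff ?mul1r // pnatr_eq0.
  rewrite mulrC -ler_pdivlMr ?ltr0n // div1r; apply: le_ln1Dx.
  by rewrite (lt_le_trans (ltrN10 _)) // invr_ge0.
have -> : N.+2%:R = N.+1%:R + 1 :> R by rewrite natr1.
move: IH; set A := \sum_(_ < _) _; set l2 := ln (_ + 1); set l1 := ln _; lra.
Qed.

Lemma big_ord_recr_pred (F : nat -> R) N : (0 < N)%N ->
  \sum_(d < N) F d = \sum_(d < N.-1) F d + F N.-1.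
Proof. by case: N => // N _; rewrite big_ord_recr. Qed.

Lemma big_ord_recl_pred (F : nat -> R) N : (0 < N)%N ->
  \sum_(d < N) F d = F 0%N + \sum_(d < N.-1) F d.+1.
Proof. by case: N => // N _; rewrite big_ord_recl. Qed.

(** Seen from rho, the grid points on either side lie at distances at least 0, 1, 2, ... times y /
    N, so [sum_ln_ge] bounds each side by - N relative to ln y. The nearest point on each side has
    only the distance eta and costs another N. *)
Lemma sum_grid_ge N y eta rho : (0 < N)%N -> 0 < y -> 0 < eta ->
  ln (y / eta) <= N%:R ->
  (forall j, (j <= N.*2)%N ->
     eta <= normc (((j%:R - N%:R) * (y / N%:R))%:C - rho)) ->
  (N.*2.+1)%:R * (ln y - 2) <=
    \sum_(j < N.*2.+1) ln (normc (((j%:R - N%:R) * (y / N%:R))%:C - rho)).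
Proof.
move=> N0 y0 e0 lnN H.
have Np : (0 : R) < N%:R by rewrite ltr0n.
pose X j : R := normc (((j%:R - N%:R) * (y / N%:R))%:C - rho).
have X0 j : (j <= N.*2)%N -> 0 < X j by move=> /H; exact: lt_le_trans.
(* Lower bound for the logarithm, relative to ln y, of the d-th point on one side. In the second
   case [d] is rebound to the original successor; truncation at 0 makes partial sums over any number
   of points comparable. *)
pose g d : R := if d is d'.+1 then Num.min 0 (ln (d%:R / N%:R)) else Num.min 0 (ln (eta / y)).
have g0 d : g d <= 0 by case: d => [|d]; rewrite /g ge_min lexx.
have gN d : (N <= d)%N -> g d = 0.
  case: d => [|d Nd]; first by rewrite leqn0 -(negbK (N == 0%N)) -lt0n N0.
  rewrite /g; apply/min_idPl; rewrite ln_ge0 // ler_pdivlMr // mul1r ler_nat //.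
have gsum : - (2 * N%:R) <= \sum_(d < N) g d.
  have h1 : - N%:R <= g 0%N.
    rewrite /g le_min oppr_le0 ler0n /= lerNl -lnV ?posrE ?divr_gt0 //.
    by rewrite invf_div.
  have h2 : \sum_(d < N) ln (d.+1%:R / N%:R) <= \sum_(d < N.-1) g d.+1.
    rewrite (big_ord_recr_pred (fun d => ln (d.+1%:R / N%:R))) // prednK //.
    rewrite divff ?gt_eqF // ln1 addr0.
    apply: ler_sum => d _; rewrite /g le_min lexx andbT.
    apply: ln_le0; rewrite ler_pdivrMr // mul1r ler_nat.
    by have := ltn_ord d; lia.
  have := sum_ln_ge N0; rewrite (big_ord_recl_pred g) //; lra.
have gK K : - (2 * N%:R) <= \sum_(d < K) g d.
  apply: le_trans gsum _.
  have [KN|NK] := leqP K N.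
    rewrite -!(big_mkord xpredT g) (@big_cat_nat _ _ _ K 0 N) //=.
    by rewrite gerDl; apply: sumr_le0.
  rewrite -!(big_mkord xpredT g) (@big_cat_nat _ _ _ N 0 K) //=; last exact: ltnW.
  rewrite [X in _ + X]big_nat [X in _ + X]big1 ?addr0 // => d /andP[Nd _].
  exact: gN.
have yN : 0 <= y / N%:R by rewrite divr_ge0 // ltW.
(* The real part of rho as a position on the index scale; [b'] clamps it to the grid, which only
   decreases the distances, and [k] is the last index not exceeding it. *)
pose b : R := N%:R + Re rho * N%:R / y.
pose b' : R := Num.max 0 (Num.min b (N.*2)%:R).
have b'0 : 0 <= b' by rewrite le_max lexx.
have b'N : b' <= (N.*2)%:R by rewrite ge_max ler0n ge_min lexx orbT.
pose k := Num.truncn b'.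
have /andP[kb bk] := truncn_itv b'0; rewrite -/k in kb bk.
have kN : (k <= N.*2)%N by rewrite -(ler_nat R); exact: le_trans kb b'N.
have dist j : (j <= N.*2)%N -> `|j%:R - b'| * (y / N%:R) <= X j.
  move=> jN; apply: le_trans (normc_Re _).
  have -> : Re (((j%:R - N%:R) * (y / N%:R))%:C - rho) = (j%:R - b) * (y / N%:R).
    by rewrite !reim /= /b; field; rewrite !gt_eqF.
  rewrite normrM [`|y / _|]ger0_norm // ler_wpM2r //.
  have j0 : 0 <= j%:R :> R by [].
  have j2 : j%:R <= (N.*2)%:R :> R by rewrite ler_nat.
  rewrite /b'; have [b1|b1] := leP b (N.*2)%:R.
    have [b2|b2] := leP 0 b => //.
    by rewrite subr0 !ger0_norm // ?subr_ge0; lra.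
  rewrite max_r ?ler0n // [leLHS]distrC [leRHS]distrC.
  by rewrite [leLHS]ger0_norm ?subr_ge0 // ger0_norm ?subr_ge0; lra.
have Xg j d : (j <= N.*2)%N -> (d%:R <= `|j%:R - b'|) -> ln y + g d <= ln (X j).
  move=> jN dj; have Xj := X0 j jN.
  case: d dj => [_|d dj].
    have : g 0%N <= ln (eta / y) by rewrite /g ge_min lexx orbT.
    have : ln eta <= ln (X j) by rewrite ler_ln ?posrE // H.
    by rewrite ln_div ?posrE //; lra.
  have : g d.+1 <= ln (d.+1%:R / N%:R) by rewrite /g ge_min lexx orbT.
  have : ln (d.+1%:R / N%:R * y) <= ln (X j).
    have p0 : 0 < d.+1%:R / N%:R * y by rewrite mulr_gt0 // divr_gt0 // ltr0n.
    rewrite ler_ln ?posrE //.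
    apply: le_trans (dist j jN); rewrite mulrAC -mulrA.
    by rewrite ler_wpM2r.
  have -> : ln (d.+1%:R / N%:R * y) = ln (d.+1%:R / N%:R) + ln y.
    by rewrite lnM // posrE // divr_gt0 // ltr0n.
  by lra.
rewrite -/(X _).
have main : (N.*2.+1)%:R * ln y + (- (2 * N%:R) - (2 * N%:R)) <= \sum_(j < N.*2.+1) ln (X j).
  rewrite -(big_mkord xpredT (fun j => ln (X j))) (@big_cat_nat _ _ _ k.+1) //=.
  have s1 : (k.+1)%:R * ln y + - (2 * N%:R) <= \sum_(0 <= j < k.+1) ln (X j).
    rewrite big_mkord.
    apply: le_trans (_ : (k.+1)%:R * ln y + \sum_(d < k.+1) g d <= _).
      by rewrite lerD2l gK.
    have -> : (k.+1)%:R * ln y = \sum_(d < k.+1) ln y by rewrite sumr_const card_ord mulr_natl.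
    rewrite -big_split /= (reindex_inj rev_ord_inj) /=.
    apply: ler_sum => j _; rewrite subSS.
    have jk : (j <= k)%N by rewrite -ltnS.
    apply: Xg; first exact: leq_trans jk kN.
    rewrite natrB // distrC.
    apply: le_trans (ler_norm _); lra.
  have s2 : (N.*2.+1 - k.+1)%:R * ln y + - (2 * N%:R) <=
      \sum_(k.+1 <= j < N.*2.+1) ln (X j).
    apply: le_trans (_ : (N.*2.+1 - k.+1)%:R * ln y + \sum_(d < N.*2.+1 - k.+1) g d <= _).
      by rewrite lerD2l gK.
    have -> : (N.*2.+1 - k.+1)%:R * ln y = \sum_(d < N.*2.+1 - k.+1) ln y.
      by rewrite sumr_const card_ord mulr_natl.
    rewrite -big_split /= -[X in \sum_(X <= _ < _) _]add0n big_addn big_mkord.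
    apply: ler_sum => d _; have dN := ltn_ord d.
    apply: Xg; first by rewrite -ltnS addnC -ltn_subRL.
    rewrite natrD; apply: le_trans (ler_norm _); rewrite -natr1 in bk *; lra.
  apply: le_trans (lerD s1 s2).
  have -> : (N.*2.+1)%:R = (k.+1)%:R + (N.*2.+1 - k.+1)%:R :> R.
    by rewrite -natrD subnKC.
  by rewrite mulrDl; lra.
apply: le_trans main; rewrite mulrBr -natr1 -muln2 natrM; lra.
Qed.

(** Opposite grid points are paired: (x - rho)(- x - rho) = rho^2 - x^2, so the linear terms cancel
    and the loss is quadratic in y / |rho|. *)
Lemma ln_far_avg_ge N y rho : (0 < N)%N -> 0 < y -> 2 * y <= normc rho ->
  (N.*2.+1)%:R * (ln (normc rho) - (y / normc rho) ^+ 2) <=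
    \sum_(j < N.*2.+1) ln (normc (((j%:R - N%:R) * (y / N%:R))%:C - rho)).
Proof.
move=> N0 y0 yr; have Np : (0 : R) < N%:R by rewrite ltr0n.
have r0 : 0 < normc rho by apply: lt_le_trans yr; rewrite mulr_gt0.
pose x (j : 'I_(N.*2.+1)) : R := (j%:R - N%:R) * (y / N%:R).
pose u := (y / normc rho) ^+ 2.
have u0 : 0 <= u by rewrite sqr_ge0.
have u1 : u <= 1 / 2.
  have h : y / normc rho <= 1 / 2 by rewrite ler_pdivrMr //; lra.
  have : u <= (1 / 2) ^+ 2 by rewrite lerXn2r ?nnegrE ?divr_ge0 // ltW.
  by rewrite expr2; lra.
have xy j : `|x j| <= y.
  have yN : 0 <= y / N%:R by rewrite divr_ge0 // ltW.
  rewrite normrM [`|y / _|]ger0_norm // mulrA ler_pdivrMr // mulrC.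
  rewrite ler_wpM2l ?(ltW y0) //.
  have h : (j : nat)%:R <= N%:R + N%:R :> R.
    by rewrite -natrD ler_nat addnn -ltnS.
  by have : 0 <= (j : nat)%:R :> R by []; rewrite ler_norml; lra.
have xr j : x (rev_ord j) = - x j.
  rewrite /x /= -mulNr; congr (_ * _).
  rewrite subSS natrB; last by rewrite -ltnS.
  have -> : (N.*2)%:R = N%:R + N%:R :> R by rewrite -natrD addnn.
  by ring.
have x2 j : x j ^+ 2 <= normc rho ^+ 2 * u.
  rewrite /u -exprMn mulrC mulfVK ?gt_eqF // -[leLHS]real_normK ?num_real //.
  by rewrite lerXn2r ?nnegrE // ltW.
have pair j : 2 * (ln (normc rho) - u) <=
    ln (normc ((x j)%:C - rho)) + ln (normc ((x (rev_ord j))%:C - rho)).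
  have pos i : 0 < normc ((x i)%:C - rho).
    rewrite normcB; apply: lt_le_trans (normcB_ge _ _).
    by rewrite normc_real subr_gt0 (le_lt_trans (xy i)) //; lra.
  rewrite -lnM ?posrE // -normcM xr.
  have -> : ((x j)%:C - rho) * ((- x j)%:C - rho) = rho ^+ 2 - (x j ^+ 2)%:C.
    by rewrite rmorphN rmorphXn /=; ring.
  have le : normc rho ^+ 2 * (1 - u) <= normc (rho ^+ 2 - (x j ^+ 2)%:C).
    apply: le_trans (normcB_ge _ _); rewrite normcX normc_real ger0_norm ?sqr_ge0 //.
    by rewrite mulrBr mulr1 lerD2l lerN2.
  have p1 : 0 < normc rho ^+ 2 * (1 - u) by rewrite mulr_gt0 ?exprn_gt0 //; lra.
  have {}le : ln (normc rho ^+ 2 * (1 - u)) <= ln (normc (rho ^+ 2 - (x j ^+ 2)%:C)).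
    by rewrite ler_ln ?posrE // (lt_le_trans p1 le).
  apply: le_trans le; rewrite lnM ?posrE ?exprn_gt0 //; last lra.
  rewrite lnXn // -[_ *+ 2]mulr_natl.
  have := @ln_1B_ge u; rewrite u0 u1 => /(_ isT); lra.
have E : \sum_(j < N.*2.+1) ln (normc ((x j)%:C - rho)) =
    \sum_(j < N.*2.+1) ln (normc ((x (rev_ord j))%:C - rho)).
  by rewrite (reindex_inj rev_ord_inj).
have : \sum_(j < N.*2.+1) (2 * (ln (normc rho) - u)) <=
  \sum_(j < N.*2.+1) (ln (normc ((x j)%:C - rho)) + ln (normc ((x (rev_ord j))%:C - rho))).
  by apply: ler_sum => j _; exact: pair.
rewrite big_split /= -E sumr_const card_ord -[_ *+ N.*2.+1]mulr_natl.
rewrite mulrCA => h.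
change ((N.*2.+1)%:R * (ln (normc rho) - u) <= \sum_(j < N.*2.+1) ln (normc ((x j)%:C - rho))).
by move: h; rewrite -[2]/(2%:R); set A := \sum_(_ < _) _; set B := _ * (ln _ - u); lra.
Qed.

End LogAverage.

(** * Bounding the value at t = 0 by a window average *)

Section Center.
Variables (R : realType) (E0 r C V s0 : R).
Hypotheses (r0 : 0 < r) (r1 : r <= 1) (C0 : 0 < C) (V0 : 0 <= V).
Implicit Types (n N m k q : nat) (t z s rho : R[i]) (eta kap sig : R).

Lemma ln_normc_roots (b : nat -> {poly R[i]}) n (rs : seq R[i]) t :
  dp b n = lead_coef (dp b n) *: \prod_(y <- rs) ('X - y%:P) ->
  dp (fun k => (b k).[t]) n != 0 ->
  ln (normc (dp (fun k => (b k).[t]) n)) =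
    ln (normc (lead_coef (dp b n))) + \sum_(x <- rs) ln (normc (t - x)).
Proof.
rewrite -dp_horner => brs.
have -> : (dp b n).[t] = lead_coef (dp b n) * \prod_(x <- rs) (t - x).
  by rewrite {1}brs prod_XsubC_neq0.
rewrite mulf_eq0 negb_or.
move: (lead_coef _) => c {brs} /andP[cn]; elim: rs => [|x rs IH].
  by rewrite !big_nil mulr1 addr0.
rewrite !big_cons mulf_eq0 negb_or => /andP[xn pn].
rewrite mulrCA normcM lnM ?posrE ?normc_gt0 ?mulf_neq0 // IH //; ring.
Qed.

(** Two scales separate the roots: the window has radius q^-3, and a root is near if its modulus is
    below 1 / q. Near roots lose at most 3 each but are few, of order n / ln q; each of the
    remaining at most 2 n roots loses at most q^-4. *)
Lemma center_le (p : sample R) kap q N1 : good C V p ->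
  4 * (C * `|kap|) <= r -> `|kap| <= 1 -> (8 <= q)%N -> (0 < N1)%N ->
  pN p = (q ^ 3 * N1)%N -> ln (3 / peta p) <= N1%:R ->
  curve_pot E0 r p s0 kap 0 <=
    (N1.*2.+1)%:R^-1 * \sum_(j < N1.*2.+1)
      curve_pot E0 r p s0 kap (gridx R (pN p) (pN p - N1 + j)) +
    3 * (6 + ln (curve_Q E0 C V s0 + 1) + ln (2 / peta p) / (pn p)%:R) / ln (q%:R / 4) +
    2 / q%:R ^+ 4.
Proof.
move=> gp kr k1 q8 N10 pNE lnN.
have [n0 N0 /andP[e0 e1] vV wC] := gp.
set n := pn p in n0 *; set eta := peta p in e0 e1 lnN *.
have s1 : `|s0| <= `|s0| + 1 by lra.
pose b := curve_poly E0 r (pv p) (pw p) eta s0 kap.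
have [rs brs] := closed_roots (dp b n).
have upE t k : `|Re t| <= 1 -> 0 <= Im t -> eta <= Im (b k).[t].
  exact: (@Im_curve_gt0 R E0 r C r0 (pv p) (pw p) eta s0 kap wC kr t k).
have nz t : `|Re t| <= 1 -> 0 <= Im t -> dp (fun k => (b k).[t]) n != 0.
  move=> h1 h2; have [] // := @dp_upper R (fun k => (b k).[t]) n _.
  by move=> k; apply: lt_le_trans (upE t k h1 h2).
have szr : (size rs <= 2 * n)%N.
  apply: (@size_roots R b) brs; first exact: size_curve_poly.
  by apply: (@dp_poly_neq0 _ _ _ 0) => k; apply: lt_le_trans (upE 0 k _ _) => //;
    rewrite /= ?normr0.
have dist t x : x \in rs -> `|Re t| <= 1 -> 0 <= Im t -> eta / 3 <= normc (t - x).
  move=> xr; exact: (@curve_root_dist R E0 r C r0 r1 (pv p) (pw p) n eta s0 kap e0 e1 wC kr rs t x brs xr).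
have pE (x : R) : `|x| <= 1 -> n%:R * curve_pot E0 r p s0 kap x =
    ln (normc (lead_coef (dp b n))) + \sum_(rho <- rs) ln (normc (x%:C - rho)).
  move=> x1; rewrite -(ln_normc_roots brs) ?nz // /curve_pot /pot mulrA divff ?pnatr_eq0 -?lt0n //.
  rewrite mul1r; congr (ln (normc (dp _ _))); apply/funext => k.
  by rewrite /b curve_polyE.
have qp : (0 : R) < q%:R by rewrite ltr0n (leq_trans _ q8).
have q8R : 8 <= q%:R :> R by rewrite ler_nat.
pose y : R := q%:R ^- 3.
have y0 : 0 < y by rewrite invr_gt0 exprn_gt0.
have y1 : y <= 1 by rewrite invf_le1 ?exprn_gt0 // exprn_ege1 //; lra.
have Np : (0 : R) < (pN p)%:R by rewrite ltr0n.
have N1p : (0 : R) < N1%:R by rewrite ltr0n.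
have N1N : (N1 <= pN p)%N by rewrite pNE leq_pmull // expn_gt0 (leq_trans _ q8).
have gE j : gridx R (pN p) (pN p - N1 + j) = (j%:R - N1%:R) * (y / N1%:R).
  rewrite /gridx natrD natrB // /y pNE natrM natrX; field.
  by rewrite !gt_eqF.
have g1 j : (j <= N1.*2)%N -> `|(j%:R - N1%:R) * (y / N1%:R)| <= 1 :> R.
  move=> jN; have yN : 0 <= y / N1%:R by rewrite divr_ge0 // ltW.
  rewrite normrM [`|y / _|]ger0_norm // mulrA ler_pdivrMr // mul1r.
  have h : (j : nat)%:R <= N1%:R + N1%:R :> R by rewrite -natrD ler_nat addnn.
  have h2 : `|j%:R - N1%:R| <= N1%:R :> R.
    by have : 0 <= (j : nat)%:R :> R by []; rewrite ler_norml; lra.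
  by apply: le_trans h2; rewrite ler_piMr.
pose near rho : bool := normc rho < q%:R^-1.
pose K : R := (N1.*2.+1)%:R.
have K0 : 0 < K by rewrite ltr0n.
(* Far from the window the loss is (y / |rho|)^2, at most 1 for near roots and q^-4 otherwise.
   Inside |rho| < 2 y, ln |rho| exceeds ln y by at most ln 2 <= 1 and the average is at least ln y -
   2. *)
have root_le rho : rho \in rs -> K * ln (normc rho) -
    \sum_(j < N1.*2.+1) ln (normc (((j%:R - N1%:R) * (y / N1%:R))%:C - rho)) <=
    K * (3 * (near rho)%:R + q%:R ^- 4).
  move=> rr.
  have q4 : 0 <= q%:R ^- 4 :> R by rewrite invr_ge0 exprn_ge0 // ltW.
  have rn : 0 < normc rho.
    have := dist 0 rho rr; rewrite normcB subr0 /= normr0 => /(_ ler01 (lexx _)).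
    by apply: lt_le_trans; rewrite divr_gt0.
  have [far|close] := leP (2 * y) (normc rho).
    have h := ln_far_avg_ge N10 y0 far.
    apply: le_trans (_ : K * (y / normc rho) ^+ 2 <= _).
      by move: h; rewrite mulrBr -/K; lra.
    rewrite ler_wpM2l ?(ltW K0) //.
    rewrite /near; case: ltP => [nr|fr] /=.
      have : (y / normc rho) ^+ 2 <= 1.
        rewrite expr_le1 // ?divr_ge0 ?(ltW y0) ?(ltW rn) //.
        by rewrite ler_pdivrMr // mul1r; lra.
      by lra.
    rewrite mulr0 add0r (_ : q%:R ^- 4 = (q%:R ^- 2) ^+ 2); last first.
      by rewrite exprVn -exprM.
    rewrite lerXn2r ?nnegrE ?divr_ge0 ?invr_ge0 ?exprn_ge0 ?(ltW y0) ?(ltW rn) ?(ltW qp) //.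
    rewrite ler_pdivrMr //; apply: le_trans (_ : q%:R ^- 2 * q%:R^-1 <= _).
      by rewrite /y -invfM -exprSr.
    by rewrite ler_wpM2l // invr_ge0 exprn_ge0 // ltW.
  have nr : near rho.
    rewrite /near; apply: lt_le_trans close _.
    have -> : q%:R^-1 = q%:R ^+ 2 * y by rewrite /y; field; rewrite gt_eqF.
    by rewrite ler_wpM2r ?(ltW y0) // expr2; nra.
  have h1 : K * (ln y - 2) <= \sum_(j < N1.*2.+1)
     ln (normc (((j%:R - N1%:R) * (y / N1%:R))%:C - rho)).
    apply: (@sum_grid_ge R N1 y (eta / 3)) => //; first by rewrite divr_gt0.
    - apply: le_trans lnN; rewrite ler_ln ?posrE ?divr_gt0 // invf_div mulrA.
      by rewrite ler_pM2r ?invr_gt0 //; lra.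
    - by move=> j jN; apply: dist => //=; exact: g1.
  have l2 : ln (normc rho) <= 1 + ln y.
    have : ln (normc rho) <= ln (2 * y) by rewrite ler_ln ?posrE ?mulr_gt0 // ltW.
    rewrite lnM ?posrE // => h2.
    have : ln (1 + 1) <= 1 :> R by apply: le_ln1Dx; lra.
    by rewrite (_ : 1 + 1 = 2) //; lra.
  rewrite nr mulr1; have := ler_wpM2l (ltW K0) l2.
  have := mulr_ge0 (ltW K0) q4.
  by move: h1; rewrite !mulrDr; lra.
have sum_rs (f g : R[i] -> R) : (forall rho, rho \in rs -> f rho <= g rho) ->
    \sum_(rho <- rs) f rho <= \sum_(rho <- rs) g rho.
  by move=> fg; rewrite big_seq [leRHS]big_seq; exact: ler_sum.
pose near_count : R := \sum_(rho <- rs) (near rho)%:R.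
(* Counting in the manner of Jensen: the determinant at 0 is not small and at i/2 not large, but
   each near root makes the quotient of the two smaller by a factor 4 / q. The 6 is 3 >= ln 3 for
   each of at most 2 n roots. *)
have count_le : near_count * ln (q%:R / 4) <=
    n%:R * (6 + ln (curve_Q E0 C V s0 + 1)) + ln (2 / eta).
  have i1 : `|Re (0 +i* (1 / 2) : R[i])| <= 1 by rewrite /= normr0.
  have i2 : 0 <= Im (0 +i* (1 / 2) : R[i]) <= 1 by rewrite /=; lra.
  have i3 : 0 <= Im (0 +i* (1 / 2) : R[i]) by case/andP: i2.
  (* The disc of radius 1/4 around i/2 lies inside the domain where [Im_curve] gives positivity,
     uniformly in eta. *)
  have half rho : rho \in rs -> 1 / 4 <= normc ((0 +i* (1 / 2)) - rho).
    move=> rr; rewrite leNgt; apply/negP => lt.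
    have h := dp_root brs rr.
    suff up k : 0 < Im (b k).[rho] by have [] := dp_upper n up; rewrite h eqxx.
    apply: lt_le_trans (@Im_curve R E0 r C (pv p) (pw p) eta s0 kap wC kr rho k).
    have := le_lt_trans (normc_Re _) lt; have := le_lt_trans (normc_Im _) lt.
    rewrite !reim /= ltr_norml => /andP[a1 a2]; rewrite ltr_norml => /andP[a3 a4].
    have x4 : `|Re rho| <= 1 / 4 by rewrite ler_norml; lra.
    have y4 : `|Im rho| <= 3 / 4 by rewrite ler_norml; lra.
    have xy : `|Re rho| * `|Im rho| <= 1 / 4 * (3 / 4) by rewrite ler_pM.
    have := ler_wpM2l (ltW r0) xy.
    have := ltr_pM2l r0 (1 / 4) (Im rho); rewrite (_ : 1 / 4 < Im rho); last lra.
    by move=> /idP; move: r0; lra.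
  have P0 := ln_normc_roots brs (nz 0 _ _); rewrite /= normr0 in P0.
  have {}P0 := P0 ler01 (lexx _).
  have P1 := ln_normc_roots brs (nz _ i1 i3).
  have B0 : - ln (2 / eta) <= ln (normc (dp (fun k => (b k).[0]) n)).
    rewrite -lnV ?posrE ?divr_gt0 // invf_div ler_ln ?posrE ?divr_gt0 //.
      apply: dp_ge; rewrite ?e0 // => k; apply: upE => //=; by rewrite normr0.
    by rewrite normc_gt0 nz //= normr0.
  have B1 : ln (normc (dp (fun k => (b k).[0 +i* (1 / 2)]) n)) <=
      n%:R * ln (curve_Q E0 C V s0 + 1).
    have Q0 : 0 <= curve_Q E0 C V s0 by exact: curve_Q_ge0.
    have Q1 : 0 < curve_Q E0 C V s0 + 1 by rewrite ltr_wpDl.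
    rewrite mulr_natl -lnXn // ler_ln ?posrE ?exprn_gt0 // ?normc_gt0 ?nz //.
    apply: dp_le => // k.
    by apply: (@normc_energy_le R E0 r C V s0 r0 r1 (pv p) (pw p) eta s0 kap e0 e1 vV wC k1 s1).
  have ln3 : ln 3 <= 3 :> R by apply/ltW/ln_sublinear.
  have per rho : rho \in rs -> ln (normc (0 - rho)) - ln (normc ((0 +i* (1 / 2)) - rho)) <=
      3 - (near rho)%:R * ln (q%:R / 4).
    move=> rr; have h := half rho rr.
    have d0 : 0 < normc (0 +i* (1 / 2) - rho) by apply: lt_le_trans h; lra.
    have rn : 0 < normc (0 - rho).
      have := dist 0 rho rr; rewrite /= normr0 => /(_ ler01 (lexx _)).
      by apply: lt_le_trans; rewrite divr_gt0.
    rewrite -ln_div ?posrE //.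
    case nr : (near rho) => /=; last first.
      rewrite mul0r subr0; apply: le_trans ln3; rewrite ler_ln ?posrE ?divr_gt0 //.
      rewrite ler_pdivrMr //.
      have -> : 0 - rho = (0 +i* (1 / 2) - rho) - (0 +i* (1 / 2)) by ring.
      apply: le_trans (le_normcB _ _) _.
      have : normc (0 +i* (1 / 2) : R[i]) <= 1 / 2.
        apply: le_trans (normc_le_Re_Im _) _; rewrite /= normr0 add0r ger0_norm //; lra.
      lra.
    rewrite [_ * ln _]mul1r; apply: le_trans (_ : ln (4 / q%:R) <= _).
      have pq : 0 < 4 / q%:R :> R by rewrite divr_gt0.
      have pr : 0 < normc (0 - rho) / normc (0 +i* (1 / 2) - rho) by rewrite divr_gt0.
      rewrite ler_ln ?posrE //. rewrite ler_pdivrMr //.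
      have : normc (0 - rho) < q%:R^-1 by rewrite sub0r normcNN; exact: nr.
      have : 4 / q%:R * (1 / 4) <= 4 / q%:R * normc (0 +i* (1 / 2) - rho).
        by rewrite ler_wpM2l // divr_ge0 // ltW.
      have -> : 4 / q%:R * (1 / 4) = q%:R^-1 :> R by field; rewrite gt_eqF.
      lra.
    by rewrite -[4 / q%:R]invf_div lnV ?posrE ?divr_gt0 //; lra.
  have := sum_rs _ _ per; rewrite !sumrB -mulr_suml -/near_count.
  have -> : \sum_(i <- rs) (3 : R) = (size rs)%:R * 3.
    by rewrite big_const_seq count_predT iter_addr_0 -[_ *+ size rs]mulr_natl.
  have : (size rs)%:R * 3 <= n%:R * 6 :> R.
    have : (size rs)%:R <= 2 * n%:R :> R by rewrite -natrM ler_nat.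
    by lra.
  by rewrite mulrDr; lra.
have lnq : 0 < ln (q%:R / 4) :> R by apply: ln_gt0; rewrite ltr_pdivlMr //; lra.
have np : (0 : R) < n%:R by rewrite ltr0n.
have z1 : `|0 : R| <= 1 by rewrite normr0.
have tot : n%:R * (K * curve_pot E0 r p s0 kap 0 - \sum_(j < N1.*2.+1)
      curve_pot E0 r p s0 kap (gridx R (pN p) (pN p - N1 + j))) <=
    K * (3 * near_count + 2 * n%:R * q%:R ^- 4).
  have -> : n%:R * (K * curve_pot E0 r p s0 kap 0 - \sum_(j < N1.*2.+1)
      curve_pot E0 r p s0 kap (gridx R (pN p) (pN p - N1 + j))) =
    \sum_(rho <- rs) (K * ln (normc rho) -
    \sum_(j < N1.*2.+1) ln (normc (((j%:R - N1%:R) * (y / N1%:R))%:C - rho))).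
    rewrite mulrBr mulrCA pE // mulr_sumr.
    rewrite (eq_bigr (fun j : 'I_(N1.*2.+1) => ln (normc (lead_coef (dp b n))) +
       \sum_(rho <- rs) ln (normc (((j%:R - N1%:R) * (y / N1%:R))%:C - rho)))); last first.
      by move=> j _; rewrite gE pE // g1 // -ltnS.
    rewrite big_split /= sumr_const card_ord -[_ *+ N1.*2.+1]mulr_natl -/K.
    rewrite exchange_big /= sumrB -mulr_sumr mulrDr.
    have -> : \sum_(rho <- rs) ln (normc (0%:C - rho)) = \sum_(rho <- rs) ln (normc rho).
      by apply: eq_bigr => rho _; rewrite sub0r normcNN.
    by ring.
  apply: le_trans (sum_rs _ _ root_le) _.
  rewrite -mulr_sumr ler_wpM2l ?(ltW K0) // big_split /= -mulr_sumr -/near_count lerD2l.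
  rewrite big_const_seq count_predT iter_addr_0 -[_ *+ size rs]mulr_natl.
  rewrite ler_wpM2r ?invr_ge0 ?exprn_ge0 ?(ltW qp) //.
  by rewrite -natrM ler_nat.
have tot2 : curve_pot E0 r p s0 kap 0 - K^-1 * \sum_(j < N1.*2.+1)
      curve_pot E0 r p s0 kap (gridx R (pN p) (pN p - N1 + j)) <=
    3 * (near_count / n%:R) + 2 / q%:R ^+ 4.
  have nK : 0 < n%:R * K by rewrite mulr_gt0.
  rewrite -(ler_pM2l nK).
  set S := \sum_(j < _) _ in tot *.
  have -> : n%:R * K * (curve_pot E0 r p s0 kap 0 - K^-1 * S) =
    n%:R * (K * curve_pot E0 r p s0 kap 0 - S) by field; rewrite gt_eqF.
  apply: (le_trans tot); rewrite le_eqVlt; apply/orP; left; apply/eqP.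
  by field; rewrite !gt_eqF.
have cnt : near_count / n%:R <=
    (6 + ln (curve_Q E0 C V s0 + 1) + ln (2 / eta) / n%:R) / ln (q%:R / 4).
  rewrite ler_pdivlMr // mulrAC ler_pdivrMr //.
  by rewrite mulrDl mulfVK ?gt_eqF //; move: count_le; lra.
move: tot2 cnt; rewrite -/K.
set S := K^-1 * _; set c := near_count / _; set L := _ / ln _.
have -> : 3 * (6 + ln (curve_Q E0 C V s0 + 1) + ln (2 / eta) / n%:R) / ln (q%:R / 4) = 3 * L.
  by rewrite /L mulrA.
by lra.
Qed.

End Center.

(** * Cocycles and the Lyapunov exponent *)

Section ComplexCocycle.
Variable R : realType.
Implicit Types (a b : nat -> R[i]) (A B : 'M[R[i]]_2) (n m : nat) (Q e d : R).

(** Entrywise norm, comparable with the Euclidean operator norm up to a factor 4 that disappears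
    after taking logarithms and dividing by n. *)
Definition n1 A : R := \sum_i \sum_j normc (A i j).

Lemma n1E A : n1 A = normc (A 0 0) + normc (A 0 1) + normc (A 1 0) + normc (A 1 1).
Proof.
rewrite /n1 !big_ord_recl !big_ord0 !addr0 !addrA.
by congr (_ + _ + _ + _); congr (normc (A _ _)); apply/val_inj.
Qed.

Lemma mulmx2E A B i j : (A *m B) i j = A i 0 * B 0 j + A i 1 * B 1 j.
Proof.
rewrite mxE !big_ord_recl big_ord0 addr0.
by congr (_ + A i _ * B _ j); apply/val_inj.
Qed.

Lemma n1_ge0 A : 0 <= n1 A.
Proof. by rewrite n1E !addr_ge0 ?normc_ge0. Qed.

Lemma n1M A B : n1 (A *m B) <= n1 A * n1 B.
Proof.
rewrite !n1E !mulmx2E.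
have h (x y z t : R[i]) : normc (x * y + z * t) <= normc x * normc y + normc z * normc t.
  by apply: le_trans (normcD _ _) _; rewrite !normcM.
have := h (A 0 0) (B 0 0) (A 0 1) (B 1 0); have := h (A 0 0) (B 0 1) (A 0 1) (B 1 1).
have := h (A 1 0) (B 0 0) (A 1 1) (B 1 0); have := h (A 1 0) (B 0 1) (A 1 1) (B 1 1).
have := normc_ge0 (A 0 0); have := normc_ge0 (A 0 1); have := normc_ge0 (A 1 0).
have := normc_ge0 (A 1 1); have := normc_ge0 (B 0 0); have := normc_ge0 (B 0 1).
have := normc_ge0 (B 1 0); have := normc_ge0 (B 1 1).
move: (normc (A 0 0)) (normc (A 0 1)) (normc (A 1 0)) (normc (A 1 1)) => a1 a2 a3 a4.
move: (normc (B 0 0)) (normc (B 0 1)) (normc (B 1 0)) (normc (B 1 1)) => b1 b2 b3 b4.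
move=> p1 p2 p3 p4 q1 q2 q3 q4 h1 h2 h3 h4.
have M (x y : R) : 0 <= x -> 0 <= y -> 0 <= x * y by exact: mulr_ge0.
have := M _ _ q4 p2; have := M _ _ q4 p1; have := M _ _ q3 p3; have := M _ _ q3 p4.
have := M _ _ q2 p2; have := M _ _ q2 p1; have := M _ _ q1 p3; have := M _ _ q1 p4.
have -> : (a1 + a2 + a3 + a4) * (b1 + b2 + b3 + b4) = a1 * b1 + a1 * b2 + a1 * b3 + a1 * b4 +
  (a2 * b1 + a2 * b2 + a2 * b3 + a2 * b4) + (a3 * b1 + a3 * b2 + a3 * b3 + a3 * b4) +
  (a4 * b1 + a4 * b2 + a4 * b3 + a4 * b4) by ring.
lra.
Qed.

Lemma n1D A B : n1 (A + B) <= n1 A + n1 B.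
Proof.
rewrite !n1E !mxE.
have := normcD (A 0 0) (B 0 0); have := normcD (A 0 1) (B 0 1).
have := normcD (A 1 0) (B 1 0); have := normcD (A 1 1) (B 1 1); lra.
Qed.

Definition smx (c : R[i]) : 'M[R[i]]_2 := \matrix_(i < 2, j < 2)
  if i == 0 then (if j == 0 then c else -1) else (if j == 0 then 1 else 0).

Fixpoint cocM a n : 'M[R[i]]_2 := if n is m.+1 then smx (a m) *m cocM a m else 1%:M.

Lemma cocM_add a n m : cocM a (n + m) = cocM (fun k => a (k + m)%N) n *m cocM a m.
Proof. by elim: n => [|n IH]; rewrite ?mul1mx // addSn /= IH mulmxA. Qed.

Lemma eq_cocM a b : a =1 b -> cocM a =1 cocM b.
Proof. by move=> /funext ->. Qed.

Lemma cocM_dp a n : [/\ cocM a n.+2 0 0 = dp a n.+2, cocM a n.+2 1 0 = dp a n.+1,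
  cocM a n.+2 0 1 = - dp (a \o succn) n.+1 & cocM a n.+2 1 1 = - dp (a \o succn) n].
Proof.
elim: n => [|n [h1 h2 h3 h4]].
  rewrite /= !mulmx2E !mxE /= dpSS !dp1 !dp0.
  by split; rewrite !(mulr0, mulr1, addr0, add0r, mulrN1, mulN1r, mul0r, subr0, mul1r, subrr).
have E : cocM a n.+3 = smx (a n.+2) *m cocM a n.+2 by [].
rewrite E; move: (cocM a n.+2) h1 h2 h3 h4 => B h1 h2 h3 h4.
rewrite !mulmx2E h1 h2 h3 h4 !mxE /=.
by rewrite [dp a n.+3]dpSS [dp (a \o succn) n.+2]dpSS /=; split; ring.
Qed.

Lemma n1_cocM a n : n1 (cocM a n.+2) = normc (dp a n.+2) + normc (dp a n.+1) +
  normc (dp (a \o succn) n.+1) + normc (dp (a \o succn) n).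
Proof. by rewrite n1E; have [-> -> -> ->] := cocM_dp a n; rewrite !normcNN; ring. Qed.

Lemma n1_scalar1 : n1 1%:M = 2.
Proof. by rewrite n1E !mxE !mulr1n !mulr0n !normc0 !normc1; ring. Qed.

Lemma n1_smx c : n1 (smx c) = normc c + 2.
Proof.
rewrite n1E !mxE; change (normc c + normc (-1) + normc 1 + normc 0 = normc c + 2).
by rewrite normcNN normc0 normc1; ring.
Qed.

(** The determinant is 1, so the entries cannot all be small. This makes the logarithms
    nonnegative. *)
Lemma n1_ge1 a n : 1 <= n1 (cocM a n).
Proof.
case: n => [|[|n]]; first by rewrite n1_scalar1 ler1n.
  by rewrite /= mulmx1 n1_smx; have := normc_ge0 (a 0%N); lra.
rewrite n1_cocM.
have := congr1 (@normc R) (dp_wronskian a n); rewrite normc1 => h.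
have {h} : 1 <= normc (dp a n.+1) * normc (dp (a \o succn) n.+1) +
   normc (dp a n.+2) * normc (dp (a \o succn) n).
  by rewrite -[leLHS]h -!normcM le_normcB.
have := normc_ge0 (dp a n.+1); have := normc_ge0 (dp (a \o succn) n.+1).
have := normc_ge0 (dp a n.+2); have := normc_ge0 (dp (a \o succn) n).
move: (normc _) (normc _) (normc _) (normc _) => x y z t; nra.
Qed.

Lemma n1_le a n Q : (forall k, normc (a k) <= Q) -> n1 (cocM a n) <= 2 * (Q + 2) ^+ n.
Proof.
move=> aQ; have Q0 : 0 <= Q by exact: le_trans (normc_ge0 _) (aQ 0%N).
elim: n => [|n IH]; first by rewrite n1_scalar1 expr0 mulr1.
rewrite /= exprS mulrCA; apply: le_trans (n1M _ _) _.
by rewrite ler_pM ?n1_ge0 // n1_smx lerD2r.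
Qed.

Lemma n1_lipschitz n Q : exists2 c, 0 <= c & forall a b d,
  (forall k, normc (a k) <= Q) -> (forall k, normc (b k) <= Q) ->
  (forall k, normc (a k - b k) <= d) -> n1 (cocM a n - cocM b n) <= c * d.
Proof.
elim: n => [|n [c c0 IH]].
  exists 0 => // a b d _ _ _; rewrite /= subrr mul0r n1E !mxE normc0; lra.
have [Q0|Q0] := leP 0 Q; last first.
  exists 0 => // a b d aQ; have := le_trans (normc_ge0 _) (aQ 0%N); lra.
exists ((Q + 2) * c + 2 * (Q + 2) ^+ n).
  by rewrite addr_ge0 // mulr_ge0 // ?exprn_ge0 // addr_ge0.
move=> a b d aQ bQ abd; have d0 : 0 <= d by exact: le_trans (normc_ge0 _) (abd 0%N).
rewrite /=; have -> : smx (a n) *m cocM a n - smx (b n) *m cocM b n =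
  smx (a n) *m (cocM a n - cocM b n) + (smx (a n) - smx (b n)) *m cocM b n.
  by rewrite mulmxBr mulmxBl addrA subrK.
apply: le_trans (n1D _ _) _; rewrite mulrDl; apply: lerD.
  apply: le_trans (n1M _ _) _; rewrite -mulrA ler_pM ?n1_ge0 //.
    by rewrite n1_smx lerD2r.
  exact: IH.
apply: le_trans (n1M _ _) _; rewrite mulrC ler_pM ?n1_ge0 ?n1_le //.
rewrite n1E !mxE.
change (normc (a n - b n) + normc (-1 - (-1)) + normc (1 - 1) + normc (0 - 0) <= d).
by rewrite !subrr normc0 !addr0; exact: abd.
Qed.

Lemma dp_le_n1 a n : normc (dp a n) <= n1 (cocM a n).
Proof.
case: n => [|[|n]]; first by rewrite dp0 normc1 n1_scalar1 ler1n.
  by rewrite /= mulmx1 n1_smx dp1; lra.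
rewrite n1_cocM; have := normc_ge0 (dp a n.+1); have := normc_ge0 (dp (a \o succn) n.+1).
have := normc_ge0 (dp (a \o succn) n); lra.
Qed.

(** At positive height the growth lemmas bound the other three entries by the corner entry; hence
    potentials and norms have the same exponential rate there. *)
Lemma n1_le_dp a n e : 0 < e <= 1 -> (forall k, e <= Im (a k)) ->
  n1 (cocM a n) <= 4 / e ^+ 2 * normc (dp a n).
Proof.
move=> /andP[e0 e1] ap; have e2 : 0 < e ^+ 2 by rewrite exprn_gt0.
have le2 : e ^+ 2 <= e by rewrite expr2 ler_piMl // ltW.
rewrite mulrAC ler_pdivlMr //.
case: n => [|[|n]].
- by rewrite n1_scalar1 dp0 normc1; lra.
- rewrite /= mulmx1 n1_smx dp1.
  have := le_trans (ap 0%N) (le_trans (ler_norm _) (normc_Im _)).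
  by move: (normc (a 0%N)) => x h; nra.
rewrite n1_cocM; set D := normc (dp a n.+2).
have h1 : e * normc (dp a n.+1) <= D by exact: dp_growth.
have h2 : e * normc (dp (a \o succn) n.+1) <= D by exact: dp_growth_shift.
have h3 : e * normc (dp (a \o succn) n) <= normc (dp (a \o succn) n.+1).
  by apply: dp_growth => // k; exact: ap.
have D0 : 0 <= D by exact: normc_ge0.
have n1 := normc_ge0 (dp a n.+1); have n2 := normc_ge0 (dp (a \o succn) n.+1).
have n3 := normc_ge0 (dp (a \o succn) n).
move: D D0 h1 h2 h3 n1 n2 n3 => D D0.
move: (normc (dp a n.+1)) (normc (dp (a \o succn) n.+1)) (normc (dp (a \o succn) n)) => u v w.
move=> h1 h2 h3 u0 v0 w0.
have k1 : e ^+ 2 * u <= D.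
  by rewrite expr2 -mulrA (le_trans (ler_wpM2l (ltW e0) h1)) // ler_piMl.
have k2 : e ^+ 2 * v <= D.
  by rewrite expr2 -mulrA (le_trans (ler_wpM2l (ltW e0) h2)) // ler_piMl.
have k3 : e ^+ 2 * w <= D.
  by rewrite expr2 -mulrA (le_trans (ler_wpM2l (ltW e0) h3)).
have k4 : e ^+ 2 * D <= D by rewrite ler_piMl //; lra.
lra.
Qed.

(* The zeros in z of dp (z - c_k) are real, c being real, so |dp| grows away
   from the real axis. *)
Lemma dp_real_mono (c : nat -> R) n (x eta : R) : 0 <= eta ->
  normc (dp (fun k => x%:C - (c k)%:C) n) <=
  normc (dp (fun k => (x +i* eta) - (c k)%:C) n).
Proof.
move=> eta0; pose b k : {poly R[i]} := 'X - ((c k)%:C)%:P.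
have bE t : (fun k => (b k).[t]) = (fun k => t - (c k)%:C).
  by apply/funext => k; rewrite /b hornerXsubC.
have [rs brs] := closed_roots (dp b n).
have ev t : dp (fun k => t - (c k)%:C) n =
    lead_coef (dp b n) * \prod_(r <- rs) (t - r).
  by rewrite -bE -dp_horner {1}brs prod_XsubC_neq0.
have real_root r : r \in rs -> Im r = 0.
  move=> rr; have := dp_root brs rr; rewrite bE => h.
  have up t : 0 < Im t -> dp (fun k => t - (c k)%:C) n != 0.
    move=> t0; have [] // := @dp_upper R (fun k => t - (c k)%:C) n _.
    by move=> k; rewrite !reim /= subr0.
  have [r0|r0|//] := ltgtP (Im r) 0.
    have := up (conjc r); rewrite cImJ oppr_gt0 => /(_ r0).
    have -> : (fun k => conjc r - (c k)%:C) =
        (@conjc R : {rmorphism R[i] -> R[i]}) \o (fun k => r - (c k)%:C).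
      by apply/funext => k; rewrite /comp rmorphB; congr (_ - _); rewrite -[RHS]/(conjc _) conjc_real.
    by rewrite -map_dp h rmorph0 eqxx.
  by have := up r r0; rewrite h eqxx.
rewrite !ev !normcM ler_wpM2l ?normc_ge0 //.
elim: rs real_root {brs ev} => [|r rs IH] H; first by rewrite !big_nil.
rewrite !big_cons !normcM ler_pM ?normc_ge0 //; last first.
  by apply: IH => r' rr'; apply: H; rewrite inE rr' orbT.
have r0 := H r (mem_head _ _).
rewrite -(@ler_pXn2r _ 2) ?nnegrE ?normc_ge0 // !normc_sqr !reim /= r0.
by rewrite !subr0 expr0n addr0 lerDl sqr_ge0.
Qed.

(** Every entry is a continuant with real zeros. It allows an upper bound at a real energy to be
    proved at a positive height. *)
Lemma n1_real_mono (c : nat -> R) n (x eta : R) : 0 <= eta ->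
  n1 (cocM (fun k => x%:C - (c k)%:C) n) <=
  n1 (cocM (fun k => (x +i* eta) - (c k)%:C) n).
Proof.
move=> eta0; case: n => [|[|n]] //.
  have := @dp_real_mono c 1 x eta eta0; rewrite !dp1 => h.
  by rewrite /= !mulmx1 !n1_smx lerD2r.
rewrite !n1_cocM; have h1 := dp_real_mono c n.+2 x eta0; have h2 := dp_real_mono c n.+1 x eta0.
have h3 := dp_real_mono (c \o succn) n.+1 x eta0; have h4 := dp_real_mono (c \o succn) n x eta0.
by apply: lerD => //; apply: lerD => //; apply: lerD.
Qed.

End ComplexCocycle.

Section OperatorNorm.
Variable R : realType.
Implicit Types (A B : 'M[R]_2) (u : 'cV[R]_2).

Lemma norm2E u : norm2 u = normc (u 0 0 +i* u 1 0).
Proof.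
rewrite /norm2 /= !big_ord_recl big_ord0 addr0; congr (Num.sqrt (_ ^+ 2 + u _ 0 ^+ 2)).
exact/val_inj.
Qed.

Lemma norm2D u v : norm2 (u + v) <= norm2 u + norm2 v.
Proof.
by rewrite !norm2E !mxE; exact: (normcD (u 0 0 +i* u 1 0) (v 0 0 +i* v 1 0)).
Qed.

Let toC A : 'M[R[i]]_2 := map_mx (real_complex R) A.

Lemma norm2_mulmx A u : norm2 u = 1 -> norm2 (A *m u) <= n1 (toC A).
Proof.
move=> u1; rewrite norm2E n1E; apply: le_trans (normc_le_Re_Im _) _.
have u0 : `|u 0 0| <= 1 by rewrite -u1 norm2E; exact: (normc_Re (u 0 0 +i* u 1 0)).
have u1' : `|u 1 0| <= 1 by rewrite -u1 norm2E; exact: (normc_Im (u 0 0 +i* u 1 0)).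
have E i : (A *m u) i 0 = A i 0 * u 0 0 + A i 1 * u 1 0.
  rewrite mxE !big_ord_recl big_ord0 addr0.
  by congr (_ + A i _ * u _ 0); apply/val_inj.
have h i : `|(A *m u) i 0| <= `|A i 0| + `|A i 1|.
  rewrite E; apply: le_trans (ler_normD _ _) _.
  by rewrite !normrM; apply: lerD; rewrite ler_piMr.
rewrite [toC A 0 0]mxE [toC A 0 1]mxE [toC A 1 0]mxE [toC A 1 1]mxE !normc_real.
by have := h 0; have := h 1 => /=; lra.
Qed.

Let S A := [set norm2 (A *m u) | u in [set u : 'cV[R]_2 | norm2 u = 1]].

Lemma has_sup_opnorm A : has_sup (S A).
Proof.
split; last first.
  by exists (n1 (toC A)) => _ [u /= u1 <-]; exact: norm2_mulmx.
exists (norm2 (A *m delta_mx 0 0)), (delta_mx 0 0) => //=.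
by rewrite norm2E !mxE /= expr1n expr0n addr0 sqrtr1.
Qed.

Lemma opnorm_ge A u : norm2 u = 1 -> norm2 (A *m u) <= opnorm A.
Proof. by move=> u1; apply: ub_le_sup; [case: (has_sup_opnorm A)|exists u]. Qed.

Lemma opnorm_le A c : (forall u, norm2 u = 1 -> norm2 (A *m u) <= c) -> opnorm A <= c.
Proof.
move=> h; apply: ge_sup; first by case: (has_sup_opnorm A).
by move=> _ [u /= u1 <-]; exact: h.
Qed.

Lemma opnorm_le_n1 A : opnorm A <= n1 (toC A).
Proof. by apply: opnorm_le => u; exact: norm2_mulmx. Qed.

Lemma n1_le_opnorm A : n1 (toC A) <= 4 * opnorm A.
Proof.
have h (j : 'I_2) : norm2 (delta_mx j 0 : 'cV[R]_2) = 1.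
  rewrite norm2E !mxE /=; case: j => -[|[|//]] ? /=;
  by rewrite ?expr1n ?expr0n ?addr0 ?add0r sqrtr1.
have col_ij i j : (A *m (delta_mx j 0 : 'cV[R]_2)) i 0 = A i j.
  by rewrite -colE mxE.
have ent i j : `|A i j| <= opnorm A.
  apply: le_trans (opnorm_ge A (h j)); rewrite norm2E !col_ij.
  have /orP[/eqP->|/eqP->] : (i == 0) || (i == 1) by case: i => -[|[|//]].
    exact: (normc_Re (A 0 j +i* A 1 j)).
  exact: (normc_Im (A 0 j +i* A 1 j)).
rewrite n1E [toC A 0 0]mxE [toC A 0 1]mxE [toC A 1 0]mxE [toC A 1 1]mxE !normc_real.
by have := ent 0 0; have := ent 0 1; have := ent 1 0; have := ent 1 1; lra.
Qed.

Lemma opnorm_lipschitz A B : opnorm A <= opnorm B + n1 (toC (A - B)).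
Proof.
apply: opnorm_le => u u1.
have -> : A *m u = B *m u + (A - B) *m u by rewrite mulmxBl addrC subrK.
by apply: le_trans (norm2D _ _) _; apply: lerD; [exact: opnorm_ge|exact: norm2_mulmx].
Qed.

End OperatorNorm.

(** * Integrals of continuous functions *)

Section Integral.
Variables (R : realType) (X : pmetricType R) (mu : probability (borelType X) R).
Hypothesis cX : compact [set: X].
Implicit Types (g h : X -> R).

Lemma continuous_measurable g : continuous g ->
  measurable_fun [set: borelType X] (g : borelType X -> R).
Proof.
move=> cg; apply: (measurability _ (measurable_realfun.RGenOpens.measurableE R)).
move=> _ [_ [a [b ->]] <-]; rewrite setTI.
apply: sub_sigma_algebra; apply: open_comp; last exact: interval_open.
by move=> x _; exact: cg.
Qed.

Lemma continuous_integrable g : continuous g ->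
  mu.-integrable [set: borelType X] (EFin \o g).
Proof.
move=> cg; apply: measurable_bounded_integrable => //.
- by rewrite [X in (X < _)%E]probability_setT ltry.
- exact: continuous_measurable.
- have : bounded_set (g @` [set: X]).
    apply: compact_bounded; apply: continuous_compact => //.
    exact: continuous_subspaceT.
  by move=> [M [Mr HM]]; exists M; split => // y My x _; apply: HM => //; exists x.
Qed.

Definition mean g : R := \int[mu]_x g x.

Lemma meanD g h : continuous g -> continuous h ->
  mean (fun x => g x + h x) = mean g + mean h.
Proof. by move=> cg ch; apply: RintegralD => //; exact: continuous_integrable. Qed.

Lemma meanZ c g : continuous g -> mean (fun x => c * g x) = c * mean g.
Proof. by move=> cg; apply: RintegralZl => //; exact: continuous_integrable. Qed.

Lemma mean_cst c : mean (fun=> c) = c.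
Proof.
by rewrite /mean Rintegral_cst // [X in fine X](probability_setT mu) mulr1.
Qed.

Lemma mean_le g h : continuous g -> continuous h -> (forall x, g x <= h x) ->
  mean g <= mean h.
Proof. by move=> cg ch gh; apply: le_Rintegral => //; exact: continuous_integrable. Qed.

Lemma continuous_sum I (l : seq I) (F : I -> X -> R) :
  (forall i, continuous (F i)) -> continuous (fun x => \sum_(i <- l) F i x).
Proof.
move=> cF; elim: l => [|i l IH].
  rewrite (_ : (fun _ => _) = cst 0); first exact: cst_continuous.
  by apply/funext => x; rewrite big_nil.
rewrite (_ : (fun _ => _) = (fun x => F i x + \sum_(j <- l) F j x)); last first.
  by apply/funext => x; rewrite big_cons.
by move=> x; apply: continuousD; [exact: cF|exact: IH].
Qed.

Lemma mean_sum I (l : seq I) (F : I -> X -> R) : (forall i, continuous (F i)) ->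
  mean (fun x => \sum_(i <- l) F i x) = \sum_(i <- l) mean (F i).
Proof.
move=> cF; elim: l => [|i l IH].
  rewrite big_nil -[RHS]mean_cst; congr mean.
  by apply/funext => x; rewrite big_nil.
rewrite big_cons -IH -meanD //; last exact: continuous_sum.
by congr mean; apply/funext => x; rewrite big_cons.
Qed.

Lemma mean_comp (f : X -> X) g : continuous f -> continuous g ->
  invariant_measure f mu -> mean (g \o f) = mean g.
Proof.
move=> cf cg inv.
have mf : measurable_fun [set: borelType X] (f : borelType X -> borelType X).
  apply: (@measurability _ _ (borelType X) (borelType X) setT f (@open X) erefl).
  move=> _ [B oB <-]; rewrite setTI; apply: sub_sigma_algebra.
  by apply: open_comp => // x _; exact: cf.
rewrite /mean /Rintegral; congr fine.
have intf : mu.-integrable (f @^-1` [set: borelType X]) ((EFin \o g) \o f).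
  have := @continuous_integrable (g \o f) _; apply => x.
  by apply: continuous_comp; [exact: cf|exact: cg].
have mg := measurable_int mu (continuous_integrable cg).
have h := integral_pushforward mf mg intf measurableT.
transitivity (\int[mu]_(x in f @^-1` [set: borelType X]) ((EFin \o g) \o f) x)%E => //.
rewrite -h; apply: eq_measure_integral => A mA _; exact: inv.
Qed.

End Integral.

(** * Subadditive sequences *)

Section Subadditive.
Variables (R : realType) (u : nat -> R).
Hypotheses (u0 : forall n, 0 <= u n) (uD : forall n m, u (n + m)%N <= u n + u m).

(** Euclidean division of n by n0. A single scale n0 controls all later ones, which is what
    semicontinuity needs. *)
Lemma subadditive_eventually n0 (eps : R) : (0 < n0)%N -> 0 < eps ->
  exists N, forall n, (N <= n)%N -> (0 < n)%N -> u n <= (u n0 / n0%:R + eps) * n%:R.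
Proof.
move=> n0p e0; have n0R : (0 : R) < n0%:R by rewrite ltr0n.
(* Bounds every remainder term and u 0; it occurs twice below, once for each. *)
pose M := \sum_(i < n0) u i.
have uq q : u (q * n0)%N <= q%:R * u n0 + M.
  elim: q => [|q IH].
    by rewrite mul0n mul0r add0r /M (bigD1 (Ordinal n0p)) //= lerDl sumr_ge0.
  by rewrite mulSn (le_trans (uD _ _)) // -natr1; lra.
have uM r : (r < n0)%N -> u r <= M.
  by move=> rn; rewrite /M (bigD1 (Ordinal rn)) //= lerDl sumr_ge0.
exists (Num.truncn (2 * M / eps)).+1 => n Nn np.
rewrite {1}(divn_eq n n0); set q := (n %/ n0)%N; set r := (n %% n0)%N.
have h1 : u (q * n0 + r)%N <= q%:R * u n0 + 2 * M.
  apply: le_trans (uD _ _) _; have := uq q; have := uM r (ltn_pmod _ n0p); lra.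
apply: (le_trans h1); rewrite [leRHS]mulrDl; apply: lerD.
  rewrite [leRHS]mulrAC ler_pdivlMr // mulrAC mulrC ler_wpM2l //.
  by rewrite -natrM ler_nat; exact: leq_trunc_div.
have : 2 * M / eps < n%:R.
  apply: lt_le_trans (truncnS_gt _) _; by rewrite ler_nat.
by rewrite ltr_pdivrMr // [_ * eps]mulrC => /ltW.
Qed.

Lemma subadditive_cvg : exists l : R, (fun n => n%:R^-1 * u n) @ \oo --> l.
Proof.
pose S := [set u n / n%:R | n in [set n | (0 < n)%N]].
have Slb : has_inf S.
  split; first by exists (u 1%N / 1%:R), 1%N.
  by exists 0 => _ [n _ <-]; rewrite divr_ge0.
exists (inf S); apply/cvgrPdist_le => eps e0.
have e2 : 0 < eps / 2 by rewrite divr_gt0.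
have [_ [n0 /= n0p <-] hn0] := inf_adherent e2 Slb.
have [N HN] := subadditive_eventually n0p e2.
exists (maxn N 1) => // n /=; rewrite geq_max => /andP[Nn np].
have nR : (0 : R) < n%:R by rewrite ltr0n.
have h1 : inf S <= n%:R^-1 * u n.
  by rewrite mulrC; apply: ge_inf; [case: Slb|exists n].
rewrite distrC ger0_norm ?subr_ge0 // lerBlDr.
have := HN n Nn np; rewrite mulrC -ler_pdivrMl // => h2; apply: (le_trans h2).
by move: hn0 => /ltW; lra.
Qed.

End Subadditive.

Section Dynamics.
Variables (R : realType) (X : pmetricType R) (f : X -> X).
Variable mu : probability (borelType X) R.
Hypotheses (cX : compact [set: X]) (cf : continuous f) (inv : invariant_measure f mu).
Implicit Types (v w g : X -> R) (h : X -> R[i]) (x : X) (n m k : nat).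

Local Notation mean := (mean mu).

Lemma continuous_iter n : continuous (iter n f).
Proof.
elim: n => [|n IH] x /=; first exact: cvg_id.
by apply: (@continuous_comp _ _ _ (iter n f) f x); [exact: IH|exact: cf].
Qed.

Lemma mean_iter n g : continuous g -> mean (g \o iter n f) = mean g.
Proof.
move=> cg; elim: n => [|n IH] //; rewrite -[RHS]IH.
have cgn : continuous (g \o iter n f).
  by move=> x; apply: continuous_comp; [exact: continuous_iter|exact: cg].
rewrite -(mean_comp cX cf cgn inv); congr (mean _).
by apply/funext => x; rewrite /= -iterSr.
Qed.

Definition ccont h := continuous (fun x => Re (h x)) /\ continuous (fun x => Im (h x)).

Lemma ccont_cst (c : R[i]) : ccont (fun=> c).
Proof. by split; exact: cst_continuous. Qed.

Lemma ccont_real g : continuous g -> ccont (fun x => (g x)%:C).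
Proof. by move=> cg; split => //=; exact: cst_continuous. Qed.

Lemma ccontD h h' : ccont h -> ccont h' -> ccont (fun x => h x + h' x).
Proof.
move=> [h1 h2] [h1' h2']; split => x.
  rewrite (_ : (fun _ => _) = (fun x => Re (h x) + Re (h' x))).
    by apply: continuousD; [exact: h1|exact: h1'].
  by apply/funext => y; rewrite cReD.
rewrite (_ : (fun _ => _) = (fun x => Im (h x) + Im (h' x))).
  by apply: continuousD; [exact: h2|exact: h2'].
by apply/funext => y; rewrite cImD.
Qed.

Lemma ccontM h h' : ccont h -> ccont h' -> ccont (fun x => h x * h' x).
Proof.
move=> [h1 h2] [h1' h2']; split => x.
  rewrite (_ : (fun _ => _) = (fun x => Re (h x) * Re (h' x) - Im (h x) * Im (h' x))).
    by apply: cvgB; apply: cvgM; first [exact: h1|exact: h1'|exact: h2|exact: h2'].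
  by apply/funext => y; rewrite cReM.
rewrite (_ : (fun _ => _) = (fun x => Re (h x) * Im (h' x) + Im (h x) * Re (h' x))).
  by apply: cvgD; apply: cvgM; first [exact: h1|exact: h1'|exact: h2|exact: h2'].
by apply/funext => y; rewrite cImM.
Qed.

Lemma ccontN h : ccont h -> ccont (fun x => - h x).
Proof.
move=> hc; rewrite (_ : (fun _ => _) = (fun x => (-1) * h x)).
  exact: ccontM (ccont_cst _) hc.
by apply/funext => x; rewrite mulN1r.
Qed.

Lemma continuous_normc h : ccont h -> continuous (fun x => normc (h x)).
Proof.
move=> [h1 h2] x.
rewrite (_ : (fun _ => _) = Num.sqrt \o (fun x => Re (h x) * Re (h x) + Im (h x) * Im (h x))).
  apply: continuous_comp; last exact: sqrt_continuous.
  by apply: cvgD; apply: cvgM; first [exact: h1|exact: h2].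
by apply/funext => y /=; case: (h y) => a b /=; rewrite !expr2.
Qed.

Lemma continuous_ln_comp g : continuous g -> (forall x, 0 < g x) ->
  continuous (fun x => ln (g x)).
Proof.
move=> cg g0 x; have := @continuous_comp _ _ _ g (@ln R) x.
by apply; [exact: cg|exact: continuous_ln].
Qed.

Definition orb v x k : R := v (iter k f x).

Lemma continuous_orb v k : continuous v -> continuous (fun x => orb v x k).
Proof.
by move=> cv x; apply: (@continuous_comp _ _ _ (iter k f) v);
  [exact: continuous_iter|exact: cv].
Qed.

Section Family.
Variables v w : X -> R.
Hypotheses (cv : continuous v) (cw : continuous w).
Implicit Types (z s : R[i]).

Definition en z s x : nat -> R[i] := energy (orb v x) (orb w x) z s.

Lemma ccont_en z s k : ccont (fun x => en z s x k).
Proof.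
apply: ccontD; last apply: ccontN; last apply: ccontM; last exact/ccont_real/continuous_orb.
  apply: ccontD; first exact: ccont_cst.
  by apply/ccontN/ccont_real/continuous_orb.
exact: ccont_cst.
Qed.

Lemma ccont_dp z s n : ccont (fun x => dp (en z s x) n).
Proof.
elim/dp_ind: n => [||n h1 h2].
- exact: ccont_cst.
- rewrite (_ : (fun _ => _) = (fun x => en z s x 0%N)); first exact: ccont_en.
  by apply/funext => x; rewrite dp1.
- apply: ccontD; first by apply: ccontM; [exact: ccont_en|exact: h2].
  exact: ccontN.
Qed.

Lemma ccont_cocM z s n i j : ccont (fun x => cocM (en z s x) n i j).
Proof.
elim: n i j => [|n IH] i j /=; first exact: ccont_cst.
rewrite (_ : (fun _ => _) = (fun x => smx (en z s x n) i 0 * cocM (en z s x) n 0 j +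
   smx (en z s x n) i 1 * cocM (en z s x) n 1 j)); last first.
  by apply/funext => x; rewrite mulmx2E.
have cs i' j' : ccont (fun x => smx (en z s x n) i' j').
  rewrite (_ : (fun _ => _) = (fun x => if i' == 0 then (if j' == 0 then en z s x n else -1)
     else (if j' == 0 then 1 else 0))); last by apply/funext => x; rewrite mxE.
  by case: (i' == 0); case: (j' == 0); first [exact: ccont_en|exact: ccont_cst].
by apply: ccontD; apply: ccontM; first [exact: cs|exact: IH].
Qed.

Lemma continuous_n1 z s n : continuous (fun x => n1 (cocM (en z s x) n)).
Proof.
rewrite (_ : (fun _ => _) = (fun x => normc (cocM (en z s x) n 0 0) +
  normc (cocM (en z s x) n 0 1) + normc (cocM (en z s x) n 1 0) +
  normc (cocM (en z s x) n 1 1))); last by apply/funext => x; rewrite n1E.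
have cn i j : continuous (fun x => normc (cocM (en z s x) n i j)).
  by apply: continuous_normc; exact: ccont_cocM.
by move=> x; repeat apply: cvgD; exact: cn.
Qed.

Definition lnn1 z s n x : R := ln (n1 (cocM (en z s x) n)).

Lemma continuous_lnn1 z s n : continuous (lnn1 z s n).
Proof.
apply: continuous_ln_comp; first exact: continuous_n1.
by move=> x; apply: lt_le_trans (n1_ge1 _ _).
Qed.

Definition growth z s n : R := mean (lnn1 z s n).

Lemma growth_ge0 z s n : 0 <= growth z s n.
Proof.
rewrite -[leLHS](mean_cst mu 0); apply: mean_le => //.
- exact: cst_continuous.
- exact: continuous_lnn1.
- by move=> x; exact: ln_ge0 (n1_ge1 _ _).
Qed.

Lemma en_iter z s x m k : en z s x (k + m)%N = en z s (iter m f x) k.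
Proof. by rewrite /en /energy /orb iterD. Qed.

(** Submultiplicativity of [n1] and the cocycle identity; the invariance of mu removes the shift by
    m. *)
Lemma growthD z s n m : growth z s (n + m)%N <= growth z s n + growth z s m.
Proof.
have cn : continuous (lnn1 z s n \o iter m f).
  move=> x; apply: continuous_comp; first exact: continuous_iter.
  exact: continuous_lnn1.
rewrite -[X in X + _](mean_iter m (@continuous_lnn1 z s n)).
rewrite -meanD //; last exact: continuous_lnn1.
apply: mean_le => //.
- exact: continuous_lnn1.
- by move=> x; apply: cvgD; [exact: cn|exact: continuous_lnn1].
move=> x /=; rewrite /lnn1 cocM_add.
have -> : cocM (fun k => en z s x (k + m)%N) n = cocM (en z s (iter m f x)) n.
  by apply: eq_cocM => k; rewrite en_iter.
have p1 := lt_le_trans ltr01 (n1_ge1 (en z s (iter m f x)) n).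
have p2 := lt_le_trans ltr01 (n1_ge1 (en z s x) m).
rewrite -lnM ?posrE //.
have le := n1M (cocM (en z s (iter m f x)) n) (cocM (en z s x) m).
rewrite ler_ln ?posrE ?mulr_gt0 //.
have := n1_ge1 (en z s x) (n + m); rewrite cocM_add.
have -> : cocM (fun k => en z s x (k + m)%N) n = cocM (en z s (iter m f x)) n.
  by apply: eq_cocM => k; rewrite en_iter.
exact: lt_le_trans.
Qed.

Lemma growth_real_mono (x s eta : R) n : 0 <= eta ->
  growth x%:C s%:C n <= growth (x +i* eta) s%:C n.
Proof.
move=> eta0; apply: mean_le => //; try exact: continuous_lnn1.
move=> y; rewrite /lnn1.
have E z : en z s%:C y = (fun k => z - (orb v y k + s * orb w y k)%:C).
  by apply/funext => k; rewrite /en /energy rmorphD rmorphM /= opprD addrA.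
have p t := lt_le_trans ltr01 (n1_ge1 (en t s%:C y) n).
by rewrite ler_ln ?posrE // !E; exact: n1_real_mono.
Qed.

End Family.
End Dynamics.

Section LyapunovLimit.
Variables (R : realType) (X : pmetricType R) (f : X -> X).
Variable mu : probability (borelType X) R.
Hypotheses (cX : compact [set: X]) (cf : continuous f) (inv : invariant_measure f mu).
Variables v w : X -> R.
Hypotheses (cv : continuous v) (cw : continuous w).
Implicit Types (z : R[i]) (s e : R) (x : X) (n m k : nat).

Local Notation mean := (mean mu).
Local Notation en := (en f v w).
Local Notation growth := (growth f mu v w).
Local Notation lnn1 := (lnn1 f v w).

Definition xpot z s n x : R := pot (orb f v x) (orb f w x) n z s%:C.

Lemma Im_en z s x k : Im (en z s%:C x k) = Im z.
Proof. by rewrite /en Im_energy /= mul0r subr0. Qed.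

Section UpperEnergy.
Variables (z : R[i]) (s e : R).
Hypotheses (e01 : 0 < e <= 1) (ze : e <= Im z).

Let ene x k : e <= Im (en z s%:C x k). Proof. by rewrite Im_en. Qed.
Let e0 : 0 < e. Proof. by case/andP: e01. Qed.
Let e1 : e <= 1. Proof. by case/andP: e01. Qed.
Let dp_pos n x : 0 < normc (dp (en z s%:C x) n).
Proof. by apply: lt_le_trans (dp_ge n e01 (ene x)); rewrite divr_gt0. Qed.

Lemma continuous_xpot n : continuous (xpot z s n).
Proof.
move=> x; apply: cvgM; first exact: cvg_cst.
apply: (@continuous_ln_comp R X (fun x => normc (dp (en z s%:C x) n))) => //.
by apply: continuous_normc; exact: ccont_dp.
Qed.

Lemma xpot_ge n x : - (ln (2 / e) / n%:R) <= xpot z s n x.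
Proof.
rewrite -mulNr mulrC; apply: ler_wpM2l; first by rewrite invr_ge0.
rewrite -lnV ?posrE ?divr_gt0 // invf_div ler_ln ?posrE ?divr_gt0 //; first exact: (dp_ge n e01 (ene x)).
exact: dp_pos.
Qed.

Lemma mean_xpot_ge n : - (ln (2 / e) / n%:R) <= mean (xpot z s n).
Proof.
rewrite -[leLHS](mean_cst mu); apply: mean_le => //.
- exact: cst_continuous.
- exact: continuous_xpot.
- by move=> x; exact: xpot_ge.
Qed.

Lemma mean_xpot_le n : mean (xpot z s n) <= n%:R^-1 * growth z s%:C n.
Proof.
have cl : continuous (lnn1 z s%:C n) by exact: continuous_lnn1.
rewrite /growth -(meanZ _ cX _ cl); apply: mean_le => //.
- exact: continuous_xpot.
- by move=> x; apply: cvgM; [exact: cvg_cst|exact: cl].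
move=> x; apply: ler_wpM2l; first by rewrite invr_ge0.
rewrite ler_ln ?posrE; first exact: dp_le_n1.
  exact: dp_pos.
exact: lt_le_trans (n1_ge1 _ _).
Qed.

(** Together with [mean_xpot_le] it shows that, at fixed height, potentials and norms differ by
    O(1/n) on average. *)
Lemma growth_le_mean_xpot n : n%:R^-1 * growth z s%:C n <=
  mean (xpot z s n) + ln (4 / e ^+ 2) / n%:R.
Proof.
have cl : continuous (lnn1 z s%:C n) by exact: continuous_lnn1.
rewrite /growth -(meanZ _ cX _ cl) -[X in _ + X](mean_cst mu) -meanD //; last 2 first.
- exact: continuous_xpot.
- exact: cst_continuous.
apply: mean_le => //.
- by move=> x; apply: cvgM; [exact: cvg_cst|exact: cl].
- by move=> x; apply: cvgD; [exact: continuous_xpot|exact: cvg_cst].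
move=> x; rewrite [ln _ / _]mulrC -mulrDr; apply: ler_wpM2l; first by rewrite invr_ge0.
have p4 : 0 < 4 / e ^+ 2 by rewrite divr_gt0 // exprn_gt0.
have pd := dp_pos n x; have pn := lt_le_trans ltr01 (n1_ge1 (en z s%:C x) n).
have pq := mulr_gt0 p4 pd.
rewrite addrC -lnM ?posrE // ler_ln ?posrE //.
exact: n1_le_dp e01 (ene x).
Qed.

End UpperEnergy.

Lemma growth_eventually z s n0 (eps : R) : (0 < n0)%N -> 0 < eps ->
  exists N, forall n, (N <= n)%N -> (0 < n)%N ->
    growth z s%:C n <= (growth z s%:C n0 / n0%:R + eps) * n%:R.
Proof.
apply: subadditive_eventually => [n|n m]; first exact: growth_ge0.
exact: growthD.
Qed.

(* The infimum over n0 of continuous functions of z is upper semicontinuous. *)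
Lemma growth_usc (x0 s : R) n0 (a eps : R) : (0 < n0)%N -> 0 < eps ->
  growth x0%:C s%:C n0 <= a * n0%:R ->
  exists2 rho, 0 < rho & forall z, normc (z - x0%:C) < rho ->
    exists N, forall n, (N <= n)%N -> (0 < n)%N -> growth z s%:C n <= (a + eps) * n%:R.
Proof.
move=> n0p eps0 ga; have n0R : (0 : R) < n0%:R by rewrite ltr0n.
have [V0 bv] : exists V0, forall x, `|v x| <= V0.
  have : bounded_set (v @` [set: X]).
    by apply: compact_bounded; apply: continuous_compact => //; exact: continuous_subspaceT.
  move=> [M [Mr HM]]; exists (M + 1) => x; apply: HM; [by rewrite ltrDl|by exists x].
have [W0 bw] : exists W0, forall x, `|w x| <= W0.
  have : bounded_set (w @` [set: X]).
    by apply: compact_bounded; apply: continuous_compact => //; exact: continuous_subspaceT.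
  move=> [M [Mr HM]]; exists (M + 1) => x; apply: HM; [by rewrite ltrDl|by exists x].
pose Q := `|x0| + 1 + V0 + `|s| * W0.
have enQ z x k : normc z <= `|x0| + 1 -> normc (en z s%:C x k) <= Q.
  move=> zQ; rewrite /en /energy.
  apply: le_trans (le_normcB _ _) _; rewrite normcM !normc_real; apply: lerD.
    by apply: le_trans (le_normcB _ _) _; rewrite normc_real; apply: lerD => //; exact: bv.
  by rewrite ler_wpM2l //; exact: bw.
have [c c0 Lc] := n1_lipschitz n0 Q.
have c1 : 0 < c + 1 by rewrite ltr_wpDl.
exists (Num.min 1 (eps / 2 * n0%:R / (c + 1))).
  by rewrite lt_min ltr01 divr_gt0 // mulr_gt0 // divr_gt0.
move=> z; rewrite lt_min => /andP[z1 z2].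
have zQ : normc z <= `|x0| + 1.
  rewrite -[z](subrK x0%:C); apply: le_trans (normcD _ _) _.
  by rewrite normc_real addrC lerD2l ltW.
have gz : growth z s%:C n0 <= growth x0%:C s%:C n0 + c * normc (z - x0%:C).
  rewrite -[X in _ + X](mean_cst mu) -meanD //; last 2 first.
  - exact: continuous_lnn1.
  - exact: cst_continuous.
  apply: mean_le => //.
  - exact: continuous_lnn1.
  - by move=> x; apply: cvgD; [exact: continuous_lnn1|exact: cvg_cst].
  move=> x; rewrite /lnn1; set A := cocM _ _; set B := cocM _ _.
  have A1 : 1 <= n1 A by exact: n1_ge1.
  have B1 : 1 <= n1 B by exact: n1_ge1.
  have AB : n1 A <= n1 B + c * normc (z - x0%:C).
    rewrite -[A](subrK B); apply: le_trans (n1D _ _) _; rewrite addrC lerD2l.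
    apply: Lc => k; first exact: enQ.
      by apply: enQ; rewrite normc_real lerDl.
    rewrite /en /energy (_ : _ - _ - _ - _ = z - x0%:C) //; ring.
  have d0 : 0 <= c * normc (z - x0%:C) by rewrite mulr_ge0 ?normc_ge0.
  have A0 := lt_le_trans ltr01 A1; have B0 := lt_le_trans ltr01 B1.
  apply: (@le_trans _ _ (ln (n1 B * (1 + c * normc (z - x0%:C))))).
    rewrite ler_ln ?posrE ?mulr_gt0 //; last by rewrite ltr_wpDr.
    apply: (le_trans AB); rewrite mulrDr mulr1 lerD2l ler_peMl //.
  rewrite lnM ?posrE //; last by rewrite ltr_wpDr.
  by rewrite lerD2l; apply: le_ln1Dx; rewrite (lt_le_trans (ltrN10 _)).
have e2 : 0 < eps / 2 by rewrite divr_gt0.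
have [N HN] := growth_eventually z s n0p e2.
exists N => n Nn np; apply: le_trans (HN n Nn np) _; rewrite ler_wpM2r //.
have : growth z s%:C n0 / n0%:R <= a + eps / 2.
  rewrite ler_pdivrMr // mulrDl; apply: (le_trans gz); apply: lerD => //.
  apply: (@le_trans _ _ ((c + 1) * normc (z - x0%:C))).
    by rewrite ler_wpM2r ?normc_ge0 // lerDl.
  by rewrite mulrC -ler_pdivlMr // ltW.
lra.
Qed.

Lemma continuous_opnorm (A : X -> 'M[R]_2) : (forall i j, continuous (fun x => A x i j)) ->
  continuous (fun x => opnorm (A x)).
Proof.
move=> cA x; pose d y := n1 (map_mx (real_complex R) (A y - A x)).
have dE y : d y = `|A y 0 0 - A x 0 0| + `|A y 0 1 - A x 0 1| +
    `|A y 1 0 - A x 1 0| + `|A y 1 1 - A x 1 1|.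
  by rewrite /d n1E !mxE !normc_real.
have cd : d @ x --> (0 : R).
  have -> : (0 : R) = d x by rewrite dE !subrr normr0 !addr0.
  rewrite (_ : d = fun y => `|A y 0 0 - A x 0 0| + `|A y 0 1 - A x 0 1| +
    `|A y 1 0 - A x 1 0| + `|A y 1 1 - A x 1 1|); last by apply/funext.
  by repeat apply: cvgD; apply: cvg_norm; apply: cvgB; first [exact: cA|exact: cvg_cst].
apply/cvgrPdist_le => eps e0; near=> y.
have dy : d y <= eps.
  near: y; move/cvgrPdist_le : cd => /(_ _ e0); apply: filterS => y.
  by rewrite sub0r normrN; exact: le_trans (ler_norm _).
have h1 := opnorm_lipschitz (A y) (A x); have h2 := opnorm_lipschitz (A x) (A y).
have e : n1 (map_mx (real_complex R) (A x - A y)) = d y.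
  by rewrite dE n1E !mxE !normc_real ![`|A x _ _ - _|]distrC.
by rewrite e in h2; rewrite ler_norml; move: h1 h2; rewrite -/(d y); lra.
Unshelve. all: by end_near. Qed.

Lemma map_cocycle (u : X -> R) n x :
  map_mx (real_complex R) (cocycle f (schrodinger u) n x) =
  cocM (fun k => (u (iter k f x))%:C) n.
Proof.
elim: n => [|n IH] /=; first by rewrite map_mx1.
rewrite map_mxM IH; congr (_ *m _); apply/matrixP => i j; rewrite !mxE.
by case: (i == 0); case: (j == 0) => //=; rewrite ?rmorphN ?rmorph1 ?rmorph0.
Qed.

(** The operator norm lies between [n1 / 4] and [n1], so the means of the logarithms differ by at
    most ln 4. The subadditive limit of [growth] is thus also that of the defining sequence, and
    [limn] is a genuine limit. *)
Lemma lyapunov_cvg (u : X -> R) (E s : R) : (forall x, u x = E - v x - s * w x) ->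
  (fun n => n%:R^-1 * growth E%:C s%:C n) @ \oo --> lyapunov_schrodinger f mu u.
Proof.
move=> uE.
have uen x : (fun k => (u (iter k f x))%:C) = en E%:C s%:C x.
  by apply/funext => k; rewrite uE /en /energy /orb !rmorphB rmorphM.
have [l hl] := subadditive_cvg (fun n => growth_ge0 mu cX cf cv cw E%:C s%:C n)
  (fun n m => growthD cX cf inv cv cw E%:C s%:C n m).
suff -> : lyapunov_schrodinger f mu u = l by [].
pose op n x := opnorm (cocycle f (schrodinger u) n x).
have n1op n x : n1 (cocM (en E%:C s%:C x) n) <= 4 * op n x /\
    op n x <= n1 (cocM (en E%:C s%:C x) n).
  by rewrite -uen -map_cocycle; split; [exact: n1_le_opnorm|exact: opnorm_le_n1].
have op0 n x : 0 < op n x.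
  have [h _] := n1op n x; have := n1_ge1 (en E%:C s%:C x) n; lra.
have c_op n : continuous (fun x => ln (op n x)).
  apply: continuous_ln_comp => //; apply: continuous_opnorm => i j.
  rewrite (_ : (fun _ => _) = (fun x => Re (cocM (en E%:C s%:C x) n i j))).
    by case: (ccont_cocM cf cv cw E%:C s%:C n i j).
  by apply/funext => x; rewrite -uen -map_cocycle mxE.
have cl n : continuous (lnn1 E%:C s%:C n) by exact: continuous_lnn1.
have up n : mean (fun x => ln (op n x)) <= growth E%:C s%:C n.
  apply: mean_le => // x; have [_ h] := n1op n x.
  by rewrite ler_ln ?posrE // (lt_le_trans (op0 n x) h).
have lo n : growth E%:C s%:C n - ln 4 <= mean (fun x => ln (op n x)).
  rewrite lerBlDr -[X in _ + X](mean_cst mu) -meanD //; last exact: cst_continuous.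
  apply: mean_le => //.
    by move=> x; apply: cvgD; [exact: c_op|exact: cvg_cst].
  move=> x; have [h _] := n1op n x.
  rewrite addrC -lnM ?posrE // ler_ln ?posrE ?mulr_gt0 //.
  exact: lt_le_trans (n1_ge1 _ _).
apply/cvg_lim => //; apply/cvgrPdist_le => eps e0.
have e2 : 0 < eps / 2 by rewrite divr_gt0.
have ln40 : 0 <= ln 4 :> R by apply: ln_ge0; rewrite ler1n.
move/cvgrPdist_le : hl => /(_ _ e2)[N _ HN].
exists (maxn N (Num.truncn (2 * ln 4 / eps)).+1) => // n /=; rewrite geq_max => /andP[Nn Mn].
have nR : (0 : R) < n%:R by rewrite ltr0n (leq_trans _ Mn).
have small : n%:R^-1 * ln 4 <= eps / 2.
  rewrite ler_pdivrMl //.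
  have : 2 * ln 4 / eps < n%:R by apply: lt_le_trans (truncnS_gt _) _; rewrite ler_nat.
  by rewrite ltr_pdivrMr //; lra.
have h := HN n Nn.
have i0 : 0 <= n%:R^-1 :> R by rewrite invr_ge0.
have h1 := ler_wpM2l i0 (up n); have h2 := ler_wpM2l i0 (lo n).
rewrite mulrBr in h2; rewrite -/(mean _).
move: h; rewrite !ler_norml => /andP[h3 h4].
by apply/andP; split; lra.
Qed.

Lemma lyapunov_le0_growth (u : X -> R) (E s : R) : (forall x, u x = E - v x - s * w x) ->
  lyapunov_schrodinger f mu u <= 0 -> forall eps : R, 0 < eps ->
  exists2 n, (0 < n)%N & growth E%:C s%:C n <= eps * n%:R.
Proof.
move=> uE L0 eps e0; have := lyapunov_cvg uE => /cvgrPdist_le/(_ _ e0)[N _ HN].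
exists N.+1 => //; have := HN N.+1 (leqnSn _); rewrite /= ler_norml => /andP[h _].
rewrite mulrC -ler_pdivrMl ?ltr0n //.
by set a := _ * _ in h *; set L := lyapunov_schrodinger f mu u in L0 h; lra.
Qed.

Lemma growth_lyapunov_le0 (u : X -> R) (E s : R) : (forall x, u x = E - v x - s * w x) ->
  (forall eps : R, 0 < eps -> exists N, forall n, (N <= n)%N -> (0 < n)%N ->
     n%:R^-1 * growth E%:C s%:C n <= eps) ->
  lyapunov_schrodinger f mu u <= 0.
Proof.
move=> uE H; apply/ler_addgt0Pr => eps e0; rewrite add0r.
have e2 : 0 < eps / 2 by rewrite divr_gt0.
have := lyapunov_cvg uE => /cvgrPdist_le/(_ _ e2)[N _ HN].
have [M HM] := H _ e2.
have := HN (maxn N M.+1) (leq_maxl _ _); rewrite /= ler_norml => /andP[_ h].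
have := HM (maxn N M.+1); rewrite (leq_trans _ (leq_maxr N M.+1)) // => /(_ isT).
by rewrite (leq_trans _ (leq_maxr N M.+1)) // => /(_ isT); lra.
Qed.

End LyapunovLimit.

(** * Propagation of zero exponents *)

Section Eventually.
Variable R : realType.

Lemma eventually_div (A d : R) : 0 < d ->
  exists N, forall n, (N <= n)%N -> (0 < n)%N -> A / n%:R <= d.
Proof.
move=> d0; exists (Num.truncn (A / d)).+1 => n Nn np.
have nR : (0 : R) < n%:R by rewrite ltr0n.
rewrite ler_pdivrMr // mulrC -ler_pdivrMr //; apply: ltW.
by apply: lt_le_trans (truncnS_gt _) _; rewrite ler_nat.
Qed.

Lemma eventually_finite (P : nat -> nat -> Prop) M :
  (forall i, (i < M)%N -> exists N, forall n, (N <= n)%N -> P i n) ->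
  exists N, forall n, (N <= n)%N -> forall i, (i < M)%N -> P i n.
Proof.
elim: M => [|M IH] H; first by exists 0%N.
have [N1 h1] := IH (fun i iM => H i (ltnW iM)).
have [N2 h2] := H M (leqnn _).
exists (maxn N1 N2) => n; rewrite geq_max => /andP[n1 n2] i.
by rewrite ltnS leq_eqVlt => /orP[/eqP->|iM]; [exact: h2|exact: h1].
Qed.

(** The window lies in |x| <= 1/2, where the weight is at least (3/4)^m. Adding L makes all terms
    nonnegative, so the sum may be extended to the whole grid. *)
Lemma window_sum_le (F : nat -> R) (L : R) N N1 m : (0 < N1)%N -> (2 * N1 <= N)%N ->
  0 <= L -> (forall i, - L <= F i) ->
  \sum_(j < N1.*2.+1) F (N - N1 + j)%N <=
  (4 / 3) ^+ m * \sum_(i < N.*2) (F i + L) * (1 - gridx R N i ^+ 2) ^+ m.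
Proof.
move=> N10 NN L0 FL.
have Np : (0 : R) < N%:R by rewrite ltr0n; lia.
pose G i := (F i + L) * (4 / 3 * (1 - gridx R N i ^+ 2)) ^+ m.
have x1 i : (i <= N.*2)%N -> 0 <= 1 - gridx R N i ^+ 2.
  move=> iN; rewrite subr_ge0 -real_normK ?num_real // expr_le1 //.
  by have := @gridpt_Re R N (leq_trans N10 _) i 0 iN; apply; lia.
have G0 i : (i <= N.*2)%N -> 0 <= G i.
  move=> iN; apply: mulr_ge0; first by have := FL i; lra.
  by rewrite exprn_ge0 // mulr_ge0 ?x1 // divr_ge0.
have FG j : (j < N1.*2.+1)%N -> F (N - N1 + j)%N <= G (N - N1 + j)%N.
  move=> jN; set i := (N - N1 + j)%N.
  have F0 : 0 <= F i + L by have := FL i; lra.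
  apply: (@le_trans _ _ (F i + L)); first by lra.
  rewrite /G ler_peMr // exprn_ege1 //.
  have xi : `|gridx R N i| <= 1 / 2.
    have -> : gridx R N i = (j%:R - N1%:R) / N%:R.
      by rewrite /gridx /i natrD natrB; [field; rewrite gt_eqF|lia].
    rewrite normrM normfV [`|N%:R|]ger0_norm // ler_pdivrMr //.
    have h1 : j%:R <= N1%:R + N1%:R :> R by rewrite -natrD ler_nat addnn.
    have h2 : N1%:R + N1%:R <= N%:R :> R by rewrite -natrD ler_nat; lia.
    have : 0 <= j%:R :> R by [].
    by rewrite ler_norml; lra.
  have : gridx R N i ^+ 2 <= (1 / 2) ^+ 2.
    by rewrite -[leLHS]real_normK ?num_real // lerXn2r ?nnegrE.
  by rewrite [(1 / 2) ^+ 2]expr2; lra.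
apply: (@le_trans _ _ (\sum_(j < N1.*2.+1) G (N - N1 + j)%N)).
  by apply: ler_sum => j _; exact: FG.
have -> : (4 / 3) ^+ m * \sum_(i < N.*2) (F i + L) * (1 - gridx R N i ^+ 2) ^+ m =
    \sum_(i < N.*2) G i.
  by rewrite mulr_sumr; apply: eq_bigr => i _; rewrite /G [(4 / 3 * _) ^+ m]exprMn; ring.
have -> : \sum_(j < N1.*2.+1) G (N - N1 + j)%N = \sum_(N - N1 <= i < N + N1.+1) G i.
  rewrite -[X in \sum_(X <= _ < _) _]add0n big_addn.
  have -> : (N + N1.+1 - (N - N1) = N1.*2.+1)%N by lia.
  by rewrite big_mkord; apply: eq_bigr => j _; rewrite addnC.
rewrite -(big_mkord xpredT G) (@big_cat_nat _ _ _ (N - N1) 0) //=; last lia.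
rewrite (@big_cat_nat _ _ _ (N + N1.+1) (N - N1) N.*2) //=; [|lia|lia].
rewrite addrCA lerDl addr_ge0 //.
  rewrite big_nat; apply: sumr_ge0 => i /andP[_ iN]; apply: G0; lia.
rewrite big_nat; apply: sumr_ge0 => i /andP[_ iN]; apply: G0; lia.
Qed.

End Eventually.

Section Propagation.
Variables (R : realType) (X : pmetricType R) (f : X -> X).
Variable mu : probability (borelType X) R.
Hypotheses (cX : compact [set: X]) (cf : continuous f) (inv : invariant_measure f mu).
Variables v w : X -> R.
Hypotheses (cv : continuous v) (cw : continuous w).
Variables (E0 r C V s0 : R).
Hypotheses (r0 : 0 < r) (r1 : r <= 1) (C0 : 0 < C) (V0 : 0 <= V).
Hypotheses (vV : forall x, `|v x| <= V) (wC : forall x, `|w x| <= C).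
Implicit Types (s e eta kap sig delta eps : R) (x : X) (n m N k : nat).

Local Notation mean := (mean mu).
Local Notation growth := (growth f mu v w).

Definition lyap (E s : R) : R :=
  lyapunov_schrodinger f mu (fun x => E - v x - s * w x).

Definition lyap_zero delta := forall E, `|E - E0| <= r -> lyap E (s0 + delta) <= 0.

(** Upper semicontinuity at each energy and compactness of the energy interval give a height valid
    for all x at once. The threshold N may depend on x and eta: it is used only on a finite grid
    fixed after eta. *)
Lemma growth_small delta eps : lyap_zero delta -> 0 < eps ->
  exists2 eta0, 0 < eta0 & forall eta, 0 < eta < eta0 -> forall x : R, `|x| <= 1 ->
    exists N, forall n, (N <= n)%N -> (0 < n)%N ->
      growth ((E0 + r * x) +i* eta) (s0 + delta)%:C n <= eps * n%:R.
Proof.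
move=> Z eps0.
pose P eta E := 0 < eta -> exists N, forall n, (N <= n)%N -> (0 < n)%N ->
      growth (E +i* eta) (s0 + delta)%:C n <= eps * n%:R.
have cov := (compact_near_coveringP _).1 (@segment_compact R (E0 - r) (E0 + r)).
have : \forall eta \near nbhs (0 : R), [set` `[E0 - r, E0 + r]] `<=` P eta.
  apply: cov => E; rewrite /= in_itv /= => /andP[E1 E2].
  have e2 : 0 < eps / 2 by rewrite divr_gt0.
  have ZE : lyap E (s0 + delta) <= 0 by apply: Z; rewrite ler_norml; lra.
  have [n0 n0p hn0] := lyapunov_le0_growth cX cf inv cv cw (fun _ => erefl) ZE e2.
  have [rho rho0 H] := growth_usc cX cf inv cv cw n0p e2 hn0.
  have rho2 : 0 < rho / 2 by rewrite divr_gt0.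
  exists (ball E (rho / 2), ball (0 : R) (rho / 2)).
    by split; exact: nbhsx_ballx.
  move=> [E' eta] [/= B1 B2] eta0.
  have [|N HN] := H (E' +i* eta).
    apply: le_lt_trans (normc_le_Re_Im _) _; rewrite !reim /= subr0.
    move: B1 B2; rewrite /ball /= sub0r normrN distrC; lra.
  by exists N => n Nn np; have := HN n Nn np; rewrite -splitr.
move=> /nbhs_ballP[eta0 /= eta00 H]; exists eta0 => // eta /andP[e0 e1] x x1.
apply: (H eta _ (E0 + r * x)) => //.
  by rewrite /ball /= sub0r normrN gtr0_norm.
rewrite /= in_itv /=.
have : `|r * x| <= r by rewrite normrM gtr0_norm // ler_piMr // ltW.
by rewrite ler_norml => /andP[h1 h2]; apply/andP; split; lra.
Qed.

Definition orbit_sample n N eta x : sample R := Sample (orb f v x) (orb f w x) n N eta.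

Lemma orbit_sample_good n N eta x : (0 < n)%N -> (0 < N)%N -> 0 < eta <= 1 ->
  good C V (orbit_sample n N eta x).
Proof. by move=> n0 N0 e; split => //= k; [exact: vV|exact: wC]. Qed.

Lemma curve_pot_orbit n N eta x sig kap (t : R) :
  curve_pot E0 r (orbit_sample n N eta x) sig kap t =
  xpot f v w ((E0 + r * t) +i* eta) (sig + kap * (1 - t ^+ 2)) n x.
Proof.
rewrite /curve_pot /xpot /=; congr (pot _ _ _ _ _).
  by rewrite /zcurve; apply: complexP; rewrite !reim /=; ring.
by rewrite /scurve !expr2; apply: complexP; rewrite !reim /=; ring.
Qed.

Section Samples.
Variables (n N : nat) (eta : R).
Hypotheses (n0 : (0 < n)%N) (N0 : (0 < N)%N) (eta01 : 0 < eta <= 1).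

Lemma continuous_curve_pot sig kap t :
  continuous (fun x => curve_pot E0 r (orbit_sample n N eta x) sig kap t).
Proof.
rewrite (_ : (fun _ => _) = xpot f v w ((E0 + r * t) +i* eta) (sig + kap * (1 - t ^+ 2)) n).
  move=> x; apply: (continuous_xpot cf cv cw eta01); exact: lexx.
by apply/funext => x; rewrite curve_pot_orbit.
Qed.

Definition avg_pot sig kap t : R :=
  mean (fun x => curve_pot E0 r (orbit_sample n N eta x) sig kap t).

Lemma avg_potE sig kap t : avg_pot sig kap t =
  mean (xpot f v w ((E0 + r * t) +i* eta) (sig + kap * (1 - t ^+ 2)) n).
Proof. by congr (mean _); apply/funext => x; rewrite curve_pot_orbit. Qed.

Lemma avg_pot_ge sig kap t : - (ln (2 / eta) / n%:R) <= avg_pot sig kap t.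
Proof. by rewrite avg_potE; exact: mean_xpot_ge. Qed.

Lemma continuous_mean_pot m sig kap :
  continuous (fun x => mean_pot E0 r (orbit_sample n N eta x) m sig kap).
Proof.
move=> x; apply: cvgM; first exact: cvg_cst.
have := @continuous_sum R X _ (index_enum 'I_(N.*2)) (fun i x =>
  curve_pot E0 r (orbit_sample n N eta x) sig kap (gridx R N i) * (1 - gridx R N i ^+ 2) ^+ m).
by apply=> i y; apply: cvgM; [exact: continuous_curve_pot|exact: cvg_cst].
Qed.

Lemma mean_mean_pot m sig kap :
  mean (fun x => mean_pot E0 r (orbit_sample n N eta x) m sig kap) =
  N%:R^-1 * \sum_(i < N.*2) avg_pot sig kap (gridx R N i) * (1 - gridx R N i ^+ 2) ^+ m.
Proof.
have cF (i : 'I_(N.*2)) : continuous (fun x =>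
  (1 - gridx R N i ^+ 2) ^+ m * curve_pot E0 r (orbit_sample n N eta x) sig kap (gridx R N i)).
  by move=> y; apply: cvgM; [exact: cvg_cst|exact: continuous_curve_pot].
transitivity (mean (fun x => N%:R^-1 * \sum_(i < N.*2)
  (1 - gridx R N i ^+ 2) ^+ m * curve_pot E0 r (orbit_sample n N eta x) sig kap (gridx R N i))).
  congr (mean _); apply/funext => x; congr (_ * _).
  by apply: eq_bigr => i _; rewrite mulrC.
rewrite meanZ //; last exact: continuous_sum.
congr (_ * _); rewrite mean_sum //; apply: eq_bigr => i _.
rewrite meanZ //; first by rewrite mulrC.
exact: continuous_curve_pot.
Qed.

Lemma mean_mean_pot_le m sig kap d : 0 <= d ->
  (forall i, (i < N.*2)%N -> `|avg_pot sig kap (gridx R N i)| <= d) ->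
  `|mean (fun x => mean_pot E0 r (orbit_sample n N eta x) m sig kap)| <= 2 * d.
Proof.
move=> d0 H; rewrite mean_mean_pot normrM ger0_norm ?invr_ge0 // ler_pdivrMl ?ltr0n //.
apply: le_trans (ler_norm_sum _ _ _) _.
apply: (@le_trans _ _ (\sum_(i < N.*2) d)).
  apply: ler_sum => i _; rewrite normrM -[leRHS]mulr1; apply: ler_pM => //.
    exact: H.
  have x1 : `|gridx R N i| <= 1 by exact: (@gridpt_Re R N N0 i 0 (ltnW (ltn_ord i))).
  have x2 : gridx R N i ^+ 2 <= 1 by rewrite -real_normK ?num_real // expr_le1.
  have x3 := sqr_ge0 (gridx R N i).
  by rewrite normrX exprn_ile1 // ger0_norm ?subr_ge0 //; lra.
by rewrite sumr_const card_ord -[_ *+ N.*2]mulr_natl -muln2 natrM; lra.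
Qed.

End Samples.
End Propagation.

Section MainStep.
Variables (R : realType) (X : pmetricType R) (f : X -> X).
Variable mu : probability (borelType X) R.
Hypotheses (cX : compact [set: X]) (cf : continuous f) (inv : invariant_measure f mu).
Variables v w : X -> R.
Hypotheses (cv : continuous v) (cw : continuous w).
Variables (E0 r C V s0 : R).
Hypotheses (r0 : 0 < r) (r1 : r <= 1) (C0 : 0 < C) (V0 : 0 <= V).
Hypotheses (vV : forall x, `|v x| <= V) (wC : forall x, `|w x| <= C).
Implicit Types (s e eta kap sig delta eps : R) (x : X) (n m N k q : nat).

Local Notation mean := (mean mu).
Local Notation growth := (growth f mu v w).
Local Notation lyap_zero := (lyap_zero f mu v w E0 r s0).
Local Notation avg_pot := (avg_pot f mu v w E0 r).
Local Notation orbit_sample := (orbit_sample f v w).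

Let expr_small (a d : R) : 0 <= a < 1 -> 0 < d -> exists2 m, (0 < m)%N & a ^+ m <= d.
Proof.
move=> /andP[a0 a1] d0; have a1' : `|a| < 1 by rewrite ger0_norm.
have /cvgrPdist_le/(_ _ d0)[M _ HM] := cvg_expr a1'.
exists M.+1 => //; have := HM M.+1 (leqnSn _).
by rewrite /= sub0r normrN ger0_norm // exprn_ge0.
Qed.

Let large_q (K eps : R) : 0 < K -> 0 < eps -> exists2 q, (8 <= q)%N &
  K / ln (q%:R / 4) <= eps /\ 2 / q%:R ^+ 4 <= eps.
Proof.
move=> K0 e0; pose A := 4 * expR (K / eps) + 2 / eps.
have A0 : 0 <= A by rewrite addr_ge0 ?divr_ge0 ?mulr_ge0 ?expR_ge0 // ltW.
exists ((Num.truncn A).+1 + 8)%N; first exact: leq_addl.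
set q := (_ + 8)%N.
have Aq : A < q%:R.
  by apply: lt_le_trans (truncnS_gt _) _; rewrite ler_nat leq_addr.
have q1 : 1 <= q%:R :> R by rewrite ler1n /q addnS.
have qp : 0 < q%:R :> R by exact: lt_le_trans ltr01 q1.
have e1 := expR_gt0 (K / eps); have e2 : 0 < 2 / eps by rewrite divr_gt0.
split.
  have h : K / eps <= ln (q%:R / 4).
    rewrite -[leLHS]expRK ler_ln ?posrE ?divr_gt0 // ler_pdivlMr // mulrC.
    by apply/ltW; apply: le_lt_trans Aq; rewrite lerDl ltW.
  have l0 : 0 < ln (q%:R / 4) :> R by apply: lt_le_trans h; exact: divr_gt0.
  by rewrite ler_pdivrMr // mulrC -ler_pdivrMr.
apply: (@le_trans _ _ (2 / q%:R)).
  by rewrite ler_wpM2l // lef_pV2 ?posrE ?exprn_gt0 // ler_eXnr.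
rewrite ler_pdivrMr // mulrC -ler_pdivrMr //.
by apply/ltW; apply: le_lt_trans Aq; rewrite lerDr mulr_ge0 // ltW.
Qed.

(** Only finitely many admissible heights have to be intersected. The lists in use are indexed by a
    type containing proofs, so membership is expressed by [List.In]. *)
Let common_scale (I : Type) (l : seq I) (P : I -> R -> Prop) :
  (forall i, exists2 a, 0 < a & forall eta, 0 < eta < a -> P i eta) ->
  exists eta, 0 < eta <= 1 /\ forall i, List.In i l -> P i eta.
Proof.
move=> H; suff [a a0 Ha] : exists2 a, 0 < a &
    forall eta, 0 < eta < a -> forall i, List.In i l -> P i eta.
  exists (Num.min 1 (a / 2)); split.
    by rewrite lt_min ltr01 divr_gt0 // ge_min lexx.
  apply: Ha; rewrite lt_min ltr01 divr_gt0 //= gt_min; apply/orP; right; lra.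
elim: l => [|i l [a a0 Ha]]; first by exists 1.
have [b b0 Hb] := H i; exists (Num.min a b); first by rewrite lt_min a0.
move=> eta /andP[e0]; rewrite lt_min => /andP[ea eb] j /= [<-|jl].
  by apply: Hb; rewrite e0.
by apply: Ha => //; rewrite e0.
Qed.

Let eventually_list (I : Type) (l : seq I) (P : I -> nat -> Prop) :
  (forall i, List.In i l -> exists N, forall n, (N <= n)%N -> P i n) ->
  exists N, forall n, (N <= n)%N -> forall i, List.In i l -> P i n.
Proof.
elim: l => [|i l IH] H; first by exists 0%N.
have [N1 h1] := IH (fun j jl => H j (or_intror jl)).
have [N2 h2] := H i (or_introl erefl).
exists (maxn N1 N2) => n; rewrite geq_max => /andP[n1 n2] j /= [<-|jl].
  exact: h2.
exact: h1.
Qed.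

Let ler_sum_In (I : Type) (l : seq I) (F G : I -> R) :
  (forall i, List.In i l -> F i <= G i) -> \sum_(i <- l) F i <= \sum_(i <- l) G i.
Proof.
elim: l => [|i l IH] H; first by rewrite !big_nil.
rewrite !big_cons; apply: lerD; first by apply: H; left.
by apply: IH => j jl; apply: H; right.
Qed.

Lemma avg_center_le n N1 q eta kap : (0 < n)%N -> 0 < eta <= 1 -> (8 <= q)%N -> (0 < N1)%N ->
  4 * (C * `|kap|) <= r -> `|kap| <= 1 -> ln (3 / eta) <= N1%:R ->
  avg_pot n (q ^ 3 * N1) eta s0 kap 0 <=
    (N1.*2.+1)%:R^-1 * \sum_(j < N1.*2.+1)
      avg_pot n (q ^ 3 * N1) eta s0 kap (gridx R (q ^ 3 * N1) (q ^ 3 * N1 - N1 + j)) +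
    3 * (6 + ln (curve_Q E0 C V s0 + 1) + ln (2 / eta) / n%:R) / ln (q%:R / 4) +
    2 / q%:R ^+ 4.
Proof.
move=> n0 eta01 q8 N10 kr k1 lnN; set N := (q ^ 3 * N1)%N.
have N0 : (0 < N)%N by rewrite muln_gt0 N10 expn_gt0 (leq_trans _ q8).
have cF t : continuous (fun x => curve_pot E0 r (orbit_sample n N eta x) s0 kap t).
  exact: continuous_curve_pot.
have cS : continuous (fun x => \sum_(j < N1.*2.+1)
    curve_pot E0 r (orbit_sample n N eta x) s0 kap (gridx R N (N - N1 + j))).
  by apply: continuous_sum => j; exact: cF.
have cc (a : R) : continuous (fun _ : X => a) by exact: cst_continuous.
rewrite -addrA; set B := (X in _ <= _ + X).
apply: (@le_trans _ _ (mean (fun x => (N1.*2.+1)%:R^-1 * (\sum_(j < N1.*2.+1)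
    curve_pot E0 r (orbit_sample n N eta x) s0 kap (gridx R N (N - N1 + j))) + B))).
  apply: mean_le => //.
    by move=> x; apply: cvgD; [apply: cvgM; [exact: cc|exact: cS]|exact: cc].
  move=> x; have gp := orbit_sample_good f vV wC x n0 N0 eta01.
  have := @center_le R E0 r C V s0 r0 r1 C0 V0 _ kap q N1 gp kr k1 q8 N10 erefl lnN.
  by rewrite -addrA.
rewrite meanD //; last by move=> x; apply: cvgM; [exact: cc|exact: cS].
by rewrite meanZ // mean_sum // mean_cst.
Qed.

Lemma avg_transfer n N eta m kap (l : seq (R * (nat * {delta | lyap_zero delta}))) b :
  (0 < n)%N -> (0 < N)%N -> 0 < eta <= 1 ->
  (forall p, good C V p -> pn p = n -> pN p = N -> peta p = eta ->
     mean_pot E0 r p m s0 kap <=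
     \sum_(y <- l) y.1 * mean_pot E0 r p y.2.1 (s0 + sval y.2.2) 0 + b) ->
  mean (fun x => mean_pot E0 r (orbit_sample n N eta x) m s0 kap) <=
  \sum_(y <- l) y.1 *
    mean (fun x => mean_pot E0 r (orbit_sample n N eta x) y.2.1 (s0 + sval y.2.2) 0) + b.
Proof.
move=> n0 N0 eta01 H.
have cF k s kap' : continuous (fun x => mean_pot E0 r (orbit_sample n N eta x) k s kap').
  exact: continuous_mean_pot.
have cc (a : R) : continuous (fun _ : X => a) by exact: cst_continuous.
have cG (y : R * (nat * {delta | lyap_zero delta})) : continuous (fun x =>
    y.1 * mean_pot E0 r (orbit_sample n N eta x) y.2.1 (s0 + sval y.2.2) 0).
  by move=> x; apply: cvgM; [exact: cc|exact: cF].
have cS := @continuous_sum _ _ _ l _ cG.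
apply: (@le_trans _ _ (mean (fun x => \sum_(y <- l)
    y.1 * mean_pot E0 r (orbit_sample n N eta x) y.2.1 (s0 + sval y.2.2) 0 + b))).
  apply: mean_le => //; first by move=> x; apply: cvgD; [exact: cS|exact: cc].
  by move=> x; apply: H => //; exact: orbit_sample_good.
rewrite meanD // mean_cst mean_sum // lerD2r; apply: ler_sum => y _.
by rewrite meanZ.
Qed.

(** The parameters are fixed in the order q, m, the list with c, eta, N1, n. Each may depend on the
    earlier ones only, and the errors are arranged to add up to eight times eps / 8. *)
Theorem lyap_propagation kap :
  (forall eps, 0 < eps -> exists2 delta, lyap_zero delta & 0 < `|delta| < eps) ->
  36 * (C * `|kap|) <= r -> `|kap| <= 1 ->
  lyap f mu v w E0 (s0 + kap) <= 0.
Proof.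
move=> acc kr k1.
have kC0 : 0 <= C * `|kap| by rewrite mulr_ge0 // ltW.
apply: (growth_lyapunov_le0 cX cf inv cv cw (fun _ => erefl)) => eps eps0.
have e8 : 0 < eps / 8 by rewrite divr_gt0.
pose lnQ := ln (curve_Q E0 C V s0 + 1).
have lnQ0 : 0 <= lnQ by rewrite ln_ge0 // lerDr curve_Q_ge0.
(* The final 1 stands for ln (2 / eta) / n: q must be chosen before eta, and n is later taken so
   large that this term is at most 1. *)
pose K := 3 * (6 + lnQ + 1).
have K0 : 0 < K by rewrite /K; lra.
have [q q8 [hq1 hq2]] := large_q K0 e8.
have qp : 0 < q%:R :> R by rewrite ltr0n (leq_trans _ q8).
pose q3 : R := q%:R ^+ 3.
have q30 : 0 < q3 by rewrite exprn_gt0.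
have a01 : 0 <= (2 / 3 : R) < 1 by apply/andP; split; lra.
(* The truncation error will be 8 L (1/2)^m = 4 q^3 (2/3)^m, which has to be at most eps / 8. The
   1/2 is 18 C |kap| / r and comes from the factor 36 in the hypothesis. *)
have b0 : 0 < eps / (32 * q3) by rewrite divr_gt0 // mulr_gt0.
have [m m0 hm] := expr_small a01 b0.
(* Price of passing from the weighted average on [-1, 1] to the plain average on the window: q^3 / 2
   bounds N / (2 N1 + 1) and (4/3)^m removes the weight. *)
pose L := q3 / 2 * (4 / 3) ^+ m.
have L0 : 0 < L by rewrite mulr_gt0 ?divr_gt0 // exprn_gt0 // divr_gt0.
pose eps1 := eps / 8 / L.
have eps10 : 0 < eps1 by rewrite divr_gt0.
have kr12 : 12 * (C * `|kap|) <= r by lra.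
have [l _ [c c0 hl]] := @transfer R E0 r C V s0 r0 r1 C0 V0 lyap_zero m kap acc m0 kr12 k1 eps1 eps10.
pose Sl := \sum_(x <- l) `|x.1|.
have Sl0 : 0 <= Sl by apply: sumr_ge0.
pose eps2 := eps / (16 * L * (Sl + 1)).
have eps20 : 0 < eps2 by rewrite divr_gt0 // !mulr_gt0 // ltr_wpDl.
pose Q (y : R * (nat * {delta | lyap_zero delta})) eta := forall x : R, `|x| <= 1 ->
    exists N, forall n, (N <= n)%N -> (0 < n)%N ->
      growth ((E0 + r * x) +i* eta) (s0 + sval y.2.2)%:C n <= eps2 * n%:R.
have QE y : exists2 a : R, 0 < a & forall eta, 0 < eta < a -> Q y eta.
  exact: (growth_small cX cf inv cv cw r0 (svalP y.2.2) eps20).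
have [eta [eta01 Heta]] := common_scale l QE.
have /andP[eta0 eta1] := eta01.
pose cc := curve_const E0 C V s0 eta.
have cc0 : 0 <= cc by exact: curve_const_ge0.
(* The first term meets the mesh condition of the window estimate, the second makes the grid error c
   cc / N at most eps / (8 L). *)
pose N1 := (Num.truncn (`|ln (3 / eta)| + c * cc / (eps / 8 / L))).+1.
have N1b : `|ln (3 / eta)| + c * cc / (eps / 8 / L) <= N1%:R.
  by apply/ltW/truncnS_gt.
have cce : 0 <= c * cc / (eps / 8 / L) by apply: divr_ge0; [rewrite mulr_ge0|rewrite ltW].
have lnN1 : ln (3 / eta) <= N1%:R.
  by apply: le_trans (ler_norm _) _; lra.
have N10 : (0 < N1)%N by [].
have N1R : 0 < N1%:R :> R by rewrite ltr0n.
pose N := (q ^ 3 * N1)%N.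
have q3n : (2 <= q ^ 3)%N.
  apply: leq_trans (leq_trans q8 _) => //.
  by rewrite -[X in (X <= _)%N]expn1 leq_exp2l // (leq_trans _ q8).
have N0 : (0 < N)%N by rewrite muln_gt0 N10 (leq_trans _ q3n).
have NR : 0 < N%:R :> R by rewrite ltr0n.
have N12 : (2 * N1 <= N)%N by rewrite leq_mul2r q3n orbT.
have N1N : N1%:R <= N%:R :> R by rewrite ler_nat /N leq_pmull // (leq_trans _ q3n).
have errN : c * (cc / N%:R) <= eps / 8 / L.
  rewrite mulrA ler_pdivrMr // [leRHS]mulrC -ler_pdivrMr ?divr_gt0 //.
  by apply: le_trans N1N; have := normr_ge0 (ln (3 / eta)); lra.
pose A := ln (2 / eta).
have A0 : 0 <= A by rewrite ln_ge0 // ler_pdivlMr // mul1r; lra.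
have eta2 : 0 < eta ^+ 2 by rewrite exprn_gt0.
(* The three bounds on ln (2 / eta) / n serve the constant [K], the lower bound of the potentials at
   the points of the list, and the shift in the window sum. *)
have m1pos : 0 < Num.min 1 (Num.min eps2 (eps / 16 / L)).
  by rewrite !lt_min ltr01 eps20 !divr_gt0.
have [M1 hM1] := eventually_div A m1pos.
have [M2 hM2] := eventually_div (ln (4 / eta ^+ 2)) e8.
have x1 i : (i < N.*2)%N -> `|gridx R N i| <= 1.
  by move=> iN; exact: (@gridpt_Re R N N0 i 0 (ltnW iN)).
have [M3 hM3] : exists M3, forall n, (M3 <= n)%N -> forall y, List.In y l ->
    forall i, (i < N.*2)%N -> (0 < n)%N ->
    growth ((E0 + r * gridx R N i) +i* eta) (s0 + sval y.2.2)%:C n <= eps2 * n%:R.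
  apply: eventually_list => y yl; apply: eventually_finite => i iN.
  exact: Heta (x1 _ iN).
exists (maxn M1 (maxn M2 M3)) => n; rewrite !geq_max => /and3P[nM1 nM2 nM3] n0.
have nR : 0 < n%:R :> R by rewrite ltr0n.
have := hM1 n nM1 n0; rewrite !le_min => /and3P[An1 An2 An3].
have An0 : 0 <= A / n%:R by rewrite divr_ge0 // ltW.
have B2 := hM2 n nM2 n0; have B3 := hM3 n nM3.
have n1g : n%:R^-1 * growth E0%:C (s0 + kap)%:C n <= avg_pot n N eta s0 kap 0 + eps / 8.
  rewrite avg_potE mulr0 addr0 expr0n subr0 mulr1.
  apply: le_trans (_ : _ <= n%:R^-1 * growth (E0 +i* eta) (s0 + kap)%:C n) _.
    by rewrite ler_wpM2l ?invr_ge0 // growth_real_mono // ltW.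
  apply: le_trans (growth_le_mean_xpot mu cX cf cv cw _ eta01 _ n) _; first exact: lexx.
  by rewrite lerD2l.
have lq0 : 0 < ln (q%:R / 4) :> R.
  by apply: ln_gt0; rewrite ltr_pdivlMr // mul1r ltr_nat (leq_trans _ q8).
have kr4 : 4 * (C * `|kap|) <= r by apply: le_trans kr; rewrite ler_wpM2r // ler_nat.
have cen : avg_pot n N eta s0 kap 0 <= (N1.*2.+1)%:R^-1 *
    (\sum_(j < N1.*2.+1) avg_pot n N eta s0 kap (gridx R N (N - N1 + j))) + eps / 4.
  apply: le_trans (avg_center_le n0 eta01 q8 N10 kr4 k1 lnN1) _.
  rewrite -addrA lerD2l (_ : eps / 4 = eps / 8 + eps / 8); last by field.
  apply: lerD => //; apply: le_trans hq1; rewrite ler_wpM2r ?invr_ge0 ?(ltW lq0) //.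
  by rewrite ler_wpM2l // lerD2l.
pose MM := mean (fun x => mean_pot E0 r (orbit_sample n N eta x) m s0 kap).
pose T := \sum_(i < N.*2) (avg_pot n N eta s0 kap (gridx R N i) + A / n%:R) *
    (1 - gridx R N i ^+ 2) ^+ m.
have w01 (i : 'I_(N.*2)) : 0 <= (1 - gridx R N i ^+ 2) ^+ m <= 1.
  have x2 : gridx R N i ^+ 2 <= 1 by rewrite -real_normK ?num_real // expr_le1 // x1.
  have x3 := sqr_ge0 (gridx R N i).
  have x4 : 0 <= 1 - gridx R N i ^+ 2 by rewrite subr_ge0.
  by rewrite exprn_ge0 // exprn_ile1 // lerBlDr lerDl.
have Flow i : - (A / n%:R) <= avg_pot n N eta s0 kap (gridx R N i) by exact: avg_pot_ge.
have T0 : 0 <= T.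
  apply: sumr_ge0 => i _; have /andP[h _] := w01 i.
  by rewrite mulr_ge0 // -lerBlDr sub0r.
have TN : T <= N%:R * (MM + 2 * (A / n%:R)).
  have -> : MM = N%:R^-1 * \sum_(i < N.*2) avg_pot n N eta s0 kap (gridx R N i) *
      (1 - gridx R N i ^+ 2) ^+ m by exact: mean_mean_pot.
  rewrite mulrDr mulVKf ?gt_eqF // /T.
  under eq_bigr do rewrite mulrDl.
  rewrite big_split lerD2l /=.
  apply: (@le_trans _ _ (\sum_(i < N.*2) A / n%:R)).
    by apply: ler_sum => i _; have /andP[_ h] := w01 i; rewrite ler_piMr.
  by rewrite sumr_const card_ord -[_ *+ N.*2]mulr_natl -muln2 natrM -mulrA.
have win : (N1.*2.+1)%:R^-1 *
    (\sum_(j < N1.*2.+1) avg_pot n N eta s0 kap (gridx R N (N - N1 + j))) <=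
    L * (MM + 2 * (A / n%:R)).
  have d0 : 0 < (N1.*2.+1)%:R :> R by rewrite ltr0n.
  have M2A : 0 <= MM + 2 * (A / n%:R).
    by rewrite -(pmulr_rge0 _ NR); exact: le_trans TN.
  rewrite ler_pdivrMl //.
  apply: le_trans (window_sum_le m N10 N12 An0 Flow) _; rewrite -/T.
  apply: (@le_trans _ _ ((4 / 3) ^+ m * (N%:R * (MM + 2 * (A / n%:R))))).
    by rewrite ler_wpM2l // exprn_ge0 // divr_ge0.
  rewrite /L (_ : N%:R = q3 * N1%:R); last by rewrite /N natrM natrX.
  have -> : (N1.*2.+1)%:R = N1%:R * 2 + 1 :> R by rewrite -addn1 natrD -muln2 natrM.
  have h43 : 0 <= (4 / 3) ^+ m :> R by rewrite exprn_ge0 // divr_ge0.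
  have h : 0 <= q3 * (4 / 3) ^+ m * (MM + 2 * (A / n%:R)).
    by rewrite mulr_ge0 // mulr_ge0 // ltW.
  rewrite (_ : q3 / 2 * _ * _ = q3 * (4 / 3) ^+ m * (MM + 2 * (A / n%:R)) / 2); last first.
    by field; rewrite gt_eqF.
  rewrite (_ : (4 / 3) ^+ m * _ = N1%:R * 2 * (q3 * (4 / 3) ^+ m * (MM + 2 * (A / n%:R)) / 2)).
    by rewrite ler_wpM2r ?lerDl // divr_ge0.
  by field; rewrite gt_eqF.
have tr : MM <= \sum_(y <- l) y.1 *
    mean (fun x => mean_pot E0 r (orbit_sample n N eta x) y.2.1 (s0 + sval y.2.2) 0) +
    (eps1 + 8 * (`|kap| * (18 * C / r)) ^+ m + c * (cc / N%:R)).
  apply: avg_transfer => // p gp pnE pNE petaE.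
  by have := hl p gp; rewrite /err pNE petaE.
(* The coefficients have either sign, so a two-sided bound is required: from above by the vanishing
   exponents, from below by the positive height. *)
have node : \sum_(y <- l) y.1 *
    mean (fun x => mean_pot E0 r (orbit_sample n N eta x) y.2.1 (s0 + sval y.2.2) 0) <=
    Sl * (2 * eps2).
  rewrite mulr_suml; apply: ler_sum_In => y yl.
  apply: le_trans (ler_norm _) _; rewrite normrM ler_wpM2l //.
  apply: mean_mean_pot_le => //; first exact: ltW.
  move=> i iN; rewrite ler_norml; apply/andP; split.
    apply: (@le_trans _ _ (- (A / n%:R))); first by rewrite lerN2.
    exact: avg_pot_ge.
  rewrite avg_potE mul0r addr0.
  apply: (@le_trans _ _ (n%:R^-1 *
      growth ((E0 + r * gridx R N i) +i* eta) (s0 + sval y.2.2)%:C n)).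
    by apply: (mean_xpot_le mu cX cf cv cw _ eta01); exact: lexx.
  by rewrite ler_pdivrMl // [leRHS]mulrC; exact: (B3 y yl i iN n0).
have small1 : L * (Sl * (2 * eps2)) <= eps / 8.
  have -> : L * (Sl * (2 * eps2)) = Sl / (Sl + 1) * (eps / 8).
    by rewrite /eps2; field; rewrite !gt_eqF // ltr_wpDl.
  by rewrite ler_piMl ?(ltW e8) // ler_pdivrMr ?ltr_wpDl // mul1r lerDl.
have small2 : L * eps1 = eps / 8 by rewrite /eps1 mulrC divfK // gt_eqF.
have small3 : L * (8 * (`|kap| * (18 * C / r)) ^+ m) <= eps / 8.
  have hk : 0 <= `|kap| * (18 * C / r) <= 1 / 2.
    rewrite mulr_ge0 ?divr_ge0 ?mulr_ge0 // ?(ltW C0) ?(ltW r0) //=.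
    by rewrite mulrA ler_pdivrMr //; move: kr; lra.
  have hkm : (`|kap| * (18 * C / r)) ^+ m <= (1 / 2) ^+ m.
    by have /andP[h1 h2] := hk; rewrite lerXn2r ?nnegrE // divr_ge0.
  apply: (@le_trans _ _ (L * (8 * (1 / 2) ^+ m))).
    by rewrite ler_wpM2l ?(ltW L0) // ler_wpM2l.
  rewrite (_ : L * _ = 4 * q3 * (2 / 3) ^+ m); last first.
    rewrite /L (_ : (2 / 3) ^+ m = (4 / 3) ^+ m * (1 / 2) ^+ m); first by field.
    by rewrite -exprMn; congr (_ ^+ _); field.
  apply: (@le_trans _ _ (4 * q3 * (eps / (32 * q3)))).
    by rewrite ler_wpM2l // mulr_ge0 // ltW.
  by rewrite le_eqVlt; apply/orP; left; apply/eqP; field; rewrite gt_eqF.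
have small4 : L * (c * (cc / N%:R)) <= eps / 8.
  by rewrite mulrC -ler_pdivlMr.
have small5 : L * (2 * (A / n%:R)) <= eps / 8.
  have h : A / n%:R * L <= eps / 16 by rewrite -ler_pdivlMr.
  rewrite mulrCA [leRHS](_ : _ = 2 * (eps / 16)); last by field.
  by rewrite ler_wpM2l // mulrC.
have trL := lerD (le_trans tr (lerD node (lexx _))) (lexx (2 * (A / n%:R))).
apply: le_trans n1g _; apply: le_trans (lerD cen (lexx _)) _.
apply: le_trans (lerD (lerD (le_trans win (ler_wpM2l (ltW L0) trL)) (lexx _)) (lexx _)) _.
rewrite !mulrDr small2.
apply: (le_trans (lerD (lerD (lerD (lerD small1 (lerD (lerD (lexx _) small3) small4)) small5)
  (lexx _)) (lexx _))).
by rewrite le_eqVlt; apply/orP; left; apply/eqP; field.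
Qed.

End MainStep.

(** * Countability of the bad parameters *)

Lemma isolated_countable (R : realType) (A : set R) :
  (forall s, A s -> exists2 eps : R, 0 < eps & forall t, A t -> `|t - s| < eps -> t = s) ->
  countable A.
Proof.
(* Every point is alone in [A] within some rational interval, so the sets [F u], each with at most
   one element, cover [A]. *)
move=> H; pose I (u : rat * rat) := [set t : R | ratr u.1 < t < ratr u.2].
pose F (u : rat * rat) := [set s | [/\ A s, I u s & forall t, A t -> I u t -> t = s]].
apply: (@sub_countable _ _ _ (\bigcup_(u in [set: rat * rat]) F u)).
  apply: subset_card_le => s As; have [eps e0 iso] := H s As.
  have [|p] := @rat_in_itvoo R (s - eps) s; first lra.
  rewrite in_itv /= => /andP[p1 p2].
  have [|q] := @rat_in_itvoo R s (s + eps); first lra.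
  rewrite in_itv /= => /andP[q1 q2].
  exists (p, q) => //; split; [by []|by rewrite /I /= p2 q1|].
  move=> t At /andP[/= t1 t2]; apply: iso => //.
  by rewrite ltr_distl; lra.
apply: bigcup_countable => [|u _]; first exact: countableP.
have [->|/set0P[s [As Is Hs]]] := eqVneq (F u) set0; first exact: countable0.
apply: (@sub_countable _ _ _ [set s]); last exact: countable1.
by apply: subset_card_le => t [At It _]; exact: Hs.
Qed.

Lemma compact_bound (R : realType) (X : pmetricType R) (v : X -> R) :
  compact [set: X] -> continuous v -> exists2 V : R, 0 < V & forall x, `|v x| <= V.
Proof.
move=> cX cv; have : bounded_set (v @` [set: X]).
  by apply: compact_bounded; apply: continuous_compact => //; exact: continuous_subspaceT.
move=> [M [_ HM]]; exists (Num.max M 0 + 1); first by rewrite ltr_wpDl // le_max lexx orbT.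
move=> x; apply: HM; last by exists x.
by rewrite ltr_pwDr // le_max lexx.
Qed.

Section BadParameters.
Variables (R : realType) (X : pmetricType R) (f : X -> X).
Variable mu : probability (borelType X) R.
Hypotheses (cX : compact [set: X]) (cf : continuous f) (inv : invariant_measure f mu).
Variables v w : X -> R.
Hypotheses (cv : continuous v) (cw : continuous w).
Implicit Types (a b s E eps rho : R).

Local Notation lyap := (lyap f mu v w).

Definition nonhyperbolic a b :=
  [set s : R | s \in `[0, 1] /\ forall E, a < E < b -> lyap E s <= 0].

(** Propagation is applied with every E of the box as the centre of its own energy interval, always
    starting from the same s0. *)
Lemma accumulation_box a b s0 : a < b ->
  (forall eps, 0 < eps -> exists2 s, nonhyperbolic a b s & 0 < `|s - s0| < eps) ->
  exists2 rho, 0 < rho & forall E s, `|E - (a + b) / 2| <= rho -> `|s - s0| <= rho ->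
    lyap E s <= 0.
Proof.
move=> ab acc; have [V V0 vV] := compact_bound cX cv; have [C C0 wC] := compact_bound cX cw.
(* Energies within r of the midpoint have their own r-neighbourhood inside (a, b), so the
   accumulating parameters are admissible for each of them. *)
pose r := Num.min 1 ((b - a) / 8).
have r0 : 0 < r by rewrite lt_min ltr01 divr_gt0 // subr_gt0.
have r1 : r <= 1 by rewrite ge_min lexx.
have rab : r <= (b - a) / 8 by rewrite ge_min lexx orbT.
have rC : 0 < r / (36 * C) by rewrite divr_gt0 // mulr_gt0.
exists (Num.min r (r / (36 * C))); first by rewrite lt_min r0.
move=> E s; rewrite !le_min => /andP[/andP[_ Er] _] /andP[sr sC].
rewrite (_ : s = s0 + (s - s0)); last by rewrite addrC subrK.
apply: (lyap_propagation cX cf inv cv cw r0 r1 C0 (ltW V0) vV wC).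
- move=> eps /acc[t [_ tZ] teps]; exists (t - s0) => // E' E'r.
  rewrite addrC subrK; apply: tZ; move: E'r Er.
  by move: rab; rewrite !ler_norml; lra.
- by move: sC; rewrite ler_pdivlMr ?mulr_gt0 //; lra.
- by case/andP: sr.
Qed.

End BadParameters.

Theorem theorem5 (R : realType) (X : pmetricType R) (f : X -> X)
    (mu : probability (borelType X) R) (v0 v1 : X -> R) :
  compact [set: X] ->
  homeomorphism f ->
  invariant_measure f mu ->
  continuous v0 -> continuous v1 -> v0 <> v1 ->
  dense_subset
    [set Ev : R * {uniform X -> R} | segment v0 v1 Ev.2 /\
       0 < lyapunov_schrodinger f mu (fun x => Ev.1 - Ev.2 x)]
    ([set: R] `*` segment v0 v1) ->
  {ae lebesgue_measure, forall s : R, s \in `[0, 1] ->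
    dense [set E : R |
      0 < lyapunov_schrodinger f mu (fun x => E - segment_pt v0 v1 s x)]}.
Proof.
move=> cX [cf _] inv cv0 cv1 v01 [_ dens].
pose w x := v1 x - v0 x.
have cw : continuous w by move=> x; apply: cvgB; [exact: cv1|exact: cv0].
have segE E s : lyapunov_schrodinger f mu (fun x => E - segment_pt v0 v1 s x) =
    lyap f mu v0 w E s.
  by congr (lyapunov_schrodinger f mu _); apply/funext => x; rewrite /segment_pt /w; ring.
(* Evaluation at a point where v0 and v1 differ recovers the parameter: uniformly close potentials
   on the segment have close parameters. *)
have [y wy] : exists y, w y != 0.
  apply: contrapT => h; apply: v01; apply/funext => x; apply/esym/eqP.
  by rewrite -subr_eq0; apply: contrapT => /negP hx; apply: h; exists x.
have wy0 : 0 < `|w y| by rewrite normr_gt0.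
have iso (a b : R) : a < b -> countable (nonhyperbolic f mu v0 w a b).
  move=> ab; apply: isolated_countable => s0 Zs0; apply: contrapT => niso.
  have acc (eps : R) : 0 < eps ->
      exists2 s, nonhyperbolic f mu v0 w a b s & 0 < `|s - s0| < eps.
    move=> eps0; apply: contrapT => h; apply: niso; exists eps => // t Zt ts.
    apply: contrapT => /eqP tn; apply: h; exists t => //.
    by rewrite ts andbT normr_gt0 subr_eq0.
  have [rho rho0 box] := accumulation_box cX cf inv cv0 cw ab acc.
  have pt : ([set: R] `*` segment v0 v1) ((a + b) / 2, segment_pt v0 v1 s0).
    by split => //; exists s0 => //; case: Zs0.
  (* A neighbourhood of the centre of the box whose intersection with the segment has parameters
     within rho of s0; density produces a positive exponent in it, against the vanishing on the
     box. *)
  pose B : set (R * {uniform X -> R}) := [set E | `|E - (a + b) / 2| < rho] `*`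
      [set u : {uniform X -> R} | `|segment_pt v0 v1 s0 y - u y| < rho * `|w y|].
  have nB : nbhs ((a + b) / 2, segment_pt v0 v1 s0 : {uniform X -> R}) B.
    exists ([set E | `|E - (a + b) / 2| < rho],
        [set u : {uniform X -> R} | `|segment_pt v0 v1 s0 y - u y| < rho * `|w y|]) => //.
    split => /=.
      by apply/nbhs_ballP; exists rho => //= E; rewrite /ball /= distrC.
    apply/uniform_nbhs; exists [set u : R * R | `|u.1 - u.2| < rho * `|w y|]; split.
      by rewrite -entourage_ballE; exists (rho * `|w y|) => //=; exact: mulr_gt0.
    by move=> u /= /(_ y); apply.
  have [[E u] [/= [[s s01 su] Lpos] [/= Er uy]]] := dens _ pt _ nB.
  have : lyap f mu v0 w E s <= 0.
    apply: box; first exact: ltW.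
    move: uy; rewrite -su (_ : _ - _ = (s0 - s) * w y); last by rewrite /segment_pt /w; ring.
    by rewrite normrM ltr_pM2r // distrC => /ltW.
  by rewrite -segE leNgt su Lpos.
pose Bad := \bigcup_(u in [set u : rat * rat | (u.1 < u.2)%R])
  nonhyperbolic f mu v0 w (ratr u.1) (ratr u.2).
have cBad : countable Bad.
  apply: bigcup_countable => [|u u12]; first exact: countableP.
  by apply: iso; rewrite ltr_rat.
have mBad : measurable Bad by exact: countable_measurable.
exists Bad; split => //; first exact: countable_lebesgue_measure0.
(* An open set of energies without positive exponent contains a rational interval around one of its
   points, which puts s into [Bad]. *)
move=> s /= /not_implyP[s01 /denseNE[U [[E UE] US]]].
have [e /= e0 He] := (nbhs_ballP _ _).1 (open_nbhs_nbhs UE).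
have [|p] := @rat_in_itvoo R (E - e) E; first lra.
rewrite in_itv /= => /andP[p1 p2].
have [|q] := @rat_in_itvoo R E (E + e); first lra.
rewrite in_itv /= => /andP[q1 q2].
exists (p, q) => /=; first by rewrite -(ltr_rat R) (lt_trans p2 q1).
split=> // E' /andP[E1 E2]; rewrite leNgt; apply/negP => Lpos.
have : (U `&` [set E : R | 0 < lyapunov_schrodinger f mu (fun x => E - segment_pt v0 v1 s x)]) E'.
  split; last by rewrite /= segE.
  by apply: He; rewrite /ball /= ltr_distl; lra.
by rewrite US.
Qed.
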